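(* Let $\Lambda_L,\Lambda_R,\Lambda_{1,L},\Lambda_{1,R}$ be $(n-1)$-tuples of non-negative integers. For $\lambda\in\mathbb C$ write $\Lambda=(\Lambda_L,\Lambda_R,\lambda)$ and $\Lambda_1=(\Lambda_{1,L},\Lambda_{1,R},\lambda+c)$ with a fixed integer $c$. To any nonzero $\mathcal U_q(\mathfrak k^{\mathbb C})$-homomorphism $$\psi: V_{\Lambda_1}\to\mathcal A_q^-(1)\otimes V_\Lambda$$ (a notion that, for $\psi$ regarded as a linear map $V_{\Lambda_{1,L}}\otimes V_{\Lambda_{1,R}}\to\mathcal A_q^-(1)\otimes V_{\Lambda_L}\otimes V_{\Lambda_R}$, does not depend on $\lambda$) there corresponds a unique $\lambda$ such that the $\mathcal A_q^-\,\mathcal U_q(\mathfrak k^{\mathbb C})$-homomorphism $\psi_{\Lambda_1,\Lambda}:M(V_{\Lambda_1})\to M(V_\Lambda)$ extending $\psi$ satisfies $$\psi_{\Lambda_1,\Lambda}\in \mathrm{Hom}_{\mathcal U_q(\mathfrak g^{\mathbb C})}\bigl(M(V_{\Lambda_1}),M(V_\Lambda)\bigr).$$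
   Context: Let $q$ be the generic (not a root of unity) deformation parameter, and let $q^x$ denote its powers, $x\in\mathbb C$. Let $n\ge1$ and $\mathfrak g^{\mathbb C}=su(n,n)^{\mathbb C}=sl(2n,\mathbb C)$, with simple roots $\Pi=\{\mu_1,\dots,\mu_{n-1}\}\cup\{\beta\}\cup\{\nu_1,\dots,\nu_{n-1}\}$ arranged in the Dynkin diagram of type $A_{2n-1}$ in the order $\mu_{n-1},\dots,\mu_1,\beta,\nu_1,\dots,\nu_{n-1}$. $\mathcal U_q(\mathfrak g^{\mathbb C})$ is the quantized enveloping algebra with generators $E_\alpha,F_\alpha,K_\alpha^{\pm1}$ ($\alpha\in\Pi$), the relations $K_\alpha E_\gamma=q^{\langle\alpha,\gamma\rangle}E_\gamma K_\alpha$, $K_\alpha F_\gamma=q^{-\langle\alpha,\gamma\rangle}F_\gamma K_\alpha$, $[E_\alpha,F_\gamma]=\delta_{\alpha\gamma}\frac{K_\alpha-K_\alpha^{-1}}{q-q^{-1}}$, with the $K_\alpha$ commuting, and the quantum Serre relations; here $\langle\alpha,\alpha\rangle=2$. $\mathcal U_q(\mathfrak k^{\mathbb C})$ is the subalgebra generated by $\mathcal U_q(\mathfrak k_L^{\mathbb C})=\langle E_{\mu_i},F_{\mu_i},K_{\mu_i}^{\pm1}\rangle$, $\mathcal U_q(\mathfrak k_R^{\mathbb C})=\langle E_{\nu_i},F_{\nu_i},K_{\nu_i}^{\pm1}\rangle$ and $K_\beta^{\pm1}$. The elements $W_{i,j}$, $1\le i,j\le n$, are obtained from $F_\beta$ by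 Lusztig operators; explicitly $W_{1,1}=F_\beta$, $W_{i+1,j}=W_{i,j}F_{\mu_i}-qF_{\mu_i}W_{i,j}$, $W_{i,j+1}=W_{i,j}F_{\nu_j}-qF_{\nu_j}W_{i,j}$. Similarly $Z_{1,1}=E_\beta$, $Z_{i+1,j}=E_{\mu_i}Z_{i,j}-q^{-1}Z_{i,j}E_{\mu_i}$, $Z_{i,j+1}=E_{\nu_j}Z_{i,j}-q^{-1}Z_{i,j}E_{\nu_j}$. $\mathcal A_q^-$ (resp. $\mathcal A_q^+$) is the subalgebra generated by all $W_{i,j}$ (resp. $Z_{i,j}$). It is a quadratic algebra graded by degree, with $W_{i,j}$ of degree $1$; $\mathcal A_q^-(1)$ is the linear span of the $W_{i,j}$. One has $\mathcal U_q(\mathfrak g^{\mathbb C})=\mathcal A_q^-\cdot\mathcal U_q(\mathfrak k^{\mathbb C})\cdot\mathcal A_q^+$. A highest weight is a triple $\Lambda=(\Lambda_L,\Lambda_R,\lambda)$ with $\Lambda_L=(\lambda_1^\mu,\dots,\lambda_{n-1}^\mu)$, $\Lambda_R=(\lambda_1^\nu,\dots,\lambda_{n-1}^\nu)$ tuples of non-negative integers and $\lambda\in\mathbb C$. $V_\Lambda$ is the finite dimensional irreducible $\mathcal U_q(\mathfrak k^{\mathbb C})$-module generated by a nonzero vector $v_\Lambda$ annihilated by all $E_{\mu_i},E_{\nu_i}$ and with $K_{\mu_i}v_\Lambda=q^{\lambda_i^\mu}v_\Lambda$, $K_{\nu_i}v_\Lambda=q^{\lambda_i^\nu}v_\Lambda$,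 $K_\beta v_\Lambda=q^\lambda v_\Lambda$. As a vector space $V_\Lambda=V_{\Lambda_L}\otimes V_{\Lambda_R}$. It is extended to $\mathcal U_q(\mathfrak k^{\mathbb C})\mathcal A_q^+$ by letting $\mathcal A_q^+$ act trivially (the $Z_{i,j}$ act by $0$), and the quantized generalized Verma module is $M(V_\Lambda)=\mathcal U_q(\mathfrak g^{\mathbb C})\otimes_{\mathcal U_q(\mathfrak k^{\mathbb C})\mathcal A_q^+}V_\Lambda$, which as a vector space is $\mathcal A_q^-\otimes V_\Lambda$. The space $\mathcal A_q^-(1)\otimes V_\Lambda$ is a $\mathcal U_q(\mathfrak k^{\mathbb C})$-submodule of $M(V_\Lambda)$. Any $\mathcal U_q(\mathfrak k^{\mathbb C})$-homomorphism $V_{\Lambda_1}\to\mathcal A_q^-(1)\otimes V_\Lambda$ extends uniquely to an $\mathcal A_q^-\mathcal U_q(\mathfrak k^{\mathbb C})$-homomorphism $M(V_{\Lambda_1})\to M(V_\Lambda)$.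
   Formalization: The powers q^x are assumed to satisfy q^x = 1 only for x = 0 (q a formal generic parameter); for a fixed complex q, λ is unique only up to a period. That the notion of homomorphism is independent of λ is not stated separately: ψ is assumed a homomorphism for one λ only. *)

(* Defs.v *)
From HB Require Import structures.
From mathcomp Require Import all_boot all_order all_algebra.
From mathcomp Require Import zify.
From mathcomp Require Import generic_quotient ring_quotient.
From mathcomp Require Import boolp reals complex.
From mathcomp Require Import finmap monalg.

Set Implicit Arguments.
Unset Strict Implicit.
Unset Printing Implicit Defensive.

Import GRing.Theory.
Local Open Scope ring_scope.
Local Open Scope quotient_scope.

Section LinearSpan.
Context (R : nzRingType) (L : lmodType R) (D : L -> Prop).

Inductive lin_span : L -> Prop :=
| lin_span0 : lin_span 0
| lin_span_gen x of D x : lin_span x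
| lin_spanD x y of lin_span x & lin_span y : lin_span (x + y)
| lin_spanZ a x of lin_span x : lin_span (a *: x).

Definition span_pred : {pred L} := fun x => `[< lin_span x >].

Lemma span_predP x : reflect (lin_span x) (x \in span_pred).
Proof. exact: asboolP. Qed.

Fact span_pred_submod_closed : submod_closed span_pred.
Proof.
split; first by apply/span_predP; exact: lin_span0.
move=> a x y /span_predP hx /span_predP hy; apply/span_predP.
by apply: lin_spanD => //; exact: lin_spanZ.
Qed.
HB.instance Definition _ :=
  GRing.isSubmodClosed.Build R L span_pred span_pred_submod_closed.

Record lspan : predArgType :=
  LSpan { lspan_val :> L; lspan_valP : lspan_val \in span_pred }.
HB.instance Definition _ := [isSub for lspan_val].
HB.instance Definition _ := [Choice of lspan by <:].
HB.instance Definition _ := [SubChoice_isSubLmodule of lspan by <:].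

Definition lquot : Type := Quotient.quot span_pred.
HB.instance Definition _ := GRing.Zmodule.on lquot.

Definition lquot_pi (x : L) : lquot := \pi_(Quotient.quot span_pred) x.

Lemma lquot_pi_eq x y : lquot_pi x = lquot_pi y <-> lin_span (x - y).
Proof.
rewrite /lquot_pi; split.
  by move/eqP; rewrite -Quotient.idealrBE => /span_predP.
by move=> h; apply/eqP; rewrite -Quotient.idealrBE; apply/span_predP.
Qed.

Lemma lquot_piD x y : lquot_pi (x + y) = lquot_pi x + lquot_pi y.
Proof. by rewrite /lquot_pi raddfD. Qed.

Definition lquot_repr (u : lquot) : L := repr (u : (Quotient.quot span_pred)).

Lemma lquot_reprK u : lquot_pi (lquot_repr u) = u.
Proof. by rewrite /lquot_pi /lquot_repr reprK. Qed.

Definition lquot_scale (a : R) (u : lquot) : lquot :=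
  lquot_pi (a *: lquot_repr u).

Lemma lquot_piZ a x : lquot_scale a (lquot_pi x) = lquot_pi (a *: x).
Proof.
apply/lquot_pi_eq; rewrite -scalerBr; apply: lin_spanZ.
by apply/lquot_pi_eq; rewrite lquot_reprK.
Qed.

Fact lquot_scalerA a b u :
  lquot_scale a (lquot_scale b u) = lquot_scale (a * b) u.
Proof. by rewrite -[u]lquot_reprK !lquot_piZ scalerA. Qed.
Fact lquot_scale1r : left_id 1 lquot_scale.
Proof. by move=> u; rewrite -[u]lquot_reprK lquot_piZ scale1r. Qed.
Fact lquot_scalerDr : right_distributive lquot_scale +%R.
Proof.
move=> a u v; rewrite -[u]lquot_reprK -[v]lquot_reprK -lquot_piD !lquot_piZ.
by rewrite scalerDr lquot_piD.
Qed.
Fact lquot_scalerDl u : {morph lquot_scale^~ u : a b / a + b}.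
Proof.
move=> a b /=; rewrite -[u]lquot_reprK !lquot_piZ.
by rewrite scalerDl lquot_piD.
Qed.
HB.instance Definition _ := GRing.Zmodule_isLmodule.Build R lquot
  lquot_scalerA lquot_scale1r lquot_scalerDr lquot_scalerDl.

End LinearSpan.

(* [{malg R[X]}] is the free R-module on [X]; [malg_lift f] is the R-linear
   extension of [f : X -> M]. *)
Section FreeModuleLift.
Context (X : choiceType) (R : nzRingType) (M : lmodType R) (f : X -> M).

Definition malg_lift (g : {malg R[X]}) : M := \sum_(x <- msupp g) g@_x *: f x.

Lemma malg_liftEw (d : {fset X}) g : (msupp g `<=` d)%fset ->
  malg_lift g = \sum_(x <- d) g@_x *: f x.
Proof.
move=> le; rewrite /malg_lift (big_fset_incl _ le) // => x xd /mcoeff_outdom ->.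
by rewrite scale0r.
Qed.

Fact malg_lift_is_linear : linear malg_lift.
Proof.
move=> a g h; set d := (msupp (a *: g + h) `|` msupp g `|` msupp h)%fset.
rewrite !(@malg_liftEw d); try by
  rewrite /d; apply/fsubsetP => x; rewrite !inE => ->; rewrite ?orbT.
rewrite scaler_sumr -big_split /=; apply: eq_bigr => x _.
by rewrite mcoeffD mcoeffZ scalerDl scalerA.
Qed.
HB.instance Definition _ :=
  GRing.isLinear.Build R {malg R[X]} M _ malg_lift malg_lift_is_linear.

Lemma malg_liftU x : malg_lift << x >> = f x.
Proof.
by rewrite (malg_liftEw msuppU_le) big_seq_fset1 mcoeffUU scale1r.
Qed.
End FreeModuleLift.

(* The tensor product over a field, as the free module on [A * V] modulo the
   bilinearity relations. *)
Section Tensor.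
Context (F : fieldType) (A V : lmodType F).

Inductive tens_rel : {malg F[(A * V)%type]} -> Prop :=
| tens_relDl a b v : tens_rel (<< (a + b, v) >> - << (a, v) >> - << (b, v) >>)
| tens_relDr a v w : tens_rel (<< (a, v + w) >> - << (a, v) >> - << (a, w) >>)
| tens_relZl c a v : tens_rel (<< (c *: a, v) >> - c *: << (a, v) >>)
| tens_relZr c a v : tens_rel (<< (a, c *: v) >> - c *: << (a, v) >>).

Definition tens : lmodType F := lquot tens_rel.

Definition pure_tens (a : A) (v : V) : tens := lquot_pi tens_rel << (a, v) >>.

Context (M : lmodType F) (f : A -> V -> M).

Definition tens_lift (t : tens) : M :=
  malg_lift (fun p => f p.1 p.2) (lquot_repr t).

Hypothesis fl : forall v, linear (f^~ v).
Hypothesis fr : forall a, linear (f a).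

Lemma tens_lift_pi g :
  tens_lift (lquot_pi tens_rel g) = malg_lift (fun p => f p.1 p.2) g.
Proof.
apply/eqP; rewrite -subr_eq0 -linearB /=; apply/eqP.
have fDl a b v : f (a + b) v = f a v + f b v.
  by have := fl v 1 a b; rewrite !scale1r.
have fDr a v w : f a (v + w) = f a v + f a w.
  by have := fr a 1 v w; rewrite !scale1r.
have f0l v : f 0 v = 0 by apply: (addrI (f 0 v)); rewrite -fDl !addr0.
have f0r a : f a 0 = 0 by apply: (addrI (f a 0)); rewrite -fDr !addr0.
have fZl c a v : f (c *: a) v = c *: f a v.
  by have := fl v c a 0; rewrite addr0 f0l addr0.
have fZr c a v : f a (c *: v) = c *: f a v.
  by have := fr a c v 0; rewrite addr0 f0r addr0.
have : lin_span tens_rel (lquot_repr (lquot_pi tens_rel g) - g).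
  by apply/lquot_pi_eq; rewrite lquot_reprK.
elim=> [|x|x y _ hx _ hy|c x _ hx].
- by rewrite linear0.
- case=> [a b v|a v w|c a v|c a v];
    rewrite !linearB /= ?linearZ /= !malg_liftU /= ?fDl ?fDr ?fZl ?fZr.
  + by rewrite -addrA -opprD subrr.
  + by rewrite -addrA -opprD subrr.
  + by rewrite scalerN subrr.
  + by rewrite scalerN subrr.
- by rewrite linearD /= hx hy addr0.
- by rewrite linearZ /= hx scaler0.
Qed.

Fact tens_lift_is_linear : linear tens_lift.
Proof.
move=> c s t; rewrite -[s]lquot_reprK -[t]lquot_reprK.
have -> : c *: lquot_pi tens_rel (lquot_repr s) + lquot_pi _ (lquot_repr t)
        = lquot_pi _ (c *: lquot_repr s + lquot_repr t).
  by rewrite lquot_piD -lquot_piZ.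
by rewrite !tens_lift_pi linearP.
Qed.

Lemma tens_lift_pure a v : tens_lift (pure_tens a v) = f a v.
Proof. by rewrite tens_lift_pi malg_liftU. Qed.
End Tensor.

Section Subalgebra.
Context (F : fieldType) (A : lalgType F) (D : A -> Prop).

Inductive subalg : A -> Prop :=
| subalg_gen x of D x : subalg x
| subalg_scalar c : subalg c%:A
| subalgD x y of subalg x & subalg y : subalg (x + y)
| subalgM x y of subalg x & subalg y : subalg (x * y).
End Subalgebra.

Fact malg_scalerAr (X : monomType) (F : fieldType) (c : F)
  (x y : {malg F[X]}) : c *: (x * y) = x * (c *: y).
Proof.
have hC : x * c%:MP = c%:MP * x.
  rewrite [RHS]mul_malgC; apply/malgP => k; rewrite mcoeffZ.
  rewrite (@mcoeffMlw _ _ (msupp x) [fset (monalg.one : X)]%fset) ?msuppU_le //.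
  rewrite [in RHS](monalgE x) raddf_sum mulr_sumr; apply: eq_bigr => m _ /=.
  by rewrite big_seq_fset1 mulm1 mcoeffUU mcoeffU mulrnAr mulrC.
by rewrite -(mul_malgC c (x * y)) -(mul_malgC c y) !mulrA hC.
Qed.

Section SkewCommutators.
Context (F : fieldType) (A : algType F) (c : F) (w a b : A).
Hypothesis ab : a * b = b * a.

Fact qcomm_swapr :
  (w * a - c *: (a * w)) * b - c *: (b * (w * a - c *: (a * w))) =
  (w * b - c *: (b * w)) * a - c *: (a * (w * b - c *: (b * w))).
Proof.
rewrite !(mulrBl, mulrBr, scalerBr) -!scalerAl -!scalerAr !mulrA.
rewrite -[w * a * b]mulrA ab mulrA.
by rewrite !opprB addrACA [RHS]addrACA; congr (_ + _); rewrite addrC.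
Qed.

Fact qcomm_swapl :
  b * (a * w - c *: (w * a)) - c *: ((a * w - c *: (w * a)) * b) =
  a * (b * w - c *: (w * b)) - c *: ((b * w - c *: (w * b)) * a).
Proof.
rewrite !(mulrBl, mulrBr, scalerBr) -!scalerAl -!scalerAr !mulrA.
rewrite -[w * a * b]mulrA ab mulrA.
by rewrite !opprB addrACA [RHS]addrACA; congr (_ + _); rewrite addrC.
Qed.
End SkewCommutators.

Section ScalarRestriction.
Context (F : fieldType) (A : algType F) (M : lmodType A).

Definition scalar_restr : Type := M.
HB.instance Definition _ := GRing.Zmodule.on scalar_restr.

Definition restr_scale (c : F) (m : scalar_restr) : scalar_restr :=
  (c%:A : A) *: (m : M).

Fact restr_scalerA a b m :
  restr_scale a (restr_scale b m) = restr_scale (a * b) m.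
Proof.
rewrite /restr_scale [LHS]scalerA; congr (_ *: _).
by rewrite -scalerAl mul1r scalerA.
Qed.
Fact restr_scale1r : left_id 1 restr_scale.
Proof. by move=> m; rewrite /restr_scale !scale1r. Qed.
Fact restr_scalerDr : right_distributive restr_scale +%R.
Proof. by move=> a m m'; rewrite /restr_scale scalerDr. Qed.
Fact restr_scalerDl m : {morph restr_scale^~ m : a b / a + b}.
Proof. by move=> a b /=; rewrite /restr_scale !scalerDl. Qed.
HB.instance Definition _ := GRing.Zmodule_isLmodule.Build F scalar_restr
  restr_scalerA restr_scale1r restr_scalerDr restr_scalerDl.

Fact restr_scaleDl c (x y : A) (m : M) :
  (c *: x + y) *: m = c *: (x *: m : scalar_restr) + (y *: m : scalar_restr).
Proof.
rewrite scalerDl; congr (_ + _); rewrite /GRing.scale /= /restr_scale.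
by rewrite scalerA -scalerAl mul1r.
Qed.

Fact restr_scaleDr c (x : A) (m m' : M) :
  x *: (c%:A *: m + m') =
  c *: (x *: m : scalar_restr) + (x *: m' : scalar_restr).
Proof.
rewrite scalerDr; congr (_ + _); rewrite [in RHS]/GRing.scale /= /restr_scale.
by rewrite !scalerA -scalerAl -scalerAr mul1r mulr1.
Qed.
End ScalarRestriction.

(* [mu i], [nu i] are the simple roots mu_{i+1}, nu_{i+1} (0-based indices). *)
Inductive simple_root (n : nat) : Type :=
| mu of 'I_n.-1
| beta
| nu of 'I_n.-1.
Arguments beta {n}.

(* The vertex of the A_{2n-1} diagram mu_{n-1}, .., mu_1, beta, nu_1, ..,
   nu_{n-1}, numbered 0, .., 2n-2 from left to right. *)
Definition dynkin_pos n (a : simple_root n) : nat :=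
  match a with
  | mu i => n.-2 - i
  | beta => n.-1
  | nu i => n + i
  end.

Definition pairing n (a b : simple_root n) : int :=
  let i := dynkin_pos a in let j := dynkin_pos b in
  if i == j then 2 else if (i == j.+1) || (j == i.+1) then - 1 else 0.

Inductive generator (n : nat) : Type :=
| genE of simple_root n
| genF of simple_root n
| genK of simple_root n
| genKV of simple_root n.
HB.instance Definition _ n := gen_eqMixin (generator n).
HB.instance Definition _ n := gen_choiceMixin (generator n).

Section Relations.
Context (F : fieldType) (q : F) (n : nat) (A : lalgType F).
Context (e f k kv : simple_root n -> A).

(* [Uq_rel e f k kv x y] stands for the defining relation x = y between the
   elements e_a = E_a, f_a = F_a, k_a = K_a, kv_a = K_a^-1 of an algebra. *)
Inductive Uq_rel : A -> A -> Prop :=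
| Uq_rel_KKV a : Uq_rel (k a * kv a) 1
| Uq_rel_KVK a : Uq_rel (kv a * k a) 1
| Uq_rel_KK a b : Uq_rel (k a * k b) (k b * k a)
| Uq_rel_KE a b :
    Uq_rel (k a * e b) (q ^ pairing a b *: (e b * k a))
| Uq_rel_KF a b :
    Uq_rel (k a * f b) (q ^ (- pairing a b) *: (f b * k a))
| Uq_rel_EF a :
    Uq_rel (e a * f a - f a * e a) ((q - q^-1)^-1 *: (k a - kv a))
| Uq_rel_EF0 a b of a <> b : Uq_rel (e a * f b - f b * e a) 0
| Uq_rel_EE a b of pairing a b = 0 : Uq_rel (e a * e b) (e b * e a)
| Uq_rel_FF a b of pairing a b = 0 : Uq_rel (f a * f b) (f b * f a)
| Uq_rel_serreE a b of pairing a b = - 1 :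
    Uq_rel (e a * e a * e b - (q + q^-1) *: (e a * e b * e a)
            + e b * e a * e a) 0
| Uq_rel_serreF a b of pairing a b = - 1 :
    Uq_rel (f a * f a * f b - (q + q^-1) *: (f a * f b * f a)
            + f b * f a * f a) 0.

Fact Uq_rel_counit (c : A -> F) (x y : A) :
  (forall u v, c (u * v) = c u * c v) -> (forall u v, c (u - v) = c u - c v) ->
  (forall u v, c (u + v) = c u + c v) -> (forall b u, c (b *: u) = b * c u) ->
  c 1 = 1 -> c 0 = 0 ->
  (forall a, c (e a) = 0) -> (forall a, c (f a) = 0) ->
  (forall a, c (k a) = 1) -> (forall a, c (kv a) = 1) ->
  Uq_rel x y -> c x = c y.
Proof.
move=> cM cB cD cZ c1 c0 ce cf ck ckv.
have cN u : c (- u) = - c u by rewrite -[- u]sub0r cB c0 sub0r.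
by case=> *; rewrite ?(cM, cD, cN, cZ, ce, cf, ck, ckv, c1, c0)
  ?(mulr0, mul0r, mulr1, mul1r, subrr, addr0, subr0, oppr0).
Qed.
End Relations.

Section QuantumGroup.
Context (F : fieldType) (q : F) (n : nat).

Local Notation free_alg := {malg F[{fmonom (generator n)}]}.

Definition free_gen (g : generator n) : free_alg := << fmu g >>.

Local Notation Uq_free_rel := (Uq_rel q
  (fun a => free_gen (genE a)) (fun a => free_gen (genF a))
  (fun a => free_gen (genK a)) (fun a => free_gen (genKV a))).

Inductive Uq_ideal : free_alg -> Prop :=
| Uq_ideal0 : Uq_ideal 0
| Uq_ideal_rel x y of Uq_free_rel x y : Uq_ideal (x - y)
| Uq_idealD x y of Uq_ideal x & Uq_ideal y : Uq_ideal (x + y)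
| Uq_idealMl a x of Uq_ideal x : Uq_ideal (a * x)
| Uq_idealMr a x of Uq_ideal x : Uq_ideal (x * a).

Definition Uq_ideal_pred : {pred free_alg} := fun x => `[< Uq_ideal x >].

Lemma Uq_idealP x : reflect (Uq_ideal x) (x \in Uq_ideal_pred).
Proof. exact: asboolP. Qed.

Fact Uq_ideal_zmod_closed : zmod_closed Uq_ideal_pred.
Proof.
split; first by apply/Uq_idealP; exact: Uq_ideal0.
move=> x y /Uq_idealP hx /Uq_idealP hy; apply/Uq_idealP.
by apply: Uq_idealD => //; rewrite -mulN1r; exact: Uq_idealMl.
Qed.
HB.instance Definition _ :=
  GRing.isZmodClosed.Build free_alg Uq_ideal_pred Uq_ideal_zmod_closed.

Definition Uq : Type := Quotient.quot Uq_ideal_pred.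
HB.instance Definition _ := GRing.Zmodule.on Uq.

Definition Uq_pi (x : free_alg) : Uq := \pi_(Quotient.quot Uq_ideal_pred) x.
Definition Uq_repr (u : Uq) : free_alg :=
  repr (u : Quotient.quot Uq_ideal_pred).

Lemma Uq_reprK u : Uq_pi (Uq_repr u) = u.
Proof. by rewrite /Uq_pi /Uq_repr reprK. Qed.

Lemma Uq_pi_eq x y : Uq_pi x = Uq_pi y <-> Uq_ideal (x - y).
Proof.
rewrite /Uq_pi; split.
  by move/eqP; rewrite -Quotient.idealrBE => /Uq_idealP.
by move=> h; apply/eqP; rewrite -Quotient.idealrBE; apply/Uq_idealP.
Qed.

Lemma Uq_piD x y : Uq_pi (x + y) = Uq_pi x + Uq_pi y.
Proof. by rewrite /Uq_pi raddfD. Qed.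

Definition Uq_mul (u v : Uq) : Uq := Uq_pi (Uq_repr u * Uq_repr v).

Lemma Uq_mul_pi x y : Uq_mul (Uq_pi x) (Uq_pi y) = Uq_pi (x * y).
Proof.
apply/Uq_pi_eq; set x' := Uq_repr _; set y' := Uq_repr _.
have -> : x' * y' - x * y = (x' - x) * y' + x * (y' - y).
  by rewrite mulrBl mulrBr addrA subrK.
by apply: Uq_idealD; [apply: Uq_idealMr | apply: Uq_idealMl];
  apply/Uq_pi_eq; rewrite Uq_reprK.
Qed.

(* The counit E, F |-> 0, K |-> 1 shows that the quotient is not trivial. *)
Definition counit_gen (g : generator n) : F :=
  match g with genE _ | genF _ => 0 | _ => 1 end.
Definition counit_monom (m : fmonom (generator n)) : F := \prod_(g <- fmonom_val m) counit_gen g.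

Fact counit_monom_mmorphism : mmorphism counit_monom.
Proof.
split=> [x y|]; rewrite /counit_monom.
  have -> : monalg.mul x y = fmmul x y by [].
  by rewrite fmmulE /= big_cat.
have -> : monalg.one = fmone (generator n) by [].
by rewrite fmoneE big_nil.
Qed.
HB.instance Definition _ := isMultiplicative.Build _ F counit_monom counit_monom_mmorphism.

Definition counit : free_alg -> F := mmap idfun counit_monom.

Fact Uq_ideal_counit x : Uq_ideal x -> counit x = 0.
Proof.
have cg g : counit (free_gen g) = counit_gen g.
  by rewrite /counit /free_gen mmapU /= mul1r /counit_monom fmuE big_seq1.
have cM u v : counit (u * v) = counit u * counit v by rewrite /counit rmorphM.
have cB u v : counit (u - v) = counit u - counit v by rewrite /counit rmorphB.
have cD u v : counit (u + v) = counit u + counit v by rewrite /counit rmorphD.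
have cZ c u : counit (c *: u) = c * counit u by rewrite /counit mmapZ.
have c1 : counit 1 = 1 by rewrite /counit rmorph1.
have c0 : counit 0 = 0 by rewrite /counit rmorph0.
elim=> {x} [|x y hxy|x y _ hx _ hy|a x _ hx|a x _ hx].
- exact: c0.
- rewrite cB; apply/eqP; rewrite subr_eq0.
  by apply/eqP; apply: (Uq_rel_counit cM cB cD cZ c1 c0 _ _ _ _ hxy) => a;
    rewrite cg.
- by rewrite cD hx hy addr0.
- by rewrite cM hx mulr0.
- by rewrite cM hx mul0r.
Qed.

Fact Uq_mulA : associative Uq_mul.
Proof.
move=> u v w; rewrite -[u]Uq_reprK -[v]Uq_reprK -[w]Uq_reprK.
by rewrite !Uq_mul_pi mulrA.
Qed.
Fact Uq_mul1l : left_id (Uq_pi 1) Uq_mul.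
Proof. by move=> u; rewrite -[u]Uq_reprK Uq_mul_pi mul1r. Qed.
Fact Uq_mul1r : right_id (Uq_pi 1) Uq_mul.
Proof. by move=> u; rewrite -[u]Uq_reprK Uq_mul_pi mulr1. Qed.
Fact Uq_mulDl : left_distributive Uq_mul +%R.
Proof.
move=> u v w; rewrite -[u]Uq_reprK -[v]Uq_reprK -[w]Uq_reprK.
by rewrite -Uq_piD !Uq_mul_pi mulrDl Uq_piD.
Qed.
Fact Uq_mulDr : right_distributive Uq_mul +%R.
Proof.
move=> u v w; rewrite -[u]Uq_reprK -[v]Uq_reprK -[w]Uq_reprK.
by rewrite -Uq_piD !Uq_mul_pi mulrDr Uq_piD.
Qed.
Fact Uq_1_neq0 : Uq_pi 1 != 0.
Proof.
have -> : 0 = Uq_pi 0 by rewrite /Uq_pi raddf0.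
apply/eqP => /Uq_pi_eq; rewrite subr0 => /Uq_ideal_counit /eqP.
by rewrite /counit rmorph1 oner_eq0.
Qed.
HB.instance Definition _ := GRing.Zmodule_isNzRing.Build Uq
  Uq_mulA Uq_mul1l Uq_mul1r Uq_mulDl Uq_mulDr Uq_1_neq0.

Lemma Uq_piM x y : Uq_pi (x * y) = Uq_pi x * Uq_pi y.
Proof. by rewrite -Uq_mul_pi. Qed.

Definition Uq_scale (c : F) (u : Uq) : Uq := Uq_pi (c *: Uq_repr u).

Lemma Uq_scale_pi c x : Uq_scale c (Uq_pi x) = Uq_pi (c *: x).
Proof.
rewrite -!mul_malgC Uq_piM /Uq_scale -mul_malgC Uq_piM.
by rewrite Uq_reprK.
Qed.

Fact Uq_scalerA a b u : Uq_scale a (Uq_scale b u) = Uq_scale (a * b) u.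
Proof. by rewrite -[u]Uq_reprK !Uq_scale_pi scalerA. Qed.
Fact Uq_scale1r : left_id 1 Uq_scale.
Proof. by move=> u; rewrite -[u]Uq_reprK Uq_scale_pi scale1r. Qed.
Fact Uq_scalerDr : right_distributive Uq_scale +%R.
Proof.
move=> a u v; rewrite -[u]Uq_reprK -[v]Uq_reprK -Uq_piD !Uq_scale_pi.
by rewrite scalerDr Uq_piD.
Qed.
Fact Uq_scalerDl u : {morph Uq_scale^~ u : a b / a + b}.
Proof.
by move=> a b /=; rewrite -[u]Uq_reprK !Uq_scale_pi scalerDl Uq_piD.
Qed.
HB.instance Definition _ := GRing.Zmodule_isLmodule.Build F Uq
  Uq_scalerA Uq_scale1r Uq_scalerDr Uq_scalerDl.

Lemma Uq_piZ c x : Uq_pi (c *: x) = c *: Uq_pi x.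
Proof. by rewrite -Uq_scale_pi. Qed.

Fact Uq_scalerAl (c : F) (u v : Uq) : c *: (u * v) = (c *: u) * v.
Proof.
rewrite -[u]Uq_reprK -[v]Uq_reprK -Uq_piM -!Uq_piZ -Uq_piM.
by rewrite scalerAl.
Qed.
HB.instance Definition _ := GRing.Lmodule_isLalgebra.Build F Uq Uq_scalerAl.

Fact Uq_scalerAr (c : F) (u v : Uq) : c *: (u * v) = u * (c *: v).
Proof.
rewrite -[u]Uq_reprK -[v]Uq_reprK -Uq_piM -!Uq_piZ -Uq_piM.
by congr Uq_pi; exact: malg_scalerAr.
Qed.
HB.instance Definition _ := GRing.Lalgebra_isAlgebra.Build F Uq Uq_scalerAr.

Definition qE (a : simple_root n) : Uq := Uq_pi (free_gen (genE a)).
Definition qF (a : simple_root n) : Uq := Uq_pi (free_gen (genF a)).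
Definition qK (a : simple_root n) : Uq := Uq_pi (free_gen (genK a)).
Definition qKV (a : simple_root n) : Uq := Uq_pi (free_gen (genKV a)).

Lemma Uq_relE x y : Uq_free_rel x y -> Uq_pi x = Uq_pi y.
Proof. by move=> h; apply/Uq_pi_eq; exact: Uq_ideal_rel. Qed.

(* [mu_ext f k] is [f (mu k)] for [k < n.-1]; the default value 0 is never
   reached by the elements [W i j], [Z i j] with [i, j < n]. *)
Definition mu_ext (f : simple_root n -> Uq) (k : nat) : Uq :=
  oapp (fun i => f (mu i)) 0 (insub k).
Definition nu_ext (f : simple_root n -> Uq) (k : nat) : Uq :=
  oapp (fun i => f (nu i)) 0 (insub k).

(* [W i j] and [Z i j] are W_{i+1,j+1} and Z_{i+1,j+1} (0-based indices). *)
Fixpoint W0 (i : nat) : Uq :=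
  if i is k.+1 then W0 k * mu_ext qF k - q *: (mu_ext qF k * W0 k)
  else qF beta.
Fixpoint W (i j : nat) : Uq :=
  if j is k.+1 then W i k * nu_ext qF k - q *: (nu_ext qF k * W i k)
  else W0 i.

Fixpoint Z0 (i : nat) : Uq :=
  if i is k.+1 then mu_ext qE k * Z0 k - q^-1 *: (Z0 k * mu_ext qE k)
  else qE beta.
Fixpoint Z (i j : nat) : Uq :=
  if j is k.+1 then nu_ext qE k * Z i k - q^-1 *: (Z i k * nu_ext qE k)
  else Z0 i.

Lemma W_Sr i j : W i j.+1 = W i j * nu_ext qF j - q *: (nu_ext qF j * W i j).
Proof. by []. Qed.

Lemma Z_Sr i j :
  Z i j.+1 = nu_ext qE j * Z i j - q^-1 *: (Z i j * nu_ext qE j).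
Proof. by []. Qed.

Fact pairing_mu_nu (i j : 'I_n.-1) : pairing (mu i) (nu j) = 0.
Proof.
rewrite /pairing /=.
have hi := ltn_ord i; have h : (n.-2 - i < n.-1)%N by lia.
have -> : (n.-2 - i == n + j)%N = false by lia.
have -> : (n.-2 - i == (n + j).+1)%N = false by lia.
by have -> : (n + j == (n.-2 - i).+1)%N = false by lia.
Qed.

Lemma qF_mu_nu k l : mu_ext qF k * nu_ext qF l = nu_ext qF l * mu_ext qF k.
Proof.
rewrite /mu_ext /nu_ext; case: insub => [i|] /=; last by rewrite mul0r mulr0.
case: insub => [j|] /=; last by rewrite mul0r mulr0.
rewrite /qF -!Uq_piM; apply: Uq_relE.
exact: Uq_rel_FF (pairing_mu_nu i j).
Qed.

Lemma qE_mu_nu k l : mu_ext qE k * nu_ext qE l = nu_ext qE l * mu_ext qE k.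
Proof.
rewrite /mu_ext /nu_ext; case: insub => [i|] /=; last by rewrite mul0r mulr0.
case: insub => [j|] /=; last by rewrite mul0r mulr0.
rewrite /qE -!Uq_piM; apply: Uq_relE.
exact: Uq_rel_EE (pairing_mu_nu i j).
Qed.

Lemma W_Sl i j : W i.+1 j = W i j * mu_ext qF i - q *: (mu_ext qF i * W i j).
Proof.
elim: j => [//|j IH]; rewrite !W_Sr IH.
exact: qcomm_swapr (qF_mu_nu i j).
Qed.

Lemma Z_Sl i j :
  Z i.+1 j = mu_ext qE i * Z i j - q^-1 *: (Z i j * mu_ext qE i).
Proof.
elim: j => [//|j IH]; rewrite !Z_Sr IH.
exact: qcomm_swapl (qE_mu_nu i j).
Qed.

Definition kL_gen (x : Uq) : Prop :=
  exists i : 'I_n.-1,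
    [\/ x = qE (mu i), x = qF (mu i), x = qK (mu i) | x = qKV (mu i)].
Definition kR_gen (x : Uq) : Prop :=
  exists i : 'I_n.-1,
    [\/ x = qE (nu i), x = qF (nu i), x = qK (nu i) | x = qKV (nu i)].
Definition W_gen (x : Uq) : Prop := exists i j : 'I_n, x = W i j.
Definition Z_gen (x : Uq) : Prop := exists i j : 'I_n, x = Z i j.

Definition UkL : Uq -> Prop := subalg kL_gen.
Definition UkR : Uq -> Prop := subalg kR_gen.
Definition Uk : Uq -> Prop :=
  subalg (fun x => [\/ UkL x, UkR x, x = qK beta | x = qKV beta]).
Definition Aminus : Uq -> Prop := subalg W_gen.
Definition Aplus : Uq -> Prop := subalg Z_gen.
(* The products U_q(k) A_q^+ and A_q^- U_q(k) are subalgebras, so each is the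
   subalgebra generated by its two factors. *)
Definition UkAplus : Uq -> Prop := subalg (fun x => Uk x \/ Aplus x).
Definition AminusUk : Uq -> Prop := subalg (fun x => Aminus x \/ Uk x).

Definition Aminus1 : lmodType F := lspan W_gen.

Section Modules.
Context (V : vectType F).

(* Only the values of [rho] on the subalgebra [S] are relevant. *)
Definition is_rep (S : Uq -> Prop) (rho : Uq -> 'End(V)) : Prop :=
  [/\ rho 1 = \1%VF,
      forall c x y, S x -> S y -> rho (c *: x + y) = c *: rho x + rho y &
      forall x y, S x -> S y -> rho (x * y) = (rho x \o rho y)%VF].

Definition irreducible_rep (S : Uq -> Prop) (rho : Uq -> 'End(V)) : Prop :=
  [/\ is_rep S rho, fullv != 0%VS :> {vspace V} &
      forall U : {vspace V}, (forall x, S x -> (rho x @: U <= U)%VS) ->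
        U = 0%VS \/ U = fullv].

(* U_q(g) (x)_{U_q(k) A_q^+} V, presented as the free U_q(g)-module on the
   symbols [<< v >>] = 1 (x) v modulo additivity in v and
   x (x) v = 1 (x) rho x v for x in U_q(k) A_q^+. *)
Inductive verma_rel (rho : Uq -> 'End(V)) : {malg Uq[V]} -> Prop :=
| verma_relD v w : verma_rel rho (<< v + w >> - << v >> - << w >>)
| verma_relS x v of UkAplus x : verma_rel rho (x *: << v >> - << rho x v >>).

Definition verma (rho : Uq -> 'End(V)) : lmodType Uq := lquot (verma_rel rho).

Definition verma_gen (rho : Uq -> 'End(V)) (v : V) : verma rho :=
  lquot_pi (verma_rel rho) << v >>.

(* A_q^-(1) (x) V -> M(V), w (x) v |-> w v *)
Definition degree1_incl (rho : Uq -> 'End(V)) (t : tens Aminus1 V) : verma rho :=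
  tens_lift (fun (w : Aminus1) v =>
    (lspan_val w *: verma_gen rho v : scalar_restr (verma rho))) t.

Lemma verma_gen_scale (rho : Uq -> 'End(V)) x v : UkAplus x ->
  verma_gen rho (rho x v) = x *: verma_gen rho v.
Proof.
move=> hx; rewrite /verma_gen.
have -> : x *: lquot_pi (verma_rel rho) << v >> = lquot_pi _ (x *: << v >>).
  by rewrite -lquot_piZ.
apply/esym/lquot_pi_eq; apply: lin_span_gen; exact: verma_relS.
Qed.

Lemma verma_genD (rho : Uq -> 'End(V)) v w :
  verma_gen rho (v + w) = verma_gen rho v + verma_gen rho w.
Proof.
rewrite /verma_gen -lquot_piD; apply/lquot_pi_eq; rewrite opprD addrA.
by apply: lin_span_gen; exact: verma_relD.
Qed.

Lemma is_rep_scalar S rho c : is_rep S rho -> (forall c, S c%:A) ->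
  rho c%:A = c *: \1%VF.
Proof.
case=> h1 hD _ hS; have hS0 : S 0 by have := hS 0; rewrite scale0r.
have hS1 : S 1 by have := hS 1; rewrite scale1r.
have h0 : rho 0 = 0.
  apply: (addrI (rho 0)); rewrite addr0.
  by have := hD 1 0 0 hS0 hS0; rewrite scaler0 add0r scale1r => <-.
by have := hD c 1 0 hS1 hS0; rewrite h0 h1 !addr0.
Qed.

Lemma degree1_incl_pure rho w v : is_rep UkAplus rho ->
  degree1_incl rho (pure_tens w v) = lspan_val w *: verma_gen rho v.
Proof.
move=> hr; rewrite /degree1_incl tens_lift_pure //.
- by move=> u c x y; exact: restr_scaleDl.
- move=> x c u u'; rewrite verma_genD.
  have -> : c *: u = rho c%:A u.
    rewrite (is_rep_scalar c hr); last by move=> b; exact: subalg_scalar.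
    by rewrite scale_lfunE id_lfunE.
  rewrite verma_gen_scale; last exact: subalg_scalar.
  exact: restr_scaleDr.
Qed.

End Modules.

Definition is_hom_over (S : Uq -> Prop) (M N : lmodType Uq) (f : M -> N) :=
  {morph f : x y / x + y} /\ (forall x, S x -> forall m, f (x *: m) = x *: f m).

(* [psi] is a U_q(k)-homomorphism into A_q^-(1) (x) V, seen as a
   U_q(k)-submodule of the generalized Verma module M(V). *)
Definition is_degree1_hom (V1 V : vectType F) (rho1 : Uq -> 'End(V1))
    (rho : Uq -> 'End(V)) (psi : V1 -> tens Aminus1 V) : Prop :=
  forall x, Uk x -> forall u,
    degree1_incl rho (psi (rho1 x u)) = x *: degree1_incl rho (psi u).

Definition extends_degree1 (V1 V : vectType F) (rho1 : Uq -> 'End(V1))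
    (rho : Uq -> 'End(V)) (psi : V1 -> tens Aminus1 V)
    (f : verma rho1 -> verma rho) : Prop :=
  forall u, f (verma_gen rho1 u) = degree1_incl rho (psi u).
End QuantumGroup.

(* [qpow x] is q^x. Since q is a formal parameter, q^x = 1 only for x = 0; with
   q a fixed complex number, lam would only be determined up to a period. *)
Record generic_powers (R : realType) (F : fieldType) (qpow : R[i] -> F) : Prop
    := GenericPowers {
  qpow0 : qpow 0 = 1;
  qpowD : forall x y, qpow (x + y) = qpow x * qpow y;
  qpow_eq1 : forall x, qpow x = 1 -> x = 0
}.

Section HighestWeight.
Context (R : realType) (F : fieldType) (qpow : R[i] -> F) (n : nat).
Local Notation q := (qpow 1).
Local Notation Uq := (Uq q n).
Context (LL LR : (n.-1).-tuple nat).

(* [rho] makes V the module V_Lambda, Lambda = (LL, LR, lam), extended by the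
   trivial action of A_q^+, with highest weight vector [v]. *)
Record is_V_Lambda (lam : R[i]) (V : vectType F) (rho : Uq -> 'End(V)) (v : V)
    : Prop := IsVLambda {
  VL_rep : is_rep (@UkAplus F q n) rho;
  VL_irreducible : irreducible_rep (@Uk F q n) rho;
  VL_Aplus : forall i j : 'I_n, rho (Z q n i j) = 0;
  VL_neq0 : v != 0;
  VL_Emu : forall i, rho (qE q (mu i)) v = 0;
  VL_Enu : forall i, rho (qE q (nu i)) v = 0;
  VL_Kmu : forall i, rho (qK q (mu i)) v = q ^+ tnth LL i *: v;
  VL_Knu : forall i, rho (qK q (nu i)) v = q ^+ tnth LR i *: v;
  VL_Kbeta : rho (qK q beta) v = qpow lam *: v
}.

(* The modules V_(LL, LR, lam) for all lam, realized on one vector space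
   V = V_LL (x) V_LR on which U_q(k_L) and U_q(k_R) act independently of lam;
   only the action of K_beta depends on lam. *)
Record is_V_family (V : vectType F) (rho : R[i] -> Uq -> 'End(V)) (v : V)
    : Prop := IsVFamily {
  VF_V_Lambda : forall lam, is_V_Lambda lam (rho lam) v;
  VF_same : forall lam lam' x, UkL x \/ UkR x -> rho lam x = rho lam' x
}.
End HighestWeight.

(* Main.v *)
(* Write psi(v1) = sum W_ij T_ij with T_ij in V. Since psi(v1) is killed by the
   E's of k, the T_ij are obtained from T_00 by raising operators, and
     (q - q^-1) E_beta psi(v1) = K_beta T_00 - Q,
   where Q = sum G_ij T_ij and G_ij is built from K_beta^-1 as W_ij from F_beta.
   The vectors T_00 and Q have the same weight, and applying E's to either one
   along mu_1, mu_2, .. and nu_1, nu_2, .. leads to a multiple of the highest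
   weight vector of V, the lengths of both paths being forced by the weight.
   Hence Q is a multiple of T_00, by a power of q read off at the end of the
   path. When lambda moves by z, K_beta T_00 is multiplied by q^z and Q by
   q^-z, so E_beta psi(v1) = 0 is an equation q^(2 lambda) = q^y.
   To compare coefficients one needs that V embeds into M(V), shown with a
   module of functions on words, and that the W_ij are independent over V in
   degree one, shown in the tensor product of a Verma module with a fermionic
   Fock module. *)

From HB Require Import structures.
Require Import Defs.
From mathcomp Require Import all_boot all_order all_algebra.
From mathcomp Require Import zify ring.
From mathcomp Require Import boolp functions reals complex finmap monalg.

Set Implicit Arguments.
Unset Strict Implicit.
Unset Printing Implicit Defensive.

Import GRing.Theory.
Local Open Scope ring_scope.

(** * Identities in modules and algebras *)

(** [verma rho] is given by generators and relations, so a vector in it is shown to be nonzero only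
    by mapping it to a module built by hand, where every relation, the Serre relations included, has
    been checked. By [verma_lift] such a map is a U_q(k)-map on V with image killed by E_beta. In
    the fermionic target the half-filled state is trivial for k_L and k_R but has K_beta-eigenvalue
    q; this is why M(V) at lambda is mapped to the tensor product built from M(V) at lambda - 1.

    The hypothesis on psi concerns the single value [lam0]. Independence in degree one turns it into
    identities between coordinates in V that do not involve lambda, up to a power of q for K_beta;
    hence psi is a homomorphism for all lambda. Only E_beta psi(v1) = 0 remains, since E_beta
    commutes with the F's of k, which generate V1 from v1.

    It is not enough that K_beta T_00 and Q are multiples of T_00: the factors must be values of
    [qpow] for exponents to be compared, so the constants are tracked along the raising paths. *)

Section ModuleExpressions.
Context (F : fieldType).

Inductive mexp : Type :=
| mexp0
| mexpV of nat
| mexpD of mexp & mexp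
| mexpN of mexp
| mexpZ of F & mexp.

Fixpoint mexp_eval (M : lmodType F) (env : seq M) (e : mexp) : M :=
  match e with
  | mexp0 => 0
  | mexpV i => nth 0 env i
  | mexpD a b => mexp_eval env a + mexp_eval env b
  | mexpN a => - mexp_eval env a
  | mexpZ c a => c *: mexp_eval env a
  end.

(** Indices are tested with [eqn] so that [/=] reduces the coefficients of a reified term to
    explicit scalars. *)
Fixpoint mexp_coef (e : mexp) (i : nat) : F :=
  match e with
  | mexp0 => 0
  | mexpV j => if eqn i j then 1 else 0
  | mexpD a b => mexp_coef a i + mexp_coef b i
  | mexpN a => - mexp_coef a i
  | mexpZ c a => c * mexp_coef a i
  end.

Lemma mexp_evalE (M : lmodType F) (env : seq M) (e : mexp) :
  mexp_eval env e = \sum_(i < size env) mexp_coef e i *: nth 0 env i.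
Proof.
elim: e => [|j|a IHa b IHb|a IH|c a IH] /=.
- by rewrite big1 // => i _; rewrite scale0r.
- have eqnE i : eqn i j = (i == j) by [].
  case: (ltnP j (size env)) => hj.
    rewrite (bigD1 (Ordinal hj)) //= eqnE eqxx scale1r big1 ?addr0 // => i ne.
    by rewrite eqnE (_ : (i : nat) == j = false) ?scale0r //; apply: contraNF ne.
  rewrite nth_default // big1 // => i _; rewrite eqnE.
  by rewrite (_ : (i : nat) == j = false) ?scale0r //; have := ltn_ord i; lia.
- rewrite IHa IHb -big_split /=; apply: eq_bigr => i _; by rewrite scalerDl.
- rewrite IH -sumrN; apply: eq_bigr => i _; by rewrite scaleNr.
- rewrite IH scaler_sumr; apply: eq_bigr => i _; by rewrite scalerA.
Qed.

(** A nested conjunction rather than a quantifier: for an explicit environment [/=] unfolds it, and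
    [repeat split] leaves one scalar equation per atom. *)
Fixpoint mexp_coefs_eq (a b : mexp) (k : nat) : Prop :=
  match k with
  | 0 => True
  | k'.+1 => mexp_coef a k' = mexp_coef b k' /\ mexp_coefs_eq a b k'
  end.

Lemma mexp_eq (M : lmodType F) (env : seq M) (a b : mexp) :
  mexp_coefs_eq a b (size env) -> mexp_eval env a = mexp_eval env b.
Proof.
move=> h; rewrite !mexp_evalE; apply: eq_bigr => -[i hi] _ /=; congr (_ *: _).
by elim: (size env) h hi => //= k IH [h0 h]; rewrite ltnS leq_eqVlt => /orP[/eqP->|/IH]; auto.
Qed.

End ModuleExpressions.

(* Atoms are compared up to conversion, since the same product may occur with
   different instance paths. *)
Ltac mexp_index x l :=
  lazymatch l with
  | ?y :: ?l' =>
    match constr:(tt) with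
    | _ => let _ := constr:(erefl x : x = y) in constr:(0%N)
    | _ => let i := mexp_index x l' in constr:(S i)
    end
  end.
Ltac mexp_insert x l :=
  match constr:(tt) with
  | _ => let _ := mexp_index x l in l
  | _ => constr:(x :: l)
  end.
Ltac mexp_atoms t l :=
  lazymatch t with
  | GRing.zero => l
  | GRing.add ?a ?b => let l' := mexp_atoms a l in mexp_atoms b l'
  | GRing.opp ?a => mexp_atoms a l
  | GRing.scale _ ?a => mexp_atoms a l
  | _ => mexp_insert t l
  end.
Ltac mexp_reify F t l :=
  lazymatch t with
  | GRing.zero => constr:(@mexp0 F)
  | GRing.add ?a ?b => let a' := mexp_reify F a l in let b' := mexp_reify F b l in
      constr:(@mexpD F a' b')
  | GRing.opp ?a => let a' := mexp_reify F a l in constr:(@mexpN F a')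
  | GRing.scale ?c ?a => let a' := mexp_reify F a l in constr:(@mexpZ F c a')
  | _ => let i := mexp_index t l in constr:(@mexpV F i)
  end.
(* Reduces an equation in an F-module to the equations between the
   coefficients of its atoms. *)
Ltac module_eq F M :=
  lazymatch goal with
  | |- ?a = ?b =>
    let l := mexp_atoms a (@nil M) in
    let l := mexp_atoms b l in
    let a' := mexp_reify F a l in
    let b' := mexp_reify F b l in
    apply: (@mexp_eq F M l a' b'); rewrite /=; repeat split
  end.

(** * Serre elements and the relations that precede them *)

Section SerreIdentities.
Context (F : fieldType) (A : algType F) (q : F) (q0 : q != 0).

Definition serre (a b : A) : A :=
  a * a * b - (q + q^-1) *: (a * b * a) + b * a * a.

(** This is the shape of the coproduct of E: [y] plays E (x) 1 and [z] plays K (x) E. Once every [z]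
    is moved to the right of every [y], the monomials with letters of both kinds cancel identically
    in q. *)
Lemma serre_sum (ya yb za zb : A) :
  za * ya = q ^+ 2 *: (ya * za) -> za * yb = q^-1 *: (yb * za) ->
  zb * ya = q^-1 *: (ya * zb) ->
  serre ya yb = 0 -> serre za zb = 0 -> serre (ya + za) (yb + zb) = 0.
Proof.
move=> aa ab ba hy hz.
have aaA x : x * za * ya = q ^+ 2 *: (x * ya * za).
  by rewrite -mulrA aa -scalerAr mulrA.
have abA x : x * za * yb = q^-1 *: (x * yb * za).
  by rewrite -mulrA ab -scalerAr mulrA.
have baA x : x * zb * ya = q^-1 *: (x * ya * zb).
  by rewrite -mulrA ba -scalerAr mulrA.
transitivity (serre ya yb + serre za zb); last by rewrite hy hz addr0.
rewrite /serre !(mulrDl, mulrDr, mulrA).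
do 3! rewrite ?(aaA, abA, baA, aa, ab, ba) -?scalerAl.
by module_eq F A; field.
Qed.

Variables (I : Type) (pr : I -> I -> int) (e f k kv : I -> A).
Hypothesis prC : forall a b, pr a b = pr b a.
Hypothesis prD : forall a, pr a a = 2.

(** The relations other than those among the E's alone or among the F's alone. In the module of
    words they are verified directly, and the Serre relations are then deduced from them. *)
Record preUq : Prop := PreUq {
  preUq_KKV : forall a, k a * kv a = 1;
  preUq_KVK : forall a, kv a * k a = 1;
  preUq_KK : forall a b, k a * k b = k b * k a;
  preUq_KE : forall a b, k a * e b = q ^ pr a b *: (e b * k a);
  preUq_KF : forall a b, k a * f b = q ^ (- pr a b) *: (f b * k a);
  preUq_EF : forall a, e a * f a - f a * e a = (q - q^-1)^-1 *: (k a - kv a);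
  preUq_EF0 : forall a b, a <> b -> e a * f b - f b * e a = 0 }.

Hypothesis H : preUq.

Lemma preUq_EFC a b : a <> b -> e a * f b = f b * e a.
Proof. by move=> ab; apply/eqP; rewrite -subr_eq0 (preUq_EF0 H ab). Qed.

Lemma preUq_KVE a b : kv a * e b = q ^ (- pr a b) *: (e b * kv a).
Proof.
have qz : q ^ pr a b != 0 by rewrite expfz_neq0.
have : kv a * (k a * e b) * kv a = kv a * (q ^ pr a b *: (e b * k a)) * kv a.
  by rewrite (preUq_KE H).
rewrite mulrA (preUq_KVK H) mul1r -scalerAr -scalerAl mulrA.
rewrite -(mulrA _ (k a)) (preUq_KKV H) mulr1 => ->.
by rewrite scalerA -expfzDr // addNr expr0z scale1r.
Qed.

Lemma preUq_KVF a b : kv a * f b = q ^ pr a b *: (f b * kv a).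
Proof.
have : kv a * (k a * f b) * kv a = kv a * (q ^ (- pr a b) *: (f b * k a)) * kv a.
  by rewrite (preUq_KF H).
rewrite mulrA (preUq_KVK H) mul1r -scalerAr -scalerAl mulrA.
rewrite -(mulrA _ (k a)) (preUq_KKV H) mulr1 => ->.
by rewrite scalerA -expfzDr // addrN expr0z scale1r.
Qed.

(* The Serre element of the f's commutes with the e's, already without the
   Serre relations. *)
Lemma serre_comm a b c : pr a b = -1 ->
  e c * serre (f a) (f b) = serre (f a) (f b) * e c.
Proof.
move=> hab.
have hK u v p : k u * f v = q ^ (- pr u v) *: (f v * k u) /\ p * k u * f v = q ^ (- pr u v) *: (p * f v * k u).
  by split; rewrite ?(preUq_KF H) // -mulrA (preUq_KF H) -scalerAr mulrA.
have hKV u v p : kv u * f v = q ^ (pr u v) *: (f v * kv u) /\ p * kv u * f v = q ^ (pr u v) *: (p * f v * kv u).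
  by split; rewrite ?(preUq_KVF) // -mulrA (preUq_KVF) -scalerAr mulrA.
have EF0 u v : u <> v -> e u * f v = f v * e u.
  by move=> uv; apply/eqP; rewrite -subr_eq0 (preUq_EF0 H uv).
(* The constant (q - q^-1)^-1 becomes an opaque scalar: the K-terms cancel whatever its value, so
   [field] meets denominators in q only. *)
have [hh EF] : exists hh, forall u, e u * f u = f u * e u + hh *: (k u - kv u).
  exists ((q - q^-1)^-1) => u; by rewrite -(preUq_EF H u) addrC subrK.
have q1 : q ^ (-1) = q^-1 by [].
have q2 : q ^ 2 = q ^+ 2 by [].
have qm2 : q ^ (- 2) = q ^- 2 by [].
have eN11 : - (-1) = 1 :> int by [].
case: (EM (c = a)) => [->|ca].
  have ba : b <> a by move=> ba; move: hab; rewrite ba prD.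
  have eb : e a * f b = f b * e a by apply: EF0 => h; apply: ba.
  have ebA p : p * e a * f b = p * f b * e a by rewrite -mulrA eb mulrA.
  have eaA p : p * e a * f a =
      p * f a * e a + hh *: (p * k a - p * kv a).
    by rewrite -mulrA EF mulrDr mulrA -scalerAr mulrBr.
  have kaA p := (hK a a p).2; have kbA p := (hK a b p).2.
  have ka := (hK a a 1).1; have kb := (hK a b 1).1.
  have va := (hKV a a 1).1; have vb := (hKV a b 1).1.
  have vaA p := (hKV a a p).2; have vbA p := (hKV a b p).2.
  rewrite !prD hab !eN11 !q2 !qm2 !q1 !expr1z in kaA kbA ka kb va vb vaA vbA.
  rewrite /serre !(mulrDl, mulrDr, mulrBl, mulrBr, mulrA) ?(mulNr, mulrN) -?scalerAl -?scalerAr ?mulrA.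
  do 4! rewrite ?(eaA, ebA, EF, eb, kaA, kbA, ka, kb, va, vb, vaA, vbA)
    ?(mulrDl, mulrDr, mulrBl, mulrBr) ?(mulNr, mulrN) -?scalerAl -?scalerAr ?mulrA.
  by module_eq F A; field.
case: (EM (c = b)) => [->|cb].
  have ab : a <> b by move=> ba; move: hab; rewrite ba prD.
  have eb : e b * f a = f a * e b by apply: EF0 => h; apply: ab.
  have ebA p : p * e b * f a = p * f a * e b by rewrite -mulrA eb mulrA.
  have eaA p : p * e b * f b =
      p * f b * e b + hh *: (p * k b - p * kv b).
    by rewrite -mulrA EF mulrDr mulrA -scalerAr mulrBr.
  have kaA p := (hK b a p).2. have ka := (hK b a 1).1.
  have va := (hKV b a 1).1. have vaA p := (hKV b a p).2.
  rewrite !(prC b a) hab !eN11 !q1 !expr1z in kaA ka va vaA.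
  rewrite /serre !(mulrDl, mulrDr, mulrBl, mulrBr, mulrA) ?(mulNr, mulrN) -?scalerAl -?scalerAr ?mulrA.
  do 4! rewrite ?(eaA, ebA, EF, eb, kaA, ka, va, vaA)
    ?(mulrDl, mulrDr, mulrBl, mulrBr) ?(mulNr, mulrN) -?scalerAl -?scalerAr ?mulrA.
  by module_eq F A; field.
have ea : e c * f a = f a * e c by apply: EF0.
have eb : e c * f b = f b * e c by apply: EF0.
have eaA p : p * e c * f a = p * f a * e c by rewrite -mulrA ea mulrA.
have ebA p : p * e c * f b = p * f b * e c by rewrite -mulrA eb mulrA.
rewrite /serre !(mulrDl, mulrDr, mulrBl, mulrBr, mulrA) ?(mulNr, mulrN) -?scalerAl -?scalerAr ?mulrA.
by do 4! rewrite ?(eaA, ebA, ea, eb) ?mulrA.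
Qed.

(** The bracket of e_a with f_a yields K_a and K_a^-1, and these commute with f_b when the pairing
    is 0. *)
Lemma commutator_comm a b c : a <> b -> pr a b = 0 ->
  e c * (f a * f b - f b * f a) = (f a * f b - f b * f a) * e c.
Proof.
move=> ab hab.
have EF0 u v : u <> v -> e u * f v = f v * e u.
  by move=> uv; apply/eqP; rewrite -subr_eq0 (preUq_EF0 H uv).
have EF0A u v p : u <> v -> p * e u * f v = p * f v * e u.
  by move=> uv; rewrite -mulrA EF0 // mulrA.
have [hh EF] : exists hh, forall u, e u * f u = f u * e u + hh *: (k u - kv u).
  exists ((q - q^-1)^-1) => u; by rewrite -(preUq_EF H u) addrC subrK.
have EFA p u : p * e u * f u = p * f u * e u + hh *: (p * k u - p * kv u).
  by rewrite -mulrA EF mulrDr mulrA -scalerAr mulrBr.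
have kf u v : pr u v = 0 -> k u * f v = f v * k u.
  by move=> h; rewrite (preUq_KF H) h oppr0 expr0z scale1r.
have kvf u v : pr u v = 0 -> kv u * f v = f v * kv u.
  by move=> h; rewrite preUq_KVF h expr0z scale1r.
rewrite mulrBr mulrBl !mulrA.
case: (EM (c = a)) => [->|ca].
  rewrite !EF (EF0 a b) // EFA mulrDl -scalerAl mulrBl.
  rewrite (kf a b) // (kvf a b) // (EF0A a b) //.
  by module_eq F A; ring.
case: (EM (c = b)) => [->|cb].
  have ba : b <> a by move=> h; apply: ab.
  have hba : pr b a = 0 by rewrite prC.
  rewrite !EF (EF0 b a) // EFA mulrDl -scalerAl mulrBl.
  rewrite (kf b a) // (kvf b a) // (EF0A b a) //.
  by module_eq F A; ring.
by rewrite !EF0 // !EF0A.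
Qed.

End SerreIdentities.

Section PreUqSwap.
Context (F : fieldType) (A : algType F) (q : F) (q0 : q != 0).
Variables (I : Type) (pr : I -> I -> int) (e f k kv : I -> A).

(** The involution exchanging E with F and K with K^-1; it turns statements about the F's into
    statements about the E's. *)
Lemma preUq_swap : preUq q pr e f k kv -> preUq q pr f e kv k.
Proof.
move=> H; split=> [a|a|a b|a b|a b|a|a b ab].
- exact: preUq_KVK H a.
- exact: preUq_KKV H a.
(* A left and a right inverse of [k a * k b] coincide. *)
- have hab : kv a * (kv b * (k a * k b)) = 1.
    by rewrite (preUq_KK H a) !mulrA -(mulrA (kv a)) (preUq_KVK H) mulr1 (preUq_KVK H).
  have hba : (k a * k b) * (kv b * kv a) = 1.
    by rewrite mulrA -(mulrA (k a)) (preUq_KKV H) mulr1 (preUq_KKV H).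
  by rewrite -[LHS]mulr1 -hba mulrA -[kv a * kv b * _]mulrA hab mul1r.
- exact: (preUq_KVF q0 H).
- exact: (preUq_KVE q0 H).
- rewrite -opprB (preUq_EF H) -scalerN opprB //.
- by rewrite -opprB (preUq_EF0 H) ?oppr0 // => h; apply: ab.
Qed.

End PreUqSwap.

(** * The presentation of U_q and its coproduct *)

Section Presentation.
Context (F : fieldType) (q : F) (q0 : q != 0) (n : nat).
Local Notation root := (simple_root n).
Local Notation pairing := (@pairing n).

Lemma pairingC (a b : root) : pairing a b = pairing b a.
Proof. by rewrite /pairing eq_sym orbC. Qed.

Lemma pairing_id (a : root) : pairing a a = 2.
Proof. by rewrite /pairing eqxx. Qed.

Lemma pairing_cases (a b : root) : [\/ pairing a b = 2, pairing a b = -1 | pairing a b = 0].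
Proof.
rewrite /pairing; case: eqP => _; first by constructor 1.
by case: ifP => _; [constructor 2 | constructor 3].
Qed.

(** [Uq_rel] in the form in which the relations are used. Results about arbitrary families of this
    kind apply both to U_q itself and to operators on concrete modules. *)
Record isUq (A : algType F) (e f k kv : root -> A) : Prop := IsUq {
  isUq_pre :> preUq q pairing e f k kv;
  isUq_EE : forall a b, pairing a b = 0 -> e a * e b = e b * e a;
  isUq_FF : forall a b, pairing a b = 0 -> f a * f b = f b * f a;
  isUq_serreE : forall a b, pairing a b = -1 -> serre q (e a) (e b) = 0;
  isUq_serreF : forall a b, pairing a b = -1 -> serre q (f a) (f b) = 0 }.

Lemma isUqP (A : algType F) (e f k kv : root -> A) :
  isUq e f k kv <-> (forall x y, Uq_rel q e f k kv x y -> x = y).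
Proof.
split=> [H x y|H].
  case=> *.
  - exact: preUq_KKV H _.
  - exact: preUq_KVK H _.
  - exact: preUq_KK H _ _.
  - exact: preUq_KE H _ _.
  - exact: preUq_KF H _ _.
  - exact: preUq_EF H _.
  - exact: preUq_EF0 H _ _ _.
  - exact: isUq_EE H _ _ _.
  - exact: isUq_FF H _ _ _.
  - exact: isUq_serreE H _ _ _.
  - exact: isUq_serreF H _ _ _.
split; first split; move=> *; apply: H; by constructor.
Qed.

Lemma isUq_image (A : lalgType F) (B : algType F) (g : A -> B)
    (e f k kv : root -> A) :
  {morph g : x y / x + y} -> {morph g : x / - x} -> {morph g : x y / x * y} ->
  (forall c, {morph g : x / c *: x}) -> g 1 = 1 -> g 0 = 0 ->
  (forall x y, Uq_rel q e f k kv x y -> g x = g y) ->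
  isUq (fun a => g (e a)) (fun a => g (f a)) (fun a => g (k a)) (fun a => g (kv a)).
Proof.
move=> gD gN gM gZ g1 g0 H; rewrite /serre.
split; first split; move=> *; rewrite /serre -?gM -?gZ -?gM -?gN -?gD -?gZ -?g1 -?g0;
  apply: H; by constructor.
Qed.

Lemma Uq_rel_image (A : lalgType F) (B : algType F) (g : A -> B)
    (e f k kv : root -> A) (e' f' k' kv' : root -> B) :
  {morph g : x y / x + y} -> {morph g : x / - x} -> {morph g : x y / x * y} ->
  (forall c, {morph g : x / c *: x}) -> g 1 = 1 -> g 0 = 0 ->
  (forall a, [/\ g (e a) = e' a, g (f a) = f' a, g (k a) = k' a & g (kv a) = kv' a]) ->
  isUq e' f' k' kv' -> forall x y, Uq_rel q e f k kv x y -> g x = g y.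
Proof.
move=> gD gN gM gZ g1 g0 gg /isUqP H x y.
have ge a : g (e a) = e' a by case: (gg a).
have gf a : g (f a) = f' a by case: (gg a).
have gk a : g (k a) = k' a by case: (gg a).
have gkv a : g (kv a) = kv' a by case: (gg a).
by case=> *; rewrite ?(gM, gZ, gN, gD, g1, g0, ge, gf, gk, gkv); apply: H; constructor.
Qed.

Lemma isUq_Uq : isUq (A := Uq q n) (@qE F q n) (@qF F q n) (@qK F q n) (@qKV F q n).
Proof.
apply: (@isUq_image {malg F[{fmonom (generator n)}]} (Uq q n) (@Uq_pi F q n)
  (fun a => free_gen F (genE a)) (fun a => free_gen F (genF a))
  (fun a => free_gen F (genK a)) (fun a => free_gen F (genKV a)))
  => [x y|x|x y|c x|||x y].
- exact: Uq_piD.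
- by rewrite -scaleN1r Uq_piZ scaleN1r.
- exact: Uq_piM.
- exact: Uq_piZ.
- by [].
- by rewrite -(scale0r 0) Uq_piZ scale0r.
- exact: Uq_relE.
Qed.

(** The factors [u] and [w] can be collected in front: each monomial becomes [u * u * w] times the
    same monomial in [x] and [y]. *)
Lemma serre_mul_comm (A : algType F) (x y u w : A) :
  u * w = w * u -> x * u = u * x -> x * w = w * x -> y * u = u * y -> y * w = w * y ->
  serre q x y = 0 -> serre q (u * x) (w * y) = 0.
Proof.
move=> uw xu xw yu yw h.
transitivity (u * u * w * serre q x y); last by rewrite h mulr0.
have tri u1 x1 u2 x2 u3 x3 : x1 * u2 = u2 * x1 -> x1 * u3 = u3 * x1 ->
    x2 * u3 = u3 * x2 ->
    u1 * x1 * (u2 * x2) * (u3 * x3) = u1 * u2 * u3 * (x1 * x2 * x3) :> A.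
  move=> h12 h13 h23; rewrite !mulrA -(mulrA u1 x1) h12 mulrA.
  by rewrite -(mulrA _ x2) h23 mulrA -(mulrA _ x1) h13 mulrA.
have e1 : u * w * u = u * u * w by rewrite -mulrA -uw mulrA.
have e2 : w * u * u = u * u * w by rewrite -uw.
by rewrite /serre !tri // e2 e1 mulrDr mulrBr -scalerAr.
Qed.

Section Coproduct.
Context (A : algType F) (e f k kv e' f' k' kv' : root -> A).
Hypotheses (H : isUq e f k kv) (H' : isUq e' f' k' kv').
Definition all_comm (u u' : root -> A) := forall a b, u' b * u a = u a * u' b.
Hypotheses (hee : all_comm e e') (hef : all_comm e f') (hek : all_comm e k')
  (hekv : all_comm e kv').
Hypotheses (hfe : all_comm f e') (hff : all_comm f f') (hfk : all_comm f k')
  (hfkv : all_comm f kv').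
Hypotheses (hke : all_comm k e') (hkf : all_comm k f') (hkk : all_comm k k')
  (hkkv : all_comm k kv').
Hypothesis (hvk : all_comm kv k').

(* The coproduct of U_q, with commuting families in place of tensor factors. *)
Lemma isUq_coproduct :
  isUq (fun a => e a + k a * e' a) (fun a => f a * kv' a + f' a)
       (fun a => k a * k' a) (fun a => kv a * kv' a).
Proof.
have swap (x y z w : A) : z * y = y * z -> x * z * (y * w) = x * y * (z * w).
  by move=> zy; rewrite !mulrA -(mulrA x) zy mulrA.
have EF0 u v : u <> v -> e u * f v = f v * e u.
  by move=> uv; apply/eqP; rewrite -subr_eq0 (preUq_EF0 H uv).
have EF0' u v : u <> v -> e' u * f' v = f' v * e' u.
  by move=> uv; apply/eqP; rewrite -subr_eq0 (preUq_EF0 H' uv).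
(* Moving K_a past F_b and K_b^-1 past E_a costs the same power of q, by the symmetry of the
   pairing. *)
have cross a b : k a * e' a * (f b * kv' b) = f b * kv' b * (k a * e' a).
  rewrite (swap _ _ _ _ (hfe b a)) (swap _ _ _ _ (hkkv a b)).
  rewrite (preUq_KF H) (preUq_KVE q0 H') -scalerAl -scalerAr.
  by rewrite pairingC.
split; first split.
- by move=> a; rewrite (swap _ _ _ _ (hvk a a)) (preUq_KKV H) (preUq_KKV H') mulr1.
- by move=> a; rewrite (swap _ _ _ _ (hkkv a a)) (preUq_KVK H) (preUq_KVK H') mulr1.
- move=> a b; rewrite (swap _ _ _ _ (hkk b a)) (preUq_KK H) (preUq_KK H').
  by rewrite -(swap _ _ _ _ (hkk a b)).
- move=> a b; rewrite mulrDr mulrDl scalerDr; congr (_ + _).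
    by rewrite -mulrA hek (mulrA (k a)) (preUq_KE H) -scalerAl -mulrA.
  rewrite (swap _ _ _ _ (hkk b a)) (preUq_KK H) (preUq_KE H') -scalerAr.
  by rewrite -(swap _ _ _ _ (hke a b)).
- move=> a b; rewrite mulrDr mulrDl scalerDr; congr (_ + _).
    rewrite (swap _ _ _ _ (hfk b a)) (preUq_KF H) -scalerAl; congr (_ *: _).
    have h : k' a * kv' b = kv' b * k' a.
      rewrite -[LHS]mul1r -(preUq_KVK H' b) -!mulrA (mulrA (k' b)) (preUq_KK H').
      by rewrite -!mulrA (preUq_KKV H') mulr1.
    by rewrite h -(swap _ _ _ _ (hkkv a b)).
  by rewrite -mulrA (preUq_KF H') -scalerAr (mulrA (k a)) -hkf -mulrA.
- move=> a; rewrite !(mulrDl, mulrDr) cross.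
  have -> : e a * (f a * kv' a) = e a * f a * kv' a by rewrite mulrA.
  have -> : f a * kv' a * e a = f a * e a * kv' a by rewrite -mulrA hekv mulrA.
  have EF : e a * f a = f a * e a + (q - q^-1)^-1 *: (k a - kv a).
    by rewrite -(preUq_EF H) addrC subrK.
  have EF' : e' a * f' a = f' a * e' a + (q - q^-1)^-1 *: (k' a - kv' a).
    by rewrite -(preUq_EF H') addrC subrK.
  rewrite -(mulrA (k a)) EF EF' hef (mulrA (f' a)) hkf -(mulrA (k a)).
  rewrite !(mulrDl, mulrDr, mulrN, mulNr) -!(scalerAl, scalerAr).
  by rewrite !(mulrDl, mulrDr, mulrN, mulNr); module_eq F A; ring.
- move=> a b ab; rewrite !(mulrDl, mulrDr) cross.
  have -> : e a * (f b * kv' b) = f b * kv' b * e a.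
    by rewrite mulrA EF0 // -(mulrA (f b)) -hekv mulrA.
  have -> : k a * e' a * f' b = f' b * (k a * e' a).
    by rewrite -mulrA EF0' // (mulrA (k a)) -hkf -mulrA.
  by rewrite hef; module_eq F A; ring.
- move=> a b ab; have ba : pairing b a = 0 by rewrite pairingC.
  have ke u v : pairing u v = 0 -> k u * e v = e v * k u.
    by move=> h; rewrite (preUq_KE H) h expr0z scale1r.
  have h u v : pairing u v = 0 -> k u * e' u * e v = e v * (k u * e' u).
    by move=> uv; rewrite -mulrA hee (mulrA (k u)) ke // -mulrA.
  rewrite !(mulrDl, mulrDr) (isUq_EE H ab) (h a b) // (h b a) //.
  rewrite (swap _ _ _ _ (hke b a)) (preUq_KK H) (isUq_EE H' ab).
  by rewrite -(swap _ _ _ _ (hke a b)); module_eq F A; ring.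
- move=> a b ab; have ba : pairing b a = 0 by rewrite pairingC.
  have kf u v : pairing u v = 0 -> kv' u * f' v = f' v * kv' u.
    by move=> h; rewrite (preUq_KVF q0 H') h expr0z scale1r.
  have h u v : pairing u v = 0 -> f u * kv' u * f' v = f' v * (f u * kv' u).
    by move=> uv; rewrite -mulrA kf // (mulrA (f u)) -hff -mulrA.
  have vv : kv' a * kv' b = kv' b * kv' a by rewrite (preUq_KK (preUq_swap q0 H')).
  rewrite !(mulrDl, mulrDr) (isUq_FF H' ab) (h a b) // (h b a) //.
  rewrite (swap _ _ _ _ (hfkv b a)) (isUq_FF H ab) vv.
  by rewrite -(swap _ _ _ _ (hfkv a b)); module_eq F A; ring.
(* The q-commutation of K (x) E with E (x) 1 that [serre_sum] asks for, with exponent 2 or -1. *)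
- have zy u v : k u * e' u * e v = q ^ pairing u v *: (e v * (k u * e' u)).
    by rewrite -mulrA hee (mulrA (k u)) (preUq_KE H) -scalerAl -mulrA.
  move=> a b ab; have ba : pairing b a = -1 by rewrite pairingC.
  apply: serre_sum => //.
  + by rewrite zy pairing_id.
  + by rewrite zy ab.
  + by rewrite zy ba.
  + exact: isUq_serreE H _ _ ab.
  + apply: serre_mul_comm; rewrite ?hke //; first exact: preUq_KK H _ _.
    exact: isUq_serreE H' _ _ ab.
- have zy u v : f u * kv' u * f' v = q ^ pairing u v *: (f' v * (f u * kv' u)).
    by rewrite -mulrA (preUq_KVF q0 H') -scalerAr (mulrA (f u)) -hff -mulrA.
  move=> a b ab; have ba : pairing b a = -1 by rewrite pairingC.
  (* For the F's the summand 1 (x) F plays the role of [y] and F (x) K^-1 that of [z]. *)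
  rewrite addrC [f b * _ + _]addrC; apply: serre_sum => //.
  + by rewrite zy pairing_id.
  + by rewrite zy ab.
  + by rewrite zy ba.
  + exact: isUq_serreF H' _ _ ab.
  + rewrite -!hfkv; apply: serre_mul_comm; rewrite ?hfkv //; first
      exact: preUq_KK (preUq_swap q0 H') _ _.
    exact: isUq_serreF H _ _ ab.
Qed.
End Coproduct.
End Presentation.

(** * U_q-modules from operators on a vector space *)

Section Endomorphisms.
Context (F : fieldType) (X : lmodType F).

(* The endomorphism ring is non-trivial, as the hierarchy requires, only when
   the module is. *)
Record lend_of (nz : exists x : X, x != 0) : Type :=
  Lend { lend_fun :> X -> X; lend_linear : linear lend_fun }.

Context (nz : exists x : X, x != 0).
Local Notation lend := (lend_of nz).

Lemma lendP (f g : lend) : (forall x, f x = g x) -> f = g.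
Proof.
case: f g => f hf [g hg] /= fg; have E : f = g by apply/funext.
by subst g; congr (Lend nz); exact: Prop_irrelevance.
Qed.

HB.instance Definition _ := gen_eqMixin lend.
HB.instance Definition _ := gen_choiceMixin lend.

Lemma lendD (f : lend) : {morph f : x y / x + y}.
Proof. by move=> x y; have := lend_linear f 1 x y; rewrite !scale1r. Qed.
Lemma lend0 (f : lend) : f 0 = 0.
Proof. by apply: (addrI (f 0)); rewrite -lendD !addr0. Qed.
Lemma lendZ (f : lend) c : {morph f : x / c *: x}.
Proof. by move=> x; have := lend_linear f c x 0; rewrite lend0 !addr0. Qed.

Fact lend_zero_linear : linear (fun _ : X => 0 : X).
Proof. by move=> c x y; rewrite scaler0 addr0. Qed.
Fact lend_add_linear (f g : lend) : linear (fun x => f x + g x).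
Proof. by move=> c x y; rewrite !lend_linear scalerDr addrACA. Qed.
Fact lend_opp_linear (f : lend) : linear (fun x => - f x).
Proof. by move=> c x y; rewrite lend_linear opprD scalerN. Qed.
Fact lend_one_linear : linear (fun x : X => x).
Proof. by []. Qed.
Fact lend_mul_linear (f g : lend) : linear (fun x => f (g x)).
Proof. by move=> c x y; rewrite !lend_linear. Qed.
Fact lend_scale_linear a (f : lend) : linear (fun x => a *: f x).
Proof. by move=> c x y; rewrite lend_linear scalerDr !scalerA mulrC. Qed.

Definition lend_zero := Lend nz lend_zero_linear.
Definition lend_add f g := Lend nz (lend_add_linear f g).
Definition lend_opp f := Lend nz (lend_opp_linear f).
Definition lend_one := Lend nz lend_one_linear.
Definition lend_mul f g := Lend nz (lend_mul_linear f g).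
Definition lend_scale a f := Lend nz (lend_scale_linear a f).

Fact lend_addA : associative lend_add.
Proof. by move=> f g h; apply: lendP => x /=; rewrite addrA. Qed.
Fact lend_addC : commutative lend_add.
Proof. by move=> f g; apply: lendP => x /=; rewrite addrC. Qed.
Fact lend_add0 : left_id lend_zero lend_add.
Proof. by move=> f; apply: lendP => x /=; rewrite add0r. Qed.
Fact lend_addN : left_inverse lend_zero lend_opp lend_add.
Proof. by move=> f; apply: lendP => x /=; rewrite addNr. Qed.
HB.instance Definition _ :=
  GRing.isZmodule.Build lend lend_addA lend_addC lend_add0 lend_addN.

Fact lend_mulA : associative lend_mul.
Proof. by move=> f g h; apply: lendP. Qed.
Fact lend_mul1l : left_id lend_one lend_mul.
Proof. by move=> f; apply: lendP. Qed.
Fact lend_mul1r : right_id lend_one lend_mul.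
Proof. by move=> f; apply: lendP. Qed.
Fact lend_mulDl : left_distributive lend_mul +%R.
Proof. by move=> f g h; apply: lendP. Qed.
Fact lend_mulDr : right_distributive lend_mul +%R.
Proof. by move=> f g h; apply: lendP => x /=; rewrite lendD. Qed.
Fact lend_1_neq0 : lend_one != 0.
Proof.
apply/eqP => h; case: nz => x /eqP; apply.
by have := congr1 (fun f : lend => f x) h.
Qed.
HB.instance Definition _ := GRing.Zmodule_isNzRing.Build lend
  lend_mulA lend_mul1l lend_mul1r lend_mulDl lend_mulDr lend_1_neq0.

Fact lend_scaleA a b f : lend_scale a (lend_scale b f) = lend_scale (a * b) f.
Proof. by apply: lendP => x /=; rewrite scalerA. Qed.
Fact lend_scale1 : left_id 1 lend_scale.
Proof. by move=> f; apply: lendP => x /=; rewrite scale1r. Qed.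
Fact lend_scaleDr : right_distributive lend_scale +%R.
Proof. by move=> a f g; apply: lendP => x /=; rewrite scalerDr. Qed.
Fact lend_scaleDl f : {morph lend_scale^~ f : a b / a + b}.
Proof. by move=> a b; apply: lendP => x /=; rewrite scalerDl. Qed.
HB.instance Definition _ := GRing.Zmodule_isLmodule.Build F lend
  lend_scaleA lend_scale1 lend_scaleDr lend_scaleDl.

Fact lend_scaleAl (c : F) (f g : lend) : c *: (f * g) = (c *: f) * g.
Proof. by apply: lendP. Qed.
HB.instance Definition _ := GRing.Lmodule_isLalgebra.Build F lend lend_scaleAl.
Fact lend_scaleAr (c : F) (f g : lend) : c *: (f * g) = f * (c *: g).
Proof. by apply: lendP => x /=; rewrite lendZ. Qed.
HB.instance Definition _ := GRing.Lalgebra_isAlgebra.Build F lend lend_scaleAr.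

Lemma lend_scaleE c (f : lend) x : (c *: f) x = c *: f x.
Proof. by []. Qed.

End Endomorphisms.

Section UniversalProperty.
Context (F : fieldType) (q : F) (n : nat).
Local Notation root := (simple_root n).
Local Notation free_alg := {malg F[{fmonom (generator n)}]}.

Section Evaluation.
Context (A : algType F) (e f k kv : root -> A) (H : isUq q e f k kv).

Definition gen_ev (g : generator n) : A :=
  match g with genE a => e a | genF a => f a | genK a => k a | genKV a => kv a end.

Definition fmonom_ev (m : {fmonom (generator n)}) : A :=
  \prod_(g <- fmonom_val m) gen_ev g.

Definition free_ev : free_alg -> A := malg_lift fmonom_ev.

Lemma free_evD : {morph free_ev : x y / x + y}.
Proof. exact: linearD. Qed.
Lemma free_evN : {morph free_ev : x / - x}.
Proof. exact: linearN. Qed.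
Lemma free_evZ c : {morph free_ev : x / c *: x}.
Proof. by move=> x; exact: linearZ. Qed.
Lemma free_ev0 : free_ev 0 = 0.
Proof. exact: linear0. Qed.
Lemma free_evU m : free_ev << m >> = fmonom_ev m.
Proof. exact: malg_liftU. Qed.
Lemma free_ev_sum (I : Type) (r : seq I) (P : pred I) (G : I -> free_alg) :
  free_ev (\sum_(i <- r | P i) G i) = \sum_(i <- r | P i) free_ev (G i).
Proof. exact: linear_sum. Qed.

Lemma free_evE x : free_ev x = \sum_(m <- msupp x) x@_m *: fmonom_ev m.
Proof. by []. Qed.

Lemma free_algE (z : free_alg) : z = \sum_(m <- msupp z) z@_m *: << m >>.
Proof.
rewrite {1}(monalgE z); apply: eq_bigr => m _.
apply/malgP => m'; rewrite mcoeffU [RHS]mcoeffZ [X in _ * X]mcoeffU.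
by rewrite mulr_natr.
Qed.

Lemma free_algMr (c : F) (x y : free_alg) : x * (c *: y) = c *: (x * y).
Proof. exact/esym/malg_scalerAr. Qed.
Lemma free_algMl (c : F) (x y : free_alg) : (c *: x) * y = c *: (x * y).
Proof. exact/esym/scalerAl. Qed.

Lemma free_evM : {morph free_ev : x y / x * y}.
Proof.
have UU m m' : free_ev (<< m >> * << m' >>) = free_ev << m >> * free_ev << m' >>.
  have -> : << m >> * << m' >> = << monalg.mul m m' >> :> free_alg.
    by rewrite malgM_def fgmulUU mulr1.
  rewrite (free_evU m) (free_evU m') (free_evU (monalg.mul m m')) /fmonom_ev.
  have -> : monalg.mul m m' = fmmul m m' by [].
  by rewrite fmmulE /= big_cat.
move=> x y; rewrite {1}(free_algE x) {1}(free_algE y) mulr_suml.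
rewrite free_ev_sum (free_evE x) (free_evE y) mulr_suml.
apply: eq_bigr => m _; rewrite mulr_sumr free_ev_sum mulr_sumr.
apply: eq_bigr => m' _; rewrite free_algMr free_algMl !free_evZ UU.
by rewrite !free_evU -scalerAl -scalerAr scalerA mulrC -scalerA.
Qed.

Lemma free_ev_gen g : free_ev (free_gen F g) = gen_ev g.
Proof. by rewrite free_evU /fmonom_ev fmuE big_seq1. Qed.

Lemma free_ev1 : free_ev 1 = 1.
Proof.
have -> : 1 = << monalg.one >> :> free_alg by [].
rewrite free_evU /fmonom_ev.
have -> : monalg.one = fmone (generator n) by [].
by rewrite fmoneE big_nil.
Qed.

Lemma free_ev_rel x y : Uq_rel q
  (fun a => free_gen F (genE a)) (fun a => free_gen F (genF a))
  (fun a => free_gen F (genK a)) (fun a => free_gen F (genKV a)) x y ->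
  free_ev x = free_ev y.
Proof.
apply: (Uq_rel_image free_evD free_evN free_evM free_evZ free_ev1 free_ev0 _ H).
by move=> a; rewrite !free_ev_gen.
Qed.

Lemma free_ev_ideal x : Uq_ideal q x -> free_ev x = 0.
Proof.
elim=> {x} [|x y /free_ev_rel hxy|x y _ hx _ hy|a x _ hx|a x _ hx].
- exact: free_ev0.
- by rewrite free_evD free_evN hxy subrr.
- by rewrite free_evD hx hy addr0.
- by rewrite free_evM hx mulr0.
- by rewrite free_evM hx mul0r.
Qed.

(** The algebra morphism out of U_q given by its universal property. It evaluates a chosen
    representative; [Uq_ev_pi] shows that the choice is immaterial. *)
Definition Uq_ev (u : Uq q n) : A := free_ev (Uq_repr u).

Lemma Uq_ev_pi x : Uq_ev (Uq_pi q x) = free_ev x.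
Proof.
apply/eqP; rewrite /Uq_ev -subr_eq0; apply/eqP.
rewrite -free_evN -free_evD.
by apply: free_ev_ideal; apply/Uq_pi_eq; rewrite Uq_reprK.
Qed.

Lemma Uq_ev1 : Uq_ev 1 = 1.
Proof. by rewrite -free_ev1 -Uq_ev_pi. Qed.
Lemma Uq_evM u v : Uq_ev (u * v) = Uq_ev u * Uq_ev v.
Proof. by rewrite -[u]Uq_reprK -[v]Uq_reprK -Uq_piM !Uq_ev_pi free_evM. Qed.
Lemma Uq_evD u v : Uq_ev (u + v) = Uq_ev u + Uq_ev v.
Proof. by rewrite -[u]Uq_reprK -[v]Uq_reprK -Uq_piD !Uq_ev_pi free_evD. Qed.
Lemma Uq_evZ c u : Uq_ev (c *: u) = c *: Uq_ev u.
Proof. by rewrite -[u]Uq_reprK -Uq_piZ !Uq_ev_pi free_evZ. Qed.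
Lemma Uq_ev_gens a : [/\ Uq_ev (qE q a) = e a, Uq_ev (qF q a) = f a,
  Uq_ev (qK q a) = k a & Uq_ev (qKV q a) = kv a].
Proof. by split; rewrite Uq_ev_pi free_ev_gen. Qed.

End Evaluation.

Section ModuleOfOperators.
Context (X : lmodType F) (nz : exists x : X, x != 0).
Context (e f k kv : root -> lend_of nz) (H : isUq q e f k kv).

(** An alias of [X] indexed by the proof of the relations, so that the U_q-action determined by the
    four families can be attached to the type. *)
Definition umod of isUq q e f k kv : Type := X.
HB.instance Definition _ := GRing.Zmodule.on (umod H).

Definition umod_scale (u : Uq q n) (x : umod H) : umod H := Uq_ev e f k kv u x.

Fact umod_scaleA u v x : umod_scale u (umod_scale v x) = umod_scale (u * v) x.
Proof. by rewrite /umod_scale (Uq_evM H). Qed.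
Fact umod_scale1 : left_id 1 umod_scale.
Proof. by move=> x; rewrite /umod_scale (Uq_ev1 H). Qed.
Fact umod_scaleDr : right_distributive umod_scale +%R.
Proof. by move=> u x y; rewrite /umod_scale lendD. Qed.
Fact umod_scaleDl x : {morph umod_scale^~ x : u v / u + v}.
Proof. by move=> u v; rewrite /umod_scale (Uq_evD H). Qed.
HB.instance Definition _ := GRing.Zmodule_isLmodule.Build (Uq q n) (umod H)
  umod_scaleA umod_scale1 umod_scaleDr umod_scaleDl.

Lemma umod_scaleE a (x : umod H) : [/\ qE q a *: x = e a x, qF q a *: x = f a x,
  qK q a *: x = k a x & qKV q a *: x = kv a x].
Proof.
have [hE hF hK hV] := Uq_ev_gens H a.
by split; rewrite /GRing.scale /= /umod_scale ?hE ?hF ?hK ?hV.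
Qed.

Lemma umod_scalar c (x : umod H) : c%:A *: x = c *: (x : X) :> X.
Proof. by rewrite /GRing.scale /= /umod_scale (Uq_evZ H) (Uq_ev1 H). Qed.

End ModuleOfOperators.
End UniversalProperty.

Section Lift.
Context (R : nzRingType) (L M : lmodType R) (D : L -> Prop) (h : {linear L -> M}).
Hypothesis hD : forall x, D x -> h x = 0.

Lemma lquot_lift : exists g : lquot D -> M,
  linear g /\ forall x, g (lquot_pi D x) = h x.
Proof.
have gE x : h (lquot_repr (lquot_pi D x)) = h x.
  apply/eqP; rewrite -subr_eq0 -linearB; apply/eqP.
  have : lin_span D (lquot_repr (lquot_pi D x) - x).
    by apply/lquot_pi_eq; rewrite lquot_reprK.
  elim=> [|y /hD //|y z _ hy _ hz|c y _ hy]; rewrite ?linear0 //.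
    by rewrite linearD /= hy hz addr0.
  by rewrite linearZ /= hy scaler0.
exists (fun u => h (lquot_repr u)); split=> // c u v.
rewrite -[u]lquot_reprK -[v]lquot_reprK.
have -> : c *: lquot_pi D (lquot_repr u) + lquot_pi D (lquot_repr v)
        = lquot_pi D (c *: lquot_repr u + lquot_repr v).
  by rewrite lquot_piD -lquot_piZ.
by rewrite !gE linearP.
Qed.
End Lift.

Lemma scale_algE (F : fieldType) (A : algType F) (M : lmodType A) (c : F)
  (x : A) (m : M) : (c *: x) *: m = c%:A *: (x *: m).
Proof. by rewrite scalerA -scalerAl mul1r. Qed.

Lemma scale_qcomm_eq0 (F : fieldType) (A : algType F) (M : lmodType A) (c : F) (x y : A) (u : M) :
  x *: (y *: u) = 0 -> y *: (x *: u) = 0 -> (x * y - c *: (y * x)) *: u = 0.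
Proof.
by move=> h h'; rewrite scalerBl scale_algE -(scalerA x y u) -(scalerA y x u) h h' scaler0 subr0.
Qed.

(** * Homomorphisms out of the generalized Verma module *)

Section VermaLift.
Context (F : fieldType) (q : F) (n : nat).
Local Notation root := (simple_root n).
Local Notation Uq := (Uq q n).
Local Notation Uk := (@Uk F q n).
Local Notation UkAplus := (@UkAplus F q n).

Definition compact_root (a : root) : bool := if a is beta then false else true.

Lemma Uk_qE a : compact_root a -> Uk (qE q a).
Proof.
case: a => //= i _; apply: subalg_gen.
  by constructor 1; apply: subalg_gen; exists i; constructor 1.
by constructor 2; apply: subalg_gen; exists i; constructor 1.
Qed.
Lemma Uk_qF a : compact_root a -> Uk (qF q a).
Proof.
case: a => //= i _; apply: subalg_gen.
  by constructor 1; apply: subalg_gen; exists i; constructor 2.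
by constructor 2; apply: subalg_gen; exists i; constructor 2.
Qed.
Lemma Uk_qK a : Uk (qK q a).
Proof.
case: a => [i||i]; apply: subalg_gen.
- by constructor 1; apply: subalg_gen; exists i; constructor 3.
- by constructor 3.
- by constructor 2; apply: subalg_gen; exists i; constructor 3.
Qed.
Lemma Uk_qKV a : Uk (qKV q a).
Proof.
case: a => [i||i]; apply: subalg_gen.
- by constructor 1; apply: subalg_gen; exists i; constructor 4.
- by constructor 4.
- by constructor 2; apply: subalg_gen; exists i; constructor 4.
Qed.
Lemma UkAplus_Uk x : Uk x -> UkAplus x.
Proof. by move=> h; apply: subalg_gen; left. Qed.

Lemma Uk_ind (P : Uq -> Prop) :
  (forall c, P c%:A) -> (forall x y, Uk x -> Uk y -> P x -> P y -> P (x + y)) ->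
  (forall x y, Uk x -> Uk y -> P x -> P y -> P (x * y)) ->
  (forall a, compact_root a -> P (qE q a)) ->
  (forall a, compact_root a -> P (qF q a)) ->
  (forall a, P (qK q a)) -> (forall a, P (qKV q a)) ->
  forall x, Uk x -> P x.
Proof.
move=> Ps PD PM PE PF PK PV x.
have inL y : UkL y -> Uk y by move=> h; apply: subalg_gen; constructor 1.
have inR y : UkR y -> Uk y by move=> h; apply: subalg_gen; constructor 2.
elim=> {x} [x|c|x y hx Px hy Py|x y hx Px hy Py]; [|exact: Ps|exact: PD|exact: PM].
case=> [||->|->]; [| |exact: PK|exact: PV].
- elim=> {x} [x|c|x y hx Px hy Py|x y hx Px hy Py].
  + by case=> i [] ->; [apply: PE|apply: PF|apply: PK|apply: PV].
  + exact: Ps.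
  + by apply: PD => //; apply: inL.
  + by apply: PM => //; apply: inL.
- elim=> {x} [x|c|x y hx Px hy Py|x y hx Px hy Py].
  + by case=> i [] ->; [apply: PE|apply: PF|apply: PK|apply: PV].
  + exact: Ps.
  + by apply: PD => //; apply: inR.
  + by apply: PM => //; apply: inR.
Qed.

Lemma UkAplus_ind (P : Uq -> Prop) :
  (forall x, Uk x -> P x) -> (forall x y, UkAplus x -> UkAplus y -> P x -> P y -> P (x + y)) ->
  (forall x y, UkAplus x -> UkAplus y -> P x -> P y -> P (x * y)) ->
  (forall i j : 'I_n, P (Z q n i j)) -> forall x, UkAplus x -> P x.
Proof.
move=> Pk PD PM PZ x.
have inA y : Aplus y -> UkAplus y by move=> h; apply: subalg_gen; right.
elim=> {x} [x|c|x y hx Px hy Py|x y hx Px hy Py].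
- case=> [/Pk //|]; elim=> {x} [x|c|x y hx Px hy Py|x y hx Px hy Py].
  + by case=> i [j ->].
  + by apply: Pk; exact: subalg_scalar.
  + by apply: PD => //; apply: inA.
  + by apply: PM => //; apply: inA.
- by apply: Pk; exact: subalg_scalar.
- exact: PD.
- exact: PM.
Qed.

Context (V : vectType F) (rho : Uq -> 'End(V)).
Hypothesis rep : is_rep UkAplus rho.
Hypothesis rhoZ : forall i j : 'I_n, rho (Z q n i j) = 0.

Lemma repM x y u : UkAplus x -> UkAplus y -> rho (x * y) u = rho x (rho y u).
Proof. by case: rep => _ _ h hx hy; rewrite h // comp_lfunE. Qed.
Lemma repD x y u : UkAplus x -> UkAplus y -> rho (x + y) u = rho x u + rho y u.
Proof.
case: rep => _ h _ hx hy; rewrite -[x]scale1r h // scale1r.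
by rewrite scale1r add_lfunE.
Qed.
Lemma repA c u : rho c%:A u = c *: u.
Proof.
rewrite (is_rep_scalar c rep); last by move=> b; exact: subalg_scalar.
by rewrite scale_lfunE id_lfunE.
Qed.
Lemma rep1 u : rho 1 u = u.
Proof. by case: rep => -> _ _; rewrite id_lfunE. Qed.
Lemma repZ c x u : UkAplus x -> rho (c *: x) u = c *: rho x u.
Proof.
move=> hx; have h0 : UkAplus 0.
  by rewrite -(scale0r (1 : Uq)); exact: subalg_scalar.
have z : rho 0 u = 0 by rewrite -(scale0r (1 : Uq)) repA scale0r.
by case: rep => _ h _; rewrite -[c *: x]addr0 h // add_lfunE scale_lfunE z addr0.
Qed.

Section Lift.
Context (X : lmodType Uq) (phi : V -> X).
Hypothesis phiD : {morph phi : u v / u + v}.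
Hypothesis phiZ : forall c u, phi (c *: u) = c%:A *: phi u.
Hypothesis phiE : forall a, compact_root a -> forall u, phi (rho (qE q a) u) = qE q a *: phi u.
Hypothesis phiF : forall a, compact_root a -> forall u, phi (rho (qF q a) u) = qF q a *: phi u.
Hypothesis phiK : forall a u, phi (rho (qK q a) u) = qK q a *: phi u.
Hypothesis phiEbeta : forall u, qE q beta *: phi u = 0.

Lemma phi_Uk x : Uk x -> forall u, phi (rho x u) = x *: phi u.
Proof.
move=> hx; move: hx; elim/Uk_ind => {x}.
- by move=> c u; rewrite repA phiZ.
- move=> x y hx hy Px Py u; rewrite repD; try exact: UkAplus_Uk.
  by rewrite phiD Px Py scalerDl.
- move=> x y hx hy Px Py u; rewrite repM; try exact: UkAplus_Uk.
  by rewrite Px Py scalerA.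
- exact: phiE.
- exact: phiF.
- exact: phiK.
(* The case of K^-1 follows from that of K by writing u as K K^-1 u. *)
- move=> a u; have H := isUq_Uq q n.
  have E : u = rho (qK q a) (rho (qKV q a) u).
    rewrite -repM; try by apply: UkAplus_Uk; first [exact: Uk_qK|exact: Uk_qKV].
    by rewrite (preUq_KKV H) rep1.
  by rewrite [in RHS]E phiK scalerA (preUq_KVK H) scale1r.
Qed.

(** Z_ij is built from E_beta by skew commutators with E's of k. Each of these maps the image of
    [phi] to itself, so a commutator inherits the property of killing that image. *)
Lemma Z_kills i j u : Z q n i j *: phi u = 0.
Proof.
have step g (a : root) : (forall u, g *: phi u = 0) -> compact_root a ->
    forall u, (qE q a * g - q^-1 *: (g * qE q a)) *: phi u = 0.
  move=> hg ha w; apply: scale_qcomm_eq0.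
    by rewrite hg scaler0.
  by rewrite -(phiE ha); exact (hg _).
(* Beyond the last root [mu_ext] and [nu_ext] are 0, and then so is the next Z. *)
have step0 g w : (0 * g - q^-1 *: (g * 0)) *: phi w = 0.
  by rewrite mul0r mulr0 scaler0 subr0 scale0r.
elim: j u => [|j IH] u /=.
  elim: i u => [|i IH] u /=; first exact: phiEbeta.
  by rewrite /mu_ext; case: insub => [a|] /=; [apply: step|apply: step0].
by rewrite /nu_ext; case: insub => [a|] /=; [apply: step|apply: step0].
Qed.

Lemma phi_UkAplus x : UkAplus x -> forall u, phi (rho x u) = x *: phi u.
Proof.
move=> hx; move: hx; elim/UkAplus_ind => {x}.
- exact: phi_Uk.
- by move=> x y hx hy Px Py u; rewrite repD // phiD Px Py scalerDl.
- by move=> x y hx hy Px Py u; rewrite repM // Px Py scalerA.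
- move=> i j u; rewrite rhoZ zero_lfunE Z_kills.
  by apply: (addrI (phi 0)); rewrite -phiD !addr0.
Qed.

(** Frobenius reciprocity for an induced module: the symbol of u goes to [phi u], and [phi_UkAplus]
    says that the defining relations are respected. *)
Lemma verma_lift : exists g : verma rho -> X,
  linear g /\ forall u, g (verma_gen rho u) = phi u.
Proof.
case: (@lquot_lift Uq _ X (verma_rel rho) (malg_lift phi)) => [x|g [gl gE]].
  case=> [v w|y v hy]; rewrite !linearB /= ?linearZ /= !malg_liftU.
    by rewrite phiD addrAC addrK subrr.
  by rewrite phi_UkAplus // subrr.
by exists g; split=> // u; rewrite /verma_gen gE /= malg_liftU.
Qed.

End Lift.
End VermaLift.

Section VectorSpaces.
Context (F : fieldType) (V : vectType F).

(** A subspace of maximal dimension inside [P] contains every vector of [P], since otherwise adding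
    a line would enlarge it. Irreducibility speaks of [{vspace V}], while the stable subspaces met
    below are given as predicates. *)
Lemma vspace_of_pred (P : V -> Prop) : P 0 ->
  (forall c u w, P u -> P w -> P (c *: u + w)) ->
  exists U : {vspace V}, forall u, u \in U <-> P u.
Proof.
move=> P0 PL.
pose Q d := `[< exists U : {vspace V}, \dim U = d /\ forall u, u \in U -> P u >].
have Qex : exists d, Q d.
  exists 0%N; apply/asboolP; exists 0%VS; rewrite dimv0; split=> // u.
  by rewrite memv0 => /eqP ->.
have Qle d : Q d -> (d <= \dim (fullv : {vspace V}))%N.
  by case/asboolP => U [<- _]; apply: dimvS; exact: subvf.
case: (ex_maxnP Qex Qle) => d /asboolP [U [dU UP]] dmax.
exists U => u; split=> [/UP //|Pu]; apply: contrapT => uU.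
have : Q (\dim (U + <[u]>)).
  apply/asboolP; exists (U + <[u]>)%VS; split=> // w.
  case/memv_addP => x xU [y /vlineP[c ->] ->]; rewrite addrC.
  by apply: PL => //; exact: UP.
move/dmax; rewrite -dU => le; apply: uU.
have /eqP -> : U == (U + <[u]>)%VS by rewrite eqEdim addvSl.
by have := memv_add (mem0v U) (memv_line u); rewrite add0r.
Qed.

(** Applying [R - m D] removes the last term and multiplies the others by nonzero factors, which
    gives an induction on the number of terms. *)
Lemma eigen_sum_eq0 (R : 'End(V)) (m : nat -> F) (y : nat -> V) D :
  injective m -> (forall d, R (y d) = m d *: y d) ->
  \sum_(d < D) y d = 0 -> forall d, (d < D)%N -> y d = 0.
Proof.
move=> mI; elim: D y => [//|D IH] y Ry h.
have yD d : (d < D)%N -> y d = 0.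
  move=> hd; have : (m d - m D) *: y d = 0.
    apply: (IH (fun e => (m e - m D) *: y e)) => // [e|].
      by rewrite linearZ /= Ry !scalerA mulrC.
    have := congr1 (fun x => R x - m D *: x) h.
    rewrite linear0 scaler0 subrr linear_sum scaler_sumr -sumrB big_ord_recr /=.
    rewrite Ry subrr addr0 => {2}<-; apply: eq_bigr => i _.
    by rewrite Ry scalerBl.
  move/eqP; rewrite scaler_eq0 subr_eq0 => /orP[/eqP /mI E|/eqP //].
  by rewrite E ltnn in hd.
move=> d; rewrite ltnS leq_eqVlt => /orP[/eqP ->|/yD //].
by move: h; rewrite big_ord_recr /= big1 ?add0r // => i _; exact: yD.
Qed.

End VectorSpaces.

(** * Cartan elements that count simple roots *)

Section ProductsOfK.
Context (F : fieldType) (q : F) (q0 : q != 0) (A : algType F) (I : Type).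
Context (pr : I -> I -> int) (e f k kv : I -> A) (H : preUq q pr e f k kv).

Lemma prod_K_F s b : (\prod_(a <- s) k a) * f b =
  q ^ (- \sum_(a <- s) pr a b) *: (f b * \prod_(a <- s) k a).
Proof.
elim: s => [|a s IH]; first by rewrite !big_nil oppr0 expr0z scale1r mulr1 mul1r.
rewrite !big_cons -mulrA IH -scalerAr (mulrA (k a)) (preUq_KF H) -scalerAl scalerA.
by rewrite -(mulrA (f b)) -expfzDr // opprD addrC.
Qed.

Lemma prod_K_E s b : (\prod_(a <- s) k a) * e b =
  q ^ (\sum_(a <- s) pr a b) *: (e b * \prod_(a <- s) k a).
Proof.
elim: s => [|a s IH]; first by rewrite !big_nil expr0z scale1r mulr1 mul1r.
rewrite !big_cons -mulrA IH -scalerAr (mulrA (k a)) (preUq_KE H) -scalerAl scalerA.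
by rewrite -(mulrA (e b)) -expfzDr // addrC.
Qed.

End ProductsOfK.

Section CartanProducts.
Context (F : fieldType) (q : F) (q0 : q != 0) (n : nat).
Local Notation root := (simple_root n).

Definition Kprod (s : seq root) : Uq q n := \prod_(a <- s) qK q a.

Lemma Kprod_F s b : Kprod s * qF q b =
  q ^ (- \sum_(a <- s) pairing a b) *: (qF q b * Kprod s).
Proof. exact (prod_K_F q0 (isUq_pre (isUq_Uq q n)) s b). Qed.

Lemma Uk_Kprod s : Uk (Kprod s).
Proof.
rewrite /Kprod; elim: s => [|a s IH]; rewrite ?big_nil ?big_cons.
  by rewrite -(scale1r 1); exact: subalg_scalar.
by apply: subalgM => //; exact: Uk_qK.
Qed.

End CartanProducts.

Section HalfSums.
Context (n : nat).
Local Notation root := (simple_root n).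

(* [\sum_i (i + 1) (n - 1 - i) alpha_i] is the sum of the positive roots of
   type A_{n-1}, hence pairs to 2 with each simple root. *)
Definition mu_rho : seq root :=
  flatten [seq nseq (i.+1 * (n.-1 - i)) (mu i) | i : 'I_n.-1 <- enum 'I_n.-1].
Definition nu_rho : seq root :=
  flatten [seq nseq (i.+1 * (n.-1 - i)) (nu i) | i : 'I_n.-1 <- enum 'I_n.-1].

Lemma sum_rho (g : 'I_n.-1 -> root) b :
  \sum_(a <- flatten [seq nseq (i.+1 * (n.-1 - i)) (g i) | i : 'I_n.-1 <- enum 'I_n.-1])
     pairing a b = \sum_(i < n.-1) ((i.+1 * (n.-1 - i))%N%:Z * pairing (g i) b).
Proof.
rewrite big_flatten big_map big_enum /=; apply: eq_bigr => i _.
by rewrite big_nseq iter_addr_0 -mulr_natl natz.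
Qed.

Lemma pairing_mu (i j : 'I_n.-1) : pairing (mu i) (mu j) =
  if i == j then 2 else if (i.+1 == j) || (j.+1 == i) then -1 else 0.
Proof.
rewrite /pairing /=; have hi := ltn_ord i; have hj := ltn_ord j.
have -> : (n.-2 - i == n.-2 - j)%N = (i == j) by rewrite -val_eqE /=; lia.
case: eqP => // ij; have {}ij : (i : nat) <> j by move=> /val_inj.
by have -> : ((n.-2 - i == (n.-2 - j).+1) || (n.-2 - j == (n.-2 - i).+1))%N =
  ((i.+1 == j) || (j.+1 == i))%N by lia.
Qed.

Lemma pairing_nu (i j : 'I_n.-1) : pairing (nu i) (nu j) = pairing (mu i) (mu j).
Proof.
rewrite pairing_mu /pairing /= eqn_add2l; case: eqP => ij.
  by rewrite (_ : i == j) //; apply/eqP/val_inj.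
rewrite (_ : i == j = false); last by apply/eqP => E; apply: ij; rewrite E.
by have -> : ((n + i == (n + j).+1) || (n + j == (n + i).+1))%N =
  ((i.+1 == j) || (j.+1 == i))%N by lia.
Qed.

(** With G(i) = (i + 1)(m - i) the sum is 2 G(j) - G(j - 1) - G(j + 1). The neighbours missing at
    the two ends cost nothing, as G(-1) = G(m) = 0. *)
Lemma sum_rho_mu (j : 'I_n.-1) : \sum_(i < n.-1)
  ((i.+1 * (n.-1 - i))%N%:Z * pairing (mu i) (mu j)) = 2.
Proof.
set m := n.-1 in j *.
have S (G : nat -> int) (k : nat) : \sum_(i < m) G i * (i == k :> nat)%:Z =
    if (k < m)%N then G k else 0.
  case: ltnP => hk.
    rewrite (bigD1 (Ordinal hk)) //= eqxx mulr1 big1 ?addr0 // => i ne.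
    by rewrite (_ : (i == k :> nat) = false) ?mulr0 //; apply: contraNF ne.
  rewrite big1 // => i _.
  by rewrite (_ : (i == k :> nat) = false) ?mulr0 //; have := ltn_ord i; lia.
pose G i := ((i.+1 * (m - i))%N)%:Z.
transitivity (\sum_(i < m) (2 * (G i * (i == j :> nat)%:Z)
    - G i * (i == j.+1 :> nat)%:Z - (if (0 < j)%N then G i * (i == j.-1 :> nat)%:Z else 0))).
  apply: eq_bigr => i _; rewrite pairing_mu -/(G i) -val_eqE /=.
  have -> : (if (0 < j)%N then G i * (i == j.-1 :> nat)%:Z else 0) =
      G i * (i.+1 == j)%:Z.
    by case: ltnP => h; [congr (_ * _%:Z); lia|rewrite (_ : i.+1 == j = false) ?mulr0 //; lia].
  have : [&& ~~ ((i == j :> nat) && (i.+1 == j)), ~~ ((i == j :> nat) && (i == j.+1 :> nat))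
    & ~~ ((i.+1 == j) && (i == j.+1 :> nat))] by lia.
  rewrite [j.+1 == i]eq_sym.
  by case: (i == j :> nat); case: (i.+1 == j); case: (i == j.+1 :> nat) => //= _; ring.
rewrite !sumrB -mulr_sumr !S ltn_ord.
have -> : \sum_(i < m) (if (0 < j)%N then G i * (i == j.-1 :> nat)%:Z else 0) =
    if (0 < j)%N then G j.-1 else 0.
  by case: ifP => h; rewrite ?S ?big1 //; have -> : (j.-1 < m)%N by have := ltn_ord j; lia.
rewrite /G; have := ltn_ord j; case: (j : nat) => [|k] hk /=.
  by case: ltnP => h; lia.
by case: ltnP => h; nia.
Qed.

Lemma mu_rho_mu j : \sum_(a <- mu_rho) pairing a (mu j) = 2.
Proof. by rewrite sum_rho sum_rho_mu. Qed.
Lemma nu_rho_nu j : \sum_(a <- nu_rho) pairing a (nu j) = 2.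
Proof.
by rewrite sum_rho -(sum_rho_mu j); apply: eq_bigr => i _; rewrite pairing_nu.
Qed.
Lemma mu_rho_nu j : \sum_(a <- mu_rho) pairing a (nu j) = 0.
Proof. by rewrite sum_rho big1 // => i _; rewrite pairing_mu_nu mulr0. Qed.
Lemma nu_rho_mu j : \sum_(a <- nu_rho) pairing a (mu j) = 0.
Proof. by rewrite sum_rho big1 // => i _; rewrite pairingC pairing_mu_nu mulr0. Qed.

End HalfSums.

(** * Irreducible modules of U_q(k) and their embedding into M(V) *)

Section CompactModule.
Context (F : fieldType) (q : F) (q0 : q != 0) (n : nat).
Hypothesis qNroot : forall m : nat, q ^+ m = 1 -> m = 0%N.
Local Notation root := (simple_root n).
Local Notation Uq := (Uq q n).
Local Notation Uk := (@Uk F q n).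
Local Notation UkAplus := (@UkAplus F q n).
Context (V : vectType F) (rho : Uq -> 'End(V)) (v : V) (L : root -> F).
Hypothesis rep : is_rep UkAplus rho.
Hypothesis irr : irreducible_rep Uk rho.
Hypothesis v0 : v != 0.
Hypothesis Ev : forall a, compact_root a -> rho (qE q a) v = 0.
Hypothesis Kv : forall a, rho (qK q a) v = L a *: v.

Let hh := (q - q^-1)^-1.

Lemma rep_scomm c x y u : UkAplus x -> UkAplus y -> x * y = c *: (y * x) ->
  rho x (rho y u) = c *: rho y (rho x u).
Proof.
move=> hx hy E; rewrite -(repM rep u hx hy) E (repZ rep); last exact: subalgM.
by rewrite (repM rep).
Qed.
Lemma rep_comm x y u : UkAplus x -> UkAplus y -> x * y = y * x ->
  rho x (rho y u) = rho y (rho x u).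
Proof.
by move=> hx hy E; rewrite -(repM rep u hx hy) E (repM rep).
Qed.
Lemma rep_inv x y u : UkAplus x -> UkAplus y -> x * y = 1 -> rho x (rho y u) = u.
Proof. by move=> hx hy E; rewrite -(repM rep u hx hy) E (rep1 rep). Qed.
Lemma rep_bracket x y z w c u : UkAplus x -> UkAplus y -> UkAplus z -> UkAplus w ->
  x * y - y * x = c *: (z - w) ->
  rho x (rho y u) = rho y (rho x u) + c *: (rho z u - rho w u).
Proof.
move=> hx hy hz hw E.
have hN t : UkAplus t -> UkAplus (- t).
  by move=> ht; rewrite -scaleN1r -[t]mul1r scalerAl; apply: subalgM => //;
    exact: subalg_scalar.
have rN t : UkAplus t -> rho (- t) u = - rho t u.
  by move=> ht; rewrite -scaleN1r (repZ rep) // scaleN1r.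
have h : x * y = y * x + c *: (z - w) by rewrite -E addrC subrK.
rewrite -(repM rep u hx hy) h (repD rep); last 2 first.
- exact: subalgM.
- by rewrite -[_ - _]mul1r scalerAl; apply: subalgM; [exact: subalg_scalar|apply: subalgD => //; exact: hN].
rewrite (repM rep) // (repZ rep); last by apply: subalgD => //; exact: hN.
by rewrite (repD rep) ?rN //; exact: hN.
Qed.

Lemma rep_KKV a u : rho (qK q a) (rho (qKV q a) u) = u.
Proof.
apply: rep_inv; [exact/UkAplus_Uk/Uk_qK|exact/UkAplus_Uk/Uk_qKV|].
exact (preUq_KKV (isUq_Uq q n) a).
Qed.
Lemma rep_KVK a u : rho (qKV q a) (rho (qK q a) u) = u.
Proof.
apply: rep_inv; [exact/UkAplus_Uk/Uk_qKV|exact/UkAplus_Uk/Uk_qK|].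
exact (preUq_KVK (isUq_Uq q n) a).
Qed.
Lemma rep_KF a b u : compact_root b ->
  rho (qK q a) (rho (qF q b) u) = q ^ (- pairing a b) *: rho (qF q b) (rho (qK q a) u).
Proof.
move=> hb; apply: rep_scomm; [exact/UkAplus_Uk/Uk_qK|exact/UkAplus_Uk/Uk_qF|].
exact (preUq_KF (isUq_Uq q n) a b).
Qed.
Lemma rep_KE a b u : compact_root b ->
  rho (qK q a) (rho (qE q b) u) = q ^ (pairing a b) *: rho (qE q b) (rho (qK q a) u).
Proof.
move=> hb; apply: rep_scomm; [exact/UkAplus_Uk/Uk_qK|exact/UkAplus_Uk/Uk_qE|].
exact (preUq_KE (isUq_Uq q n) a b).
Qed.
Lemma rep_EF a b u : compact_root a -> compact_root b ->
  rho (qE q a) (rho (qF q b) u) = rho (qF q b) (rho (qE q a) u) +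
    (if `[< a = b >] then hh *: (rho (qK q b) u - rho (qKV q b) u) else 0).
Proof.
move=> ha hb; have hE := UkAplus_Uk (Uk_qE q ha); have hF := UkAplus_Uk (Uk_qF q hb).
have hK := UkAplus_Uk (Uk_qK q b); have hV := UkAplus_Uk (Uk_qKV q b).
case: asboolP => [ab|ab].
  apply: rep_bracket => //; subst a; rewrite /hh; exact (preUq_EF (isUq_Uq q n) b).
by rewrite addr0; apply: rep_comm hE hF _; exact (preUq_EFC (isUq_Uq q n) ab).
Qed.

Lemma L_neq0 a : L a != 0.
Proof.
apply/eqP => h; move/eqP: v0; apply; rewrite -[v](rep_KVK a) Kv h scale0r.
exact: linear0.
Qed.

(** Irreducibility as an induction principle on the vectors of V. *)
Lemma irr_pred (P : V -> Prop) : P 0 -> (forall c u w, P u -> P w -> P (c *: u + w)) ->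
  (forall a u, compact_root a -> P u -> P (rho (qE q a) u)) ->
  (forall a u, compact_root a -> P u -> P (rho (qF q a) u)) ->
  (forall a u, P u -> P (rho (qK q a) u)) ->
  (exists2 u, P u & u != 0) -> forall u, P u.
Proof.
move=> P0 PL PE PF PK [u0 Pu0 u00].
case: (vspace_of_pred P0 PL) => U UP.
(* K is injective and U finite-dimensional, so K maps U onto itself and K^-1 preserves U. *)
have PKV a u : P u -> P (rho (qKV q a) u).
  have le : (rho (qK q a) @: U <= U)%VS.
    by apply/subvP => w /memv_imgP[x /UP Px ->]; apply/UP; exact: PK.
  have inj : lker (rho (qK q a)) == 0%VS.
    by apply/lker0P => x y E; rewrite -(rep_KVK a x) E rep_KVK.
  have /eqP E : (rho (qK q a) @: U)%VS == U.
    have dE : \dim (rho (qK q a) @: U) = \dim U.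
      by apply: limg_dim_eq; rewrite (eqP inj) capv0.
    by rewrite eqEdim le dE leqnn.
  by move/UP; rewrite -E => /memv_imgP[x /UP Px ->]; rewrite rep_KVK.
have stab x : Uk x -> (rho x @: U <= U)%VS.
  move=> hx; apply/subvP => w /memv_imgP[y /UP Py ->]; apply/UP.
  elim/Uk_ind: hx y Py => {x w}.
  - by move=> c u Pu; rewrite (repA rep) -[c *: u]addr0; exact: PL.
  - move=> x y hx hy Px Py u Pu; rewrite (repD rep); try exact: UkAplus_Uk.
    by rewrite -[rho x u]scale1r; apply: PL; [exact: Px|exact: Py].
  - move=> x y hx hy Px Py u Pu; rewrite (repM rep); try exact: UkAplus_Uk.
    by apply: Px; exact: Py.
  - by move=> a ha u; exact: PE.
  - by move=> a ha u; exact: PF.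
  - by move=> a u; exact: PK.
  - by move=> a u; exact: PKV.
case: irr => _ _ /(_ U stab) [Ue|Ue] u.
  by move: u00; rewrite -memv0 -Ue => /negP; case; apply/UP.
by apply/UP; rewrite Ue; exact: memvf.
Qed.

Definition Fword (w : seq root) (u : V) := foldr (fun a x => rho (qF q a) x) u w.

(** The degree counts the F's applied to [v]. Independence of the different degrees comes later,
    from the eigenvalues in [R_Gr]. *)
Definition Gr (d : nat) : V -> Prop :=
  lin_span (fun u => exists w, [/\ all (@compact_root n) w, size w = d & u = Fword w v]).

Lemma Gr_map (T : 'End(V)) d e :
  (forall w, all (@compact_root n) w -> size w = d -> Gr e (T (Fword w v))) ->
  forall u, Gr d u -> Gr e (T u).
Proof.
move=> h u; elim=> {u} [|u [w [cw sw ->]]|u u' _ hu _ hu'|c u _ hu].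
- by rewrite linear0; exact: lin_span0.
- exact: h.
- by rewrite linearD; exact: lin_spanD.
- by rewrite linearZ; exact: lin_spanZ.
Qed.

Lemma Gr_F a d u : compact_root a -> Gr d u -> Gr d.+1 (rho (qF q a) u).
Proof.
move=> ha; apply: Gr_map => w cw sw; apply: lin_span_gen; exists (a :: w).
by rewrite /= ha cw sw.
Qed.

Lemma K_Fword a w : all (@compact_root n) w ->
  rho (qK q a) (Fword w v) = (L a * q ^ (- \sum_(b <- w) pairing a b)) *: Fword w v.
Proof.
elim: w => [|b w IH] /=; first by rewrite Kv big_nil oppr0 expr0z mulr1.
case/andP => hb /IH h; rewrite rep_KF // h linearZ /= scalerA; congr (_ *: _).
by rewrite big_cons opprD expfzDr //; ring.
Qed.

Lemma KV_Fword a w : all (@compact_root n) w ->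
  rho (qKV q a) (Fword w v) = (L a * q ^ (- \sum_(b <- w) pairing a b))^-1 *: Fword w v.
Proof.
move=> cw; have := congr1 (rho (qKV q a)) (K_Fword a cw).
rewrite rep_KVK linearZ /= => {2}->; rewrite scalerA mulVf ?scale1r //.
by rewrite mulf_neq0 ?L_neq0 // expfz_neq0.
Qed.

Lemma Gr_K a d u : Gr d u -> Gr d (rho (qK q a) u).
Proof.
apply: Gr_map => w cw sw; rewrite K_Fword //; apply: lin_spanZ.
by apply: lin_span_gen; exists w.
Qed.
Lemma Gr_KV a d u : Gr d u -> Gr d (rho (qKV q a) u).
Proof.
apply: Gr_map => w cw sw; rewrite KV_Fword //; apply: lin_spanZ.
by apply: lin_span_gen; exists w.
Qed.

Lemma E_Gr0 a u : compact_root a -> Gr 0 u -> rho (qE q a) u = 0.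
Proof.
move=> ha; elim=> {u} [|u [[|b w] [_ // _ ->]]|u u' _ hu _ hu'|c u _ hu].
- exact: linear0.
- exact: Ev.
- by rewrite linearD /= hu hu' addr0.
- by rewrite linearZ /= hu scaler0.
Qed.

Lemma Gr_E a d u : compact_root a -> Gr d.+1 u -> Gr d (rho (qE q a) u).
Proof.
move=> ha; apply: Gr_map => w; elim: w d => [//|b w IH] d /= /andP[hb cw] [sw].
have Gw : Gr d (Fword w v) by apply: lin_span_gen; exists w.
rewrite rep_EF //; apply: lin_spanD; last first.
  case: ifP => _; last exact: lin_span0.
  apply: lin_spanZ; apply: lin_spanD; first exact: Gr_K.
  by rewrite -scaleN1r; apply: lin_spanZ; exact: Gr_KV.
(* In degree 0 the remaining word is empty and E kills [v]; otherwise the induction hypothesis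
   applies. *)
case: d sw Gw => [|d] sw Gw; last by apply: Gr_F => //; exact: IH.
by rewrite E_Gr0 // linear0; exact: lin_span0.
Qed.

(** The sums of homogeneous vectors form a subspace that contains [v] and is stable under E, F and
    K, so it is V. *)
Lemma Gr_decomp u : exists D (y : nat -> V),
  (forall d, Gr d (y d)) /\ u = \sum_(d < D) y d.
Proof.
move: u; apply: irr_pred.
- exists 0%N, (fun _ => 0); split=> [d|]; first exact: lin_span0.
  by rewrite big_ord0.
- move=> c u w [D [y [hy ->]]] [D' [y' [hy' ->]]].
  (* Families of different lengths are padded with 0 to the common length D + D' before they are
     added. *)
  pose cut D (y : nat -> V) d := if (d < D)%N then y d else 0.
  have cutG E z : (forall d, Gr d (z d)) -> forall d, Gr d (cut E z d).
    by move=> hz d; rewrite /cut; case: ifP => _ //; exact: lin_span0.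
  have cutE E E' (z : nat -> V) : (E <= E')%N -> \sum_(d < E) z d = \sum_(d < E') cut E z d.
    move=> le; rewrite (big_ord_widen E' z le) big_mkcond /=.
    by apply: eq_bigr => i _; rewrite /cut.
  exists (D + D')%N, (fun d => c *: cut D y d + cut D' y' d); split=> [d|].
    by apply: lin_spanD; [apply: lin_spanZ|]; exact: cutG.
  rewrite (cutE D (D + D')%N) ?leq_addr // (cutE D' (D + D')%N) ?leq_addl //.
  by rewrite scaler_sumr -big_split.
- move=> a _ ha [[|D] [y [hy ->]]].
    by exists 0%N, y; split=> //; rewrite !big_ord0 linear0.
  exists D, (fun d => rho (qE q a) (y d.+1)).
  split=> [d|]; first exact: Gr_E.
  by rewrite linear_sum big_ord_recl /= E_Gr0 // add0r.
- move=> a _ ha [D [y [hy ->]]].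
  exists D.+1, (fun d => if d is e.+1 then rho (qF q a) (y e) else 0); split.
    by case=> [|d]; [exact: lin_span0|exact: Gr_F].
  by rewrite big_ord_recl /= add0r linear_sum.
- move=> a _ [D [y [hy ->]]]; exists D, (fun d => rho (qK q a) (y d)).
  by split=> [d|]; [exact: Gr_K|rewrite linear_sum].
- exists v => //; exists 1%N, (fun d => if d is 0 then v else 0); split.
    by case=> [|d]; [apply: lin_span_gen; exists [::]|exact: lin_span0].
  by rewrite big_ord_recl big_ord0 addr0.
Qed.

Lemma Gr0_line u : Gr 0 u -> exists c, u = c *: v.
Proof.
elim=> {u} [|u [[|b w] [_ // _ ->]]|u u' _ [c ->] _ [c' ->]|c u _ [c' ->]].
- by exists 0; rewrite scale0r.
- by exists 1; rewrite scale1r.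
- by exists (c + c'); rewrite scalerDl.
- by exists (c * c'); rewrite scalerA.
Qed.

(** The Cartan element of the sum of the positive roots of k. It pairs to 2 with every compact
    simple root, so it multiplies degree d by r q^(-2d); these scalars are distinct because q is not
    a root of unity. *)
Let R := rho (Kprod q (mu_rho n ++ nu_rho n)).

Lemma rho_pairing b : compact_root b ->
  \sum_(a <- mu_rho n ++ nu_rho n) pairing a b = 2.
Proof.
case: b => // j _; rewrite big_cat /=.
  by rewrite mu_rho_mu nu_rho_mu addr0.
by rewrite mu_rho_nu nu_rho_nu add0r.
Qed.

Lemma Kprod_v s : rho (Kprod q s) v = (\prod_(a <- s) L a) *: v.
Proof.
elim: s => [|a s IH]; first by rewrite /Kprod !big_nil (rep1 rep) scale1r.
have -> : Kprod q (a :: s) = qK q a * Kprod q s by rewrite /Kprod big_cons.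
rewrite (repM rep); [|exact/UkAplus_Uk/Uk_qK|exact/UkAplus_Uk/Uk_Kprod].
by rewrite IH linearZ /= Kv scalerA big_cons mulrC.
Qed.

Lemma Kprod_Fword s w : all (@compact_root n) w -> rho (Kprod q s) (Fword w v) =
  (\prod_(a <- s) L a * q ^ (- \sum_(b <- w) \sum_(a <- s) pairing a b)) *: Fword w v.
Proof.
elim: w => [|b w IH] /=; first by rewrite Kprod_v big_nil oppr0 expr0z mulr1.
case/andP => hb /IH h.
rewrite (@rep_scomm (q ^ (- \sum_(a <- s) pairing a b)));
  [|exact/UkAplus_Uk/Uk_Kprod|exact/UkAplus_Uk/Uk_qF|exact: Kprod_F].
rewrite h linearZ /= scalerA; congr (_ *: _).
by rewrite big_cons opprD expfzDr //; ring.
Qed.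

Let r := \prod_(a <- mu_rho n ++ nu_rho n) L a.

Lemma R_Gr d u : Gr d u -> R u = (r * q ^- (2 * d)) *: u.
Proof.
elim=> {u} [|u [w [cw sw ->]]|u u' _ hu _ hu'|c u _ hu].
- by rewrite linear0 scaler0.
- rewrite /R Kprod_Fword // -/r; congr ((_ * _) *: _).
  have -> : \sum_(b <- w) \sum_(a <- mu_rho n ++ nu_rho n) pairing a b = (2 * d)%N%:Z.
    rewrite -sw; elim: w cw {sw} => [|b w IH] /=; first by rewrite big_nil.
    by case/andP => hb /IH; rewrite big_cons rho_pairing // => ->; rewrite mulnS PoszD.
  by rewrite -exprnN.
- by rewrite linearD /= hu hu' scalerDr.
- by rewrite linearZ /= hu !scalerA mulrC.
Qed.

Lemma eigen_inj : injective (fun d : nat => r * q ^- (2 * d)).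
Proof.
have r0 : r != 0.
  rewrite /r; elim/big_rec: _ => [|a x _ x0]; first exact: oner_neq0.
  by rewrite mulf_neq0 ?L_neq0.
have le d e : (d <= e)%N -> q ^+ (2 * d) = q ^+ (2 * e) -> d = e.
  move=> hde E; have : q ^+ (2 * (e - d)) = 1.
    apply: (mulfI (expf_neq0 (2 * d) q0)).
    by rewrite -exprD mulr1 E; congr (_ ^+ _); lia.
  by move/qNroot; lia.
move=> d e /(mulfI r0) /invr_inj E.
case: (leqP d e) => [h|/ltnW h]; first exact: le h E.
exact/esym/(le _ _ h)/esym.
Qed.

(* The coefficient of [v] along the decomposition of V by the degree in the
   F's. *)
Lemma vacuum_functional : exists vs : V -> F, [/\ linear (vs : V -> F^o), vs v = 1,
  forall a u, compact_root a -> vs (rho (qF q a) u) = 0 &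
  forall a u, vs (rho (qK q a) u) = L a * vs u].
Proof.
(* Some decomposition of u has degree 0 part c v. [eigen_sum_eq0] makes c unique, so each property
   of the functional can be read off from one explicit decomposition. *)
pose P u c := exists D (y : nat -> V), [/\ forall d, Gr d (y d), y 0%N = c *: v &
  u = \sum_(d < D.+1) y d].
have Pex u : exists c, P u c.
  have [[|D] [y [hy hu]]] := Gr_decomp u; last first.
    have [c hc] := Gr0_line (hy 0%N).
    by exists c, D, y; split.
  exists 0, 0%N, (fun _ => 0); split=> [d||]; rewrite ?scale0r //.
    exact: lin_span0.
  by rewrite hu big_ord0 big_ord_recl big_ord0 addr0.
have Plin a u c w e : P u c -> P w e -> P (a *: u + w) (a * c + e).
  case=> D [y [hy y0 ->]] [D' [y' [hy' y0' ->]]].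
  pose cut D (y : nat -> V) d := if (d < D.+1)%N then y d else 0.
  have cutG E z : (forall d, Gr d (z d)) -> forall d, Gr d (cut E z d).
    by move=> hz d; rewrite /cut; case: ifP => _ //; exact: lin_span0.
  have cutE E E' (z : nat -> V) : (E <= E')%N -> \sum_(d < E.+1) z d = \sum_(d < E'.+1) cut E z d.
    move=> le; rewrite (big_ord_widen E'.+1 z) // big_mkcond /=.
    by apply: eq_bigr => i _; rewrite /cut.
  exists (D + D')%N, (fun d => a *: cut D y d + cut D' y' d); split=> [d||].
  - by apply: lin_spanD; [apply: lin_spanZ|]; exact: cutG.
  - by rewrite /cut /= y0 y0' scalerDl scalerA.
  rewrite (cutE D (D + D')%N) ?leq_addr // (cutE D' (D + D')%N) ?leq_addl //.
  by rewrite scaler_sumr -big_split.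
have P0 c : P 0 c -> c = 0.
  case=> D [y [hy y0 /esym h]].
  have := eigen_sum_eq0 eigen_inj (fun d => R_Gr (hy d)) h (ltn0Sn D).
  by rewrite y0 => /eqP; rewrite scaler_eq0 (negPf v0) orbF => /eqP.
have Puniq u c e : P u c -> P u e -> c = e.
  move=> hc he; have := Plin (-1) _ _ _ _ hc he.
  by rewrite scaleN1r addNr mulN1r => /P0 /eqP; rewrite addrC subr_eq0 => /eqP.
pose vs u := projT1 (cid (Pex u)).
have vsP u : P u (vs u) by rewrite /vs; case: cid.
exists vs; split.
- move=> a u w; apply: Puniq (vsP _) _.
  by apply: Plin; exact: vsP.
- apply: Puniq (vsP _) _; exists 0%N, (fun d => if d is 0 then v else 0).
  split=> [[|d]||]; rewrite ?scale1r //; last by rewrite big_ord_recl big_ord0 addr0.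
    by apply: lin_span_gen; exists [::].
  exact: lin_span0.
- move=> a u ha; apply: Puniq (vsP _) _; have [D [y [hy _ ->]]] := vsP u.
  exists D.+1, (fun d => if d is e.+1 then rho (qF q a) (y e) else 0); split.
  + by case=> [|d]; [exact: lin_span0|exact: Gr_F].
  + by rewrite scale0r.
  + by rewrite [RHS]big_ord_recl /= add0r linear_sum.
- move=> a u; apply: Puniq (vsP _) _; have [D [y [hy y0 E]]] := vsP u.
  exists D, (fun d => rho (qK q a) (y d)); split=> [d||].
  + exact: Gr_K.
  + by rewrite y0 linearZ /= Kv scalerA mulrC.
  + by rewrite {1}E linear_sum.
Qed.

End CompactModule.

(* The value at the word a_1 .. a_k of the function attached to a vector x is
   the coefficient of the highest weight vector in E_{a_k} .. E_{a_1} x; this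
   forces the formulas for the operators. *)
Section WordModule.
Context (F : fieldType) (q : F) (q0 : q != 0) (n : nat).
Local Notation root := (simple_root n).
Context (L : root -> F) (L0 : forall a, L a != 0).
Let hh := (q - q^-1)^-1.

Definition words : lmodType F := [the lmodType F of (seq root -> F^o)].

Lemma words_nontrivial : exists g : words, g != 0.
Proof.
exists (fun=> 1); apply/eqP => /(congr1 (fun g => g [::])) /eqP.
by rewrite (oner_eq0 F).
Qed.
Local Notation A := (lend_of words_nontrivial).

Lemma wordsDE (g g' : words) w : (g + g') w = g w + g' w. Proof. by []. Qed.
Lemma wordsZE c (g : words) w : (c *: g) w = c * g w. Proof. by []. Qed.

(** The power of q acquired when K_a is moved to the left past the E's of the word, times the
    eigenvalue of K_a on the highest weight vector. *)
Definition weight_coef (a : root) (w : seq root) : F :=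
  L a * q ^ (- \sum_(b <- w) pairing a b).

Lemma weight_coef_neq0 a w : weight_coef a w != 0.
Proof. by rewrite mulf_neq0 ?expfz_neq0. Qed.

Lemma weight_coef_cons a b w :
  weight_coef a (b :: w) = q ^ (- pairing a b) * weight_coef a w.
Proof. by rewrite /weight_coef big_cons opprD expfzDr //; ring. Qed.

Definition wE (a : root) (g : words) : words := fun w => g (a :: w).
Definition wK (a : root) (g : words) : words := fun w => weight_coef a w * g w.
Definition wKV (a : root) (g : words) : words := fun w => (weight_coef a w)^-1 * g w.
(** The E's of the word are moved past F_a by E_b F_a = F_a E_b + [E_b, F_a]. At the empty word the
    value is 0, since a vector F_a x has no component along the highest weight vector. *)
Fixpoint wF (a : root) (g : words) (w : seq root) : F :=
  if w is b :: w' then wF a (wE b g) w' +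
    (if `[< b = a >] then hh * (wK a g w' - wKV a g w') else 0)
  else 0.

Fact wE_linear a : linear (wE a).
Proof. by []. Qed.
Fact wK_linear a : linear (wK a).
Proof. by move=> c g g'; apply/funext => w; rewrite /wK /= mulrDr mulrCA. Qed.
Fact wKV_linear a : linear (wKV a).
Proof. by move=> c g g'; apply/funext => w; rewrite /wKV /= mulrDr mulrCA. Qed.
Fact wF_linear a : linear (wF a : words -> words).
Proof.
move=> c g g'; apply/funext => w; elim: w g g' => [|b w IH] g g'.
  by rewrite wordsDE wordsZE /= mulr0 addr0.
rewrite wordsDE wordsZE /= wE_linear IH wK_linear wKV_linear !wordsDE !wordsZE.
by case: ifP => _; ring.
Qed.

Definition lE a : A := Lend _ (wE_linear a).
Definition lF a : A := Lend _ (wF_linear a).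
Definition lK a : A := Lend _ (wK_linear a).
Definition lKV a : A := Lend _ (wKV_linear a).

Lemma wFZ a c (g : words) : wF a (c *: g) = c *: (wF a g : words).
Proof. exact: (lendZ (lF a)). Qed.

Lemma words_preUq : preUq q (@pairing n) lE lF lK lKV.
Proof.
split=> [a|a|a b|a b|a b|a|a b ab]; apply: lendP => g; apply/funext => w.
- by rewrite /= /wK /wKV mulrA mulfV ?mul1r ?weight_coef_neq0.
- by rewrite /= /wK /wKV mulrA mulVf ?mul1r ?weight_coef_neq0.
- by rewrite /= /wK mulrCA.
- rewrite lend_scaleE wordsZE /= /wK /wE weight_coef_cons.
  by rewrite !mulrA -expfzDr // addrN mul1r.
- rewrite lend_scaleE wordsZE /=.
  elim: w g => [|c w IH] g; first by rewrite /wK /= !mulr0.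
  rewrite {1}/wK /= weight_coef_cons mulrDr.
  have -> : wE c (wK a g) = q ^ (- pairing a c) *: wK a (wE c g).
    by apply/funext => u; rewrite wordsZE /wE /wK weight_coef_cons; exact/esym/mulrA.
  rewrite wFZ wordsZE.
  have := IH (wE c g); rewrite {1}/wK /= => E.
  rewrite -mulrA E; case: asboolP => [->|_]; rewrite /wKV /wK /=; last by ring.
  by ring.
- rewrite -[LHS]/(wF a (wE a g) w + (if `[< a = a >] then hh * (wK a g w - wKV a g w)
    else 0) - wF a (wE a g) w).
  by case: asboolP => // _; rewrite addrC addKr.
- rewrite -[LHS]/(wF b (wE a g) w + (if `[< a = b >] then hh * (wK b g w - wKV b g w)
    else 0) - wF b (wE a g) w).
  by case: asboolP => // _; rewrite addr0 subrr.
Qed.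

(** The value of a function at w is the value at the empty word of its image under the E's along w.
    Hence an operator commuting with the E's is determined by the values it produces at the empty
    word. *)
Lemma words_eq0 (s : A) : (forall c, lE c * s = s * lE c) ->
  (forall g, s g [::] = 0) -> s = 0.
Proof.
move=> sE s0; apply: lendP => g; apply/funext => w.
elim: w g => [|c w IH] g; first exact: s0.
exact: etrans (congr1 (fun f : A => f g w) (sE c)) (IH (lE c g)).
Qed.

(** By [serre_comm] the Serre element commutes with the E's, and anything in the image of an F
    vanishes at the empty word. *)
Lemma words_serreF a b : pairing a b = -1 -> serre q (lF a) (lF b) = 0.
Proof.
move=> ab; apply: words_eq0 => [c|g].
  exact (serre_comm q0 (@pairingC n) (@pairing_id n) words_preUq c ab).
rewrite -[LHS]/(0 - (q + q^-1) * 0 + 0) mulr0.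
by rewrite subr0 addr0.
Qed.

Lemma words_FF a b : pairing a b = 0 -> lF a * lF b = lF b * lF a.
Proof.
move=> ab; have nab : a <> b by move=> E; move: ab; rewrite E pairing_id.
apply/eqP; rewrite -subr_eq0; apply/eqP; apply: words_eq0 => [c|g].
  exact (commutator_comm q0 (@pairingC n) words_preUq c nab ab).
by rewrite -[LHS]/(0 - 0 : F) subr0.
Qed.

(** The E's act by free shifts, so their Serre elements do not vanish on all functions. Commutation
    with the F's reduces the relation to generators of a submodule. *)
Lemma words_serreE a b c : pairing a b = -1 ->
  lF c * serre q (lE a) (lE b) = serre q (lE a) (lE b) * lF c.
Proof.
move=> ab; exact (serre_comm q0 (@pairingC n) (@pairing_id n)
  (preUq_swap q0 words_preUq) c ab).
Qed.

Lemma words_EE a b c : pairing a b = 0 ->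
  lF c * (lE a * lE b - lE b * lE a) = (lE a * lE b - lE b * lE a) * lF c.
Proof.
move=> ab; have nab : a <> b by move=> E; move: ab; rewrite E pairing_id.
exact (commutator_comm q0 (@pairingC n) (preUq_swap q0 words_preUq) c nab ab).
Qed.

(* The submodule generated by vectors killed by the Serre elements of the E's:
   there the remaining relations hold too. *)
Section Submodule.
Context (S : words -> Prop).
Hypothesis S_E : forall a x, S x -> S (lE a x) \/ lE a x = 0.
Hypothesis S_K : forall a x, S x -> S (lK a x).
Hypothesis S_KV : forall a x, S x -> S (lKV a x).
Hypothesis S_serre : forall a b x, pairing a b = -1 -> S x ->
  serre q (lE a) (lE b) x = 0.
Hypothesis S_comm : forall a b x, pairing a b = 0 -> S x ->
  (lE a * lE b - lE b * lE a) x = 0.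
Hypothesis S_nz : exists2 x, S x & x != 0.

Definition lFword (w : seq root) (x : words) : words :=
  foldr (fun a y => lF a y) x w.
Definition sub_gen (y : words) : Prop := exists w x, S x /\ y = lFword w x.
Definition sub := lspan sub_gen.

Lemma sub_ind (P : words -> Prop) :
  P 0 -> (forall x y, P x -> P y -> P (x + y)) -> (forall c x, P x -> P (c *: x)) ->
  (forall w x, S x -> P (lFword w x)) -> forall x, lin_span sub_gen x -> P x.
Proof.
move=> P0 PD PZ PF x; elim=> {x} [//|x [w [y [Sy ->]]]|x y _ + _|c x _].
- exact: PF.
- exact: PD.
- exact: PZ.
Qed.

Lemma sub_stable (T : A) : (forall w x, S x -> lin_span sub_gen (T (lFword w x))) ->
  forall x, lin_span sub_gen x -> lin_span sub_gen (T x).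
Proof.
move=> h; apply: sub_ind => //.
- by rewrite lend0; exact: lin_span0.
- by move=> x y hx hy; rewrite lendD; exact: lin_spanD.
- by move=> c x hx; rewrite lendZ; exact: lin_spanZ.
Qed.

Lemma sub_F a x : lin_span sub_gen x -> lin_span sub_gen (lF a x).
Proof. by apply: sub_stable => w y Sy; apply: lin_span_gen; exists (a :: w), y. Qed.

Lemma sub_K a x : lin_span sub_gen x -> lin_span sub_gen (lK a x).
Proof.
apply: sub_stable => w y Sy; elim: w => [|b w IH].
  by apply: lin_span_gen; exists [::], (lK a y); split=> //; exact: S_K.
have -> : lK a (lFword (b :: w) y) = q ^ (- pairing a b) *: lF b (lK a (lFword w y)).
  by have := congr1 (fun f : A => f (lFword w y)) (preUq_KF words_preUq a b).
by apply: lin_spanZ; exact: sub_F.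
Qed.

Lemma sub_KV a x : lin_span sub_gen x -> lin_span sub_gen (lKV a x).
Proof.
apply: sub_stable => w y Sy; elim: w => [|b w IH].
  by apply: lin_span_gen; exists [::], (lKV a y); split=> //; exact: S_KV.
have -> : lKV a (lFword (b :: w) y) = q ^ (pairing a b) *: lF b (lKV a (lFword w y)).
  by have := congr1 (fun f : A => f (lFword w y)) (preUq_KVF q0 words_preUq a b).
by apply: lin_spanZ; exact: sub_F.
Qed.

Lemma sub_E a x : lin_span sub_gen x -> lin_span sub_gen (lE a x).
Proof.
apply: sub_stable => w y Sy; elim: w => [|b w IH].
  case: (S_E a Sy) => h; last first.
    by have -> : lE a (lFword [::] y) = 0 by []; exact: lin_span0.
  by apply: lin_span_gen; exists [::], (lE a y).
have Fw : lin_span sub_gen (lFword w y) by apply: lin_span_gen; exists w, y.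
case: (EM (a = b)) => [E|ab]; last first.
  have -> : lE a (lFword (b :: w) y) = lF b (lE a (lFword w y)).
    exact (congr1 (fun f : A => f (lFword w y)) (preUq_EFC words_preUq ab)).
  exact: sub_F.
subst b; have -> : lE a (lFword (a :: w) y) = lF a (lE a (lFword w y)) +
    hh *: (lK a (lFword w y) - lKV a (lFword w y)).
  have h : lE a (lF a (lFword w y)) - lF a (lE a (lFword w y)) =
      hh *: (lK a (lFword w y) - lKV a (lFword w y)).
    exact (congr1 (fun f : A => f (lFword w y)) (preUq_EF words_preUq a)).
  by rewrite -h (addrC (lF a _)) subrK.
apply: lin_spanD; first exact: sub_F.
apply: lin_spanZ; apply: lin_spanD; first exact: sub_K.
by rewrite -scaleN1r; apply: lin_spanZ; exact: sub_KV.
Qed.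

Lemma sub_nontrivial : exists x : sub, x != 0.
Proof.
case: S_nz => x Sx x0.
have hx : x \in span_pred sub_gen.
  by apply/span_predP; apply: lin_span_gen; exists [::], x.
exists (LSpan hx); apply: contra x0 => /eqP /(congr1 (@lspan_val _ _ _)) /= ->.
by [].
Qed.

Lemma restr_proof (T : A) : (forall x, lin_span sub_gen x -> lin_span sub_gen (T x)) ->
  forall x : sub, T (lspan_val x) \in span_pred sub_gen.
Proof. by move=> hT x; apply/span_predP/hT/span_predP; exact: lspan_valP. Qed.

Lemma restr_linear (T : A) (hT : forall x, lin_span sub_gen x -> lin_span sub_gen (T x)) :
  linear (fun x : sub => LSpan (restr_proof hT x)).
Proof. by move=> c x y; apply: val_inj; rewrite /= lend_linear. Qed.

Definition restr (T : A) hT : lend_of sub_nontrivial := Lend _ (@restr_linear T hT).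

Definition sE a := restr (@sub_E a).
Definition sF a := restr (@sub_F a).
Definition sK a := restr (@sub_K a).
Definition sKV a := restr (@sub_KV a).

Lemma sub_isUq : isUq q sE sF sK sKV.
Proof.
(* An operator that commutes with the F's and kills [S] kills everything that the F's generate from
   [S]. *)
have ext (T : A) : (forall c, lF c * T = T * lF c) -> (forall x, S x -> T x = 0) ->
    forall x : sub, T (lspan_val x) = 0.
  move=> TF TS x; have /span_predP := lspan_valP x.
  elim/sub_ind => [|y z hy hz|c y hy|w y Sy].
  - exact: lend0.
  - by rewrite lendD hy hz addr0.
  - by rewrite lendZ hy scaler0.
  elim: w => [|b w IH]; first exact: TS.
  have <- : lF b (T (lFword w y)) = T (lFword (b :: w) y).
    exact (congr1 (fun f : A => f (lFword w y)) (TF b)).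
  by rewrite IH lend0.
have H := words_preUq.
split; first split.
- move=> a; apply: lendP => x; apply: val_inj.
  exact (congr1 (fun f : A => f (lspan_val x)) (preUq_KKV H a)).
- move=> a; apply: lendP => x; apply: val_inj.
  exact (congr1 (fun f : A => f (lspan_val x)) (preUq_KVK H a)).
- move=> a b; apply: lendP => x; apply: val_inj.
  exact (congr1 (fun f : A => f (lspan_val x)) (preUq_KK H a b)).
- move=> a b; apply: lendP => x; apply: val_inj.
  exact (congr1 (fun f : A => f (lspan_val x)) (preUq_KE H a b)).
- move=> a b; apply: lendP => x; apply: val_inj.
  exact (congr1 (fun f : A => f (lspan_val x)) (preUq_KF H a b)).
- move=> a; apply: lendP => x; apply: val_inj.
  exact (congr1 (fun f : A => f (lspan_val x)) (preUq_EF H a)).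
- move=> a b ab; apply: lendP => x; apply: val_inj.
  exact (congr1 (fun f : A => f (lspan_val x)) (preUq_EF0 H ab)).
- move=> a b ab; apply: lendP => x; apply: val_inj; apply/eqP.
  rewrite -subr_eq0; apply/eqP.
  by apply: (ext _ (fun c => words_EE c ab)) => y; exact: S_comm.
- move=> a b ab; apply: lendP => x; apply: val_inj.
  exact (congr1 (fun f : A => f (lspan_val x)) (words_FF ab)).
- move=> a b ab; apply: lendP => x; apply: val_inj.
  by apply: (ext _ (fun c => words_serreE c ab)) => y; exact: S_serre.
- move=> a b ab; apply: lendP => x; apply: val_inj.
  exact (congr1 (fun f : A => f (lspan_val x)) (words_serreF ab)).
Qed.

End Submodule.

End WordModule.

(** * V embeds into M(V) *)

Section Embedding.
Context (F : fieldType) (q : F) (q0 : q != 0) (n : nat).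
Hypothesis qNroot : forall m : nat, q ^+ m = 1 -> m = 0%N.
Local Notation root := (simple_root n).
Local Notation Uq := (Uq q n).
Local Notation Uk := (@Uk F q n).
Local Notation UkAplus := (@UkAplus F q n).
Local Notation lE := (lE F).
Context (V : vectType F) (rho : Uq -> 'End(V)) (v : V) (L : root -> F).
Hypothesis rep : is_rep UkAplus rho.
Hypothesis irr : irreducible_rep Uk rho.
Hypothesis rhoZ : forall i j : 'I_n, rho (Z q n i j) = 0.
Hypothesis v0 : v != 0.
Hypothesis Ev : forall a, compact_root a -> rho (qE q a) v = 0.
Hypothesis Kv : forall a, rho (qK q a) v = L a *: v.

Let L0 a : L a != 0 := L_neq0 rep v0 Kv a.

Context (vs : V -> F).
Hypothesis vsl : linear (vs : V -> F^o).
Hypothesis vsv : vs v = 1.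
Hypothesis vsF : forall a u, compact_root a -> vs (rho (qF q a) u) = 0.
Hypothesis vsK : forall a u, vs (rho (qK q a) u) = L a * vs u.

Definition epsE (a : root) (u : V) : V := if compact_root a then rho (qE q a) u else 0.

(** The matrix coefficients of u against the functional [vs]. E_beta is made to act on V by 0, so a
    word containing beta has value 0. *)
Fixpoint phi (u : V) (w : seq root) : F :=
  if w is a :: w' then phi (epsE a u) w' else vs u.

Lemma epsE_linear a : linear (epsE a).
Proof.
by move=> c x y; rewrite /epsE; case: ifP => _; rewrite ?linearP // scaler0 addr0.
Qed.

Lemma phi_linear : linear (phi : V -> words F n).
Proof.
move=> c x y; apply/funext => w; elim: w x y => [|a w IH] x y; first exact: vsl.
by rewrite wordsDE wordsZE /= epsE_linear IH.
Qed.
Lemma phi0 : phi 0 = 0 :> words F n.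
Proof.
by have := phi_linear (-1) 0 0; rewrite scaler0 addr0 scaleN1r addNr.
Qed.
Lemma phiDw u w : phi (u + w) = (phi u : words F n) + phi w.
Proof. by have := phi_linear 1 u w; rewrite !scale1r. Qed.
Lemma phiZw c u : phi (c *: u) = c *: (phi u : words F n).
Proof. by have := phi_linear c u 0; rewrite phi0 !addr0. Qed.

Lemma phiZE c u w : phi (c *: u) w = c * phi u w.
Proof. exact (congr1 (fun f : words F n => f w) (phiZw c u)). Qed.
Lemma phiDE u u' w : phi (u + u') w = phi u w + phi u' w.
Proof. exact (congr1 (fun f : words F n => f w) (phiDw u u')). Qed.

Lemma phiNE u w : phi (- u) w = - phi u w.
Proof. by rewrite -scaleN1r phiZE mulN1r. Qed.

Lemma phi_E a u : lE a (phi u : words F n) = phi (epsE a u).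
Proof. by []. Qed.

Lemma phi_K a u : lK q L a (phi u : words F n) = phi (rho (qK q a) u).
Proof.
apply/funext => w; elim: w u => [|b w IH] u /=.
  by rewrite /wK /weight_coef big_nil oppr0 expr0z mulr1 vsK.
rewrite /wK (weight_coef_cons q0 L) /=.
have -> : epsE b (rho (qK q a) u) = q ^ (- pairing a b) *: rho (qK q a) (epsE b u).
  rewrite /epsE; case: ifP => hb; last by rewrite linear0 scaler0.
  by rewrite (rep_KE rep) // scalerA -expfzDr // addNr expr0z scale1r.
by rewrite phiZE -IH -mulrA.
Qed.

Lemma phi_KV a u : lKV q L a (phi u : words F n) = phi (rho (qKV q a) u).
Proof.
rewrite -{1}[u](rep_KKV rep a) -phi_K.
exact (congr1 (fun f : lend_of _ => f (phi (rho (qKV q a) u) : words F n))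
  (preUq_KVK (words_preUq q0 L0) a)).
Qed.

(** Both sides obey the same recursion on the word, and both vanish at the empty word because [vs]
    kills the image of the F's. *)
Lemma phi_F a u : compact_root a -> lF q L a (phi u : words F n) = phi (rho (qF q a) u).
Proof.
move=> ha; apply/funext => w; elim: w u => [|b w IH] u /=; first by rewrite vsF.
have -> : wE b (phi u : words F n) = phi (epsE b u) by [].
have := IH (epsE b u) => /= ->.
rewrite -/(lK q L a _) -/(lKV q L a _).
rewrite /epsE; case hb: (compact_root b); last first.
  case: asboolP => [E|_]; first by rewrite E ha in hb.
  by rewrite linear0 addr0.
rewrite (rep_EF rep) //; case: asboolP => _; last by rewrite !addr0.
rewrite phiDE phiZE phiDE phiNE.
by rewrite -phi_K -phi_KV.
Qed.

Lemma rep_serre x y u : UkAplus x -> UkAplus y -> serre q x y = 0 ->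
  rho x (rho x (rho y u)) - (q + q^-1) *: rho x (rho y (rho x u))
    + rho y (rho x (rho x u)) = 0.
Proof.
move=> hx hy h.
have hM a b : UkAplus a -> UkAplus b -> UkAplus (a * b) := @subalgM _ _ _ a b.
have hZ c a : UkAplus a -> UkAplus (c *: a).
  move=> ha; rewrite -[a]mul1r scalerAl; apply: subalgM => //.
  exact: subalg_scalar.
have E a b c : UkAplus a -> UkAplus b -> UkAplus c ->
    rho (a * b * c) u = rho a (rho b (rho c u)).
  by move=> ha hb hc; rewrite (repM rep u (hM _ _ ha hb) hc) (repM rep).
have h1 := hM _ _ (hM _ _ hx hx) hy.
have h2 := hM _ _ (hM _ _ hx hy) hx.
have h3 := hM _ _ (hM _ _ hy hx) hx.
rewrite -(E x x y hx hx hy) -(E x y x hx hy hx) -(E y x x hy hx hx) -scaleNr.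
rewrite -(repZ rep _ u h2) -(repD rep u h1 (hZ _ _ h2)).
rewrite -(repD rep u (subalgD h1 (hZ _ _ h2)) h3).
by rewrite scaleNr -/(serre q x y) h -(scale0r (1 : Uq)) (repA rep) scale0r.
Qed.

Lemma epsE_serre a b u : pairing a b = -1 ->
  epsE a (epsE a (epsE b u)) - (q + q^-1) *: epsE a (epsE b (epsE a u))
    + epsE b (epsE a (epsE a u)) = 0.
Proof.
move=> ab; rewrite /epsE; case ha: (compact_root a); case hb: (compact_root b);
  rewrite ?linear0 ?scaler0 ?subr0 ?addr0 //.
apply: rep_serre; [exact/UkAplus_Uk/Uk_qE..|].
exact (isUq_serreE (isUq_Uq q n) ab).
Qed.

Lemma epsE_comm a b u : pairing a b = 0 -> epsE a (epsE b u) = epsE b (epsE a u).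
Proof.
move=> ab; rewrite /epsE; case ha: (compact_root a); case hb: (compact_root b);
  rewrite ?linear0 //.
apply: (rep_comm rep); [exact/UkAplus_Uk/Uk_qE..|].
exact (isUq_EE (isUq_Uq q n) ab).
Qed.

(** The kernel is stable under U_q(k), so a nonzero kernel would be all of V; but [phi v] is 1 at
    the empty word. *)
Lemma phi_inj u : phi u = 0 :> words F n -> u = 0.
Proof.
move=> hu; apply: contrapT => /eqP u0.
have : forall w, phi w = 0 :> words F n.
  apply: (irr_pred rep irr).
  - exact: phi0.
  - by move=> c x y hx hy; rewrite phi_linear hx hy scaler0 addr0.
  - move=> a x ha hx.
    have -> : rho (qE q a) x = epsE a x by rewrite /epsE ha.
    by rewrite -phi_E hx lend0.
  - by move=> a x ha hx; rewrite -phi_F // hx lend0.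
  - by move=> a x hx; rewrite -phi_K hx lend0.
  - by exists u.
move=> /(_ v) /(congr1 (fun f => f [::])) /= /eqP.
by rewrite vsv (oner_eq0 F).
Qed.

(** The difference of the two sides is killed by the E's and by [vs], so all its matrix coefficients
    vanish. *)
Lemma killed_line u : (forall a, compact_root a -> rho (qE q a) u = 0) -> u = vs u *: v.
Proof.
move=> hu; apply/eqP; rewrite -subr_eq0; apply/eqP/phi_inj.
have eps0 a : epsE a (u - vs u *: v) = 0.
  rewrite /epsE; case ha: (compact_root a) => //.
  by rewrite linearB /= linearZ /= Ev // scaler0 subr0 hu.
apply/funext => -[|a w] /=; last by rewrite eps0 phi0.
have -> : u - vs u *: v = - vs u *: v + u by rewrite scaleNr addrC.
by rewrite vsl vsv /GRing.scale /= mulr1 addNr.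
Qed.

Definition imphi (x : words F n) : Prop := exists u, x = phi u.

Lemma imphi_E a x : imphi x -> imphi (lE a x) \/ lE a x = 0.
Proof. by case=> u ->; left; exists (epsE a u). Qed.
Lemma imphi_K a x : imphi x -> imphi (lK q L a x).
Proof. by case=> u ->; exists (rho (qK q a) u); rewrite phi_K. Qed.
Lemma imphi_KV a x : imphi x -> imphi (lKV q L a x).
Proof. by case=> u ->; exists (rho (qKV q a) u); rewrite phi_KV. Qed.
Lemma imphi_serre a b x : pairing a b = -1 -> imphi x -> serre q (lE a) (lE b) x = 0.
Proof.
move=> ab [u ->]; rewrite -phi0 -(epsE_serre u ab) !phiDw -scaleNr phiZw.
by rewrite scaleNr.
Qed.
Lemma imphi_comm a b x : pairing a b = 0 -> imphi x -> (lE a * lE b - lE b * lE a) x = 0.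
Proof.
move=> ab [u ->].
have -> : (lE a * lE b - lE b * lE a) (phi u : words F n) =
  (phi (epsE a (epsE b u)) : words F n) - phi (epsE b (epsE a u)) by [].
by rewrite epsE_comm // subrr.
Qed.
Lemma imphi_nz : exists2 x, imphi x & x != 0.
Proof.
exists (phi v); first by exists v.
by apply/eqP => /phi_inj /eqP; rewrite (negPf v0).
Qed.

Let subU := sub_isUq q0 L0 imphi_E imphi_K imphi_KV imphi_serre imphi_comm imphi_nz.

Lemma imphi_sub u : (phi u : words F n) \in span_pred (sub_gen q L imphi).
Proof.
apply/span_predP; apply: lin_span_gen; exists [::], (phi u).
by split=> //; exists u.
Qed.

(** The submodule of functions on words generated by the image of [phi] is a U_q-module, because the
    relations among the E's hold on V. [verma_lift] maps M(V) to it and sends [v] to [phi v]. *)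
Lemma verma_gen_neq0 : verma_gen rho v <> 0.
Proof.
pose f u : umod subU := LSpan (imphi_sub u).
have [||||||g [gl gE]] := verma_lift rep rhoZ (phi := f).
- by move=> x y; apply: val_inj; exact: phiDw.
- move=> c x; rewrite umod_scalar; apply: val_inj; exact: phiZw.
- move=> a ha x; have [-> _ _ _] := umod_scaleE a (f x).
  by apply: val_inj; rewrite /= /epsE -[wE a _]/(phi (epsE a x)) /epsE ha.
- move=> a ha x; have [_ -> _ _] := umod_scaleE a (f x).
  by apply: val_inj; exact/esym/phi_F.
- move=> a x; have [_ _ -> _] := umod_scaleE a (f x).
  by apply: val_inj; exact/esym/phi_K.
- move=> x; have [-> _ _ _] := umod_scaleE beta (f x).
  by apply: val_inj; exact: phi0.
move=> h; have := gE v; rewrite h.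
have -> : g 0 = 0.
  by have := gl (-1) 0 0; rewrite scaler0 addr0 scaleN1r addNr.
move=> /(congr1 (@lspan_val _ _ _)) /= /esym /phi_inj /eqP.
by rewrite (negPf v0).
Qed.

(** The kernel of [verma_gen] is stable under U_q(k) and misses [v], so irreducibility makes it
    0. *)
Lemma verma_gen_inj u : verma_gen rho u = 0 -> u = 0.
Proof.
move=> hu; apply: contrapT => /eqP u0; apply: verma_gen_neq0.
have h0 : verma_gen rho 0 = 0 by apply: (addrI (verma_gen rho 0)); rewrite -verma_genD !addr0.
move: v; apply: (irr_pred rep irr).
- exact: h0.
- move=> c x y hx hy; rewrite verma_genD hy addr0 -(repA rep) verma_gen_scale ?hx ?scaler0 //.
  exact: subalg_scalar.
- by move=> a x ha hx; rewrite verma_gen_scale ?hx ?scaler0 //; exact/UkAplus_Uk/Uk_qE.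
- by move=> a x ha hx; rewrite verma_gen_scale ?hx ?scaler0 //; exact/UkAplus_Uk/Uk_qF.
- by move=> a x hx; rewrite verma_gen_scale ?hx ?scaler0 //; exact/UkAplus_Uk/Uk_qK.
- by exists u.
Qed.

End Embedding.

(** * The fermionic Fock module *)

(* U_q acts on the exterior algebra of the natural module of gl(2n): a state is
   a set of occupied sites, and the root at position p of the Dynkin diagram
   moves a particle between the sites p and p + 1. *)
Section Particles.

Definition sw (p : nat) (S : nat -> bool) : nat -> bool :=
  fun x => if x == p then S p.+1 else if x == p.+1 then S p else S x.

Lemma swl p S : sw p S p = S p.+1.
Proof. by rewrite /sw eqxx. Qed.
Lemma swr p S : sw p S p.+1 = S p.
Proof. by rewrite /sw eqxx ifF //; lia. Qed.
Lemma swo p S x : x <> p -> x <> p.+1 -> sw p S x = S x.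
Proof. by rewrite /sw; case: eqP => // _; case: eqP. Qed.
Lemma swK p S : sw p (sw p S) = S.
Proof.
apply/funext => x; case: (eqVneq x p) => [->|/eqP h]; first by rewrite swl swr.
by case: (eqVneq x p.+1) => [->|/eqP h']; rewrite ?swr ?swl // !swo.
Qed.
Lemma swC p r S : (p.+1 < r)%N || (r.+1 < p)%N -> sw p (sw r S) = sw r (sw p S).
Proof.
move=> pr; apply/funext => x; rewrite /sw.
by do 12?[case: eqP => //=]; move=> *; congr S; lia.
Qed.

Definition charge (p : nat) (S : nat -> bool) : int := (S p)%:Z - (S p.+1)%:Z.

Definition pos_pairing (p r : nat) : int :=
  if p == r then 2 else if (p == r.+1) || (r == p.+1) then -1 else 0.

Lemma charge_sw p r S : S r && ~~ S r.+1 ->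
  charge p S = pos_pairing p r + charge p (sw r S).
Proof.
case/andP => Sr Sr1; rewrite /charge /pos_pairing.
case: (eqVneq p r) => [->|pr]; first by rewrite swl swr Sr (negPf Sr1).
case: (eqVneq p r.+1) => [->|pr1].
  by rewrite swr swo ?Sr ?(negPf Sr1) /=; try lia; case: (S r.+2).
case: (eqVneq r p.+1) => [E|rp].
  by subst r; rewrite swl swo ?Sr ?(negPf Sr1) /=; try lia; case: (S p).
by rewrite !swo /=; try lia; rewrite add0r.
Qed.

End Particles.

Section Fermions.
Context (F : fieldType) (q : F) (q0 : q != 0) (h0 : q - q^-1 != 0) (n : nat).
Local Notation root := (simple_root n).
Context (Y : lmodType F).
(** Functions from states to Y stand for Y tensored with Fock space; finite support is not
    imposed. *)
Definition fock : lmodType F := [the lmodType F of ((nat -> bool) -> Y)].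
Context (nz : exists f : fock, f != 0).
Local Notation A := (lend_of nz).

Lemma fockDE (f g : fock) S : (f + g) S = f S + g S. Proof. by []. Qed.
Lemma fockZE c (f : fock) S : (c *: f) S = c *: f S. Proof. by []. Qed.

(** Defined by pullback on functions, it moves a particle from site p + 1 to site p, and [fF] moves
    it back. Hops between adjacent sites carry no fermionic sign. *)
Definition fE (p : nat) (f : fock) : fock :=
  fun S => if S p && ~~ S p.+1 then f (sw p S) else 0.
Definition fF (p : nat) (f : fock) : fock :=
  fun S => if ~~ S p && S p.+1 then f (sw p S) else 0.
Definition fK (p : nat) (f : fock) : fock := fun S => q ^ charge p S *: f S.
Definition fKV (p : nat) (f : fock) : fock := fun S => q ^ (- charge p S) *: f S.

Fact fE_linear p : linear (fE p).
Proof.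
move=> c f g; apply/funext => S; rewrite fockDE fockZE /fE.
by case: ifP => _; rewrite ?scaler0 ?addr0.
Qed.
Fact fF_linear p : linear (fF p).
Proof.
move=> c f g; apply/funext => S; rewrite fockDE fockZE /fF.
by case: ifP => _; rewrite ?scaler0 ?addr0.
Qed.
Fact fK_linear p : linear (fK p).
Proof.
move=> c f g; apply/funext => S; rewrite fockDE fockZE /fK fockDE fockZE.
by rewrite scalerDr !scalerA mulrC.
Qed.
Fact fKV_linear p : linear (fKV p).
Proof.
move=> c f g; apply/funext => S; rewrite fockDE fockZE /fKV fockDE fockZE.
by rewrite scalerDr !scalerA mulrC.
Qed.

Definition aE (a : root) : A := Lend _ (fE_linear (dynkin_pos a)).
Definition aF (a : root) : A := Lend _ (fF_linear (dynkin_pos a)).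
Definition aK (a : root) : A := Lend _ (fK_linear (dynkin_pos a)).
Definition aKV (a : root) : A := Lend _ (fKV_linear (dynkin_pos a)).

Lemma dynkin_pos_inj : injective (@dynkin_pos n).
Proof.
case=> [i||i] [j||j] //= h; try (have := ltn_ord i); try (have := ltn_ord j); try lia.
- by move=> hj hi; congr mu; apply: val_inj => /=; lia.
- by move=> hj hi; congr nu; apply: val_inj => /=; lia.
Qed.

Lemma far_pos (a b : root) : pairing a b = 0 ->
  ((dynkin_pos a).+1 < dynkin_pos b)%N || ((dynkin_pos b).+1 < dynkin_pos a)%N.
Proof. by rewrite /pairing; case: eqP => // h1; case: ifP => // h2 _; lia. Qed.

Lemma adjacent_pos (a b : root) : pairing a b = -1 ->
  dynkin_pos a = (dynkin_pos b).+1 \/ dynkin_pos b = (dynkin_pos a).+1.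
Proof. by rewrite /pairing; case: eqP => // h1; case: ifP => // h2 _; lia. Qed.

Lemma fE_far p r (f : fock) : (p.+1 < r)%N || (r.+1 < p)%N ->
  fE p (fE r f) = fE r (fE p f).
Proof.
move=> pr; apply/funext => S; rewrite /fE !swo; try lia.
by rewrite (swC _ pr); case: (S p); case: (S p.+1); case: (S r); case: (S r.+1).
Qed.
Lemma fF_far p r (f : fock) : (p.+1 < r)%N || (r.+1 < p)%N ->
  fF p (fF r f) = fF r (fF p f).
Proof.
move=> pr; apply/funext => S; rewrite /fF !swo; try lia.
by rewrite (swC _ pr); case: (S p); case: (S p.+1); case: (S r); case: (S r.+1).
Qed.
Lemma fEF_far p r (f : fock) : (p.+1 < r)%N || (r.+1 < p)%N ->
  fE p (fF r f) = fF r (fE p f).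
Proof.
move=> pr; apply/funext => S; rewrite /fE /fF !swo; try lia.
by rewrite (swC _ pr); case: (S p); case: (S p.+1); case: (S r); case: (S r.+1).
Qed.
Lemma fEE0 p (f : fock) : fE p (fE p f) = 0.
Proof.
by apply/funext => S; rewrite /fE swl swr; case: (S p); case: (S p.+1).
Qed.
Lemma fFF0 p (f : fock) : fF p (fF p f) = 0.
Proof.
by apply/funext => S; rewrite /fF swl swr; case: (S p); case: (S p.+1).
Qed.
Lemma fEF_near p r (f : fock) : p = r.+1 \/ r = p.+1 ->
  fE p (fF r f) = 0 /\ fF r (fE p f) = 0.
Proof.
case=> ->; split; apply/funext => S; rewrite /fE /fF ?swl ?swr ?swo; try lia.
- by case: (S r.+1); case: (S r.+2); rewrite ?andbF.
- by case: (S r.+1); case: (S r); rewrite ?andbF.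
- by case: (S p.+1); case: (S p); rewrite ?andbF.
- by case: (S p.+1); case: (S p.+2); rewrite ?andbF.
Qed.
Lemma fEEE_near p r (f : fock) : p = r.+1 \/ r = p.+1 -> fE p (fE r (fE p f)) = 0.
Proof.
case=> ->; apply/funext => S; rewrite /fE.
- rewrite !(swr, swl); rewrite (@swo r _ r.+2) ?swr ?swl; try lia.
  by case: (S r.+1); rewrite ?andbF ?if_same.
- rewrite !(swr, swl); rewrite (@swo p.+1 _ p) ?swl; try lia.
  by case: (S p.+1); rewrite ?andbF ?if_same.
Qed.
Lemma fFFF_near p r (f : fock) : p = r.+1 \/ r = p.+1 -> fF p (fF r (fF p f)) = 0.
Proof.
case=> ->; apply/funext => S; rewrite /fF.
- rewrite !(swr, swl); rewrite (@swo r _ r.+2) ?swr ?swl; try lia.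
  by case: (S r.+1); rewrite ?andbF ?if_same.
- rewrite !(swr, swl); rewrite (@swo p.+1 _ p) ?swl; try lia.
  by case: (S p.+1); rewrite ?andbF ?if_same.
Qed.

(** A site holds at most one particle, so E_p E_p = 0 and E_p E_r E_p = 0 for adjacent p and r,
    which kills every term of a Serre element. The charge c is 0, 1 or -1, where (q^c - q^-c) / (q -
    q^-1) = c; this gives the bracket of E with F. *)
Lemma fock_isUq : isUq q aE aF aK aKV.
Proof.
split; first split.
- move=> a; apply: lendP => f; apply/funext => S; rewrite /= /fK /fKV scalerA.
  by rewrite -expfzDr // addrN expr0z scale1r.
- move=> a; apply: lendP => f; apply/funext => S; rewrite /= /fK /fKV scalerA.
  by rewrite -expfzDr // addNr expr0z scale1r.
- move=> a b; apply: lendP => f; apply/funext => S; rewrite /= /fK.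
  by rewrite !scalerA mulrC.
- move=> a b; apply: lendP => f; apply/funext => S.
  rewrite lend_scaleE fockZE /= /fK /fE; case: ifP => h; last by rewrite !scaler0.
  by rewrite (charge_sw _ h) expfzDr // scalerA.
- move=> a b; apply: lendP => f; apply/funext => S.
  rewrite lend_scaleE fockZE /= /fK /fF; case: ifP => h; last by rewrite !scaler0.
  have hb : sw (dynkin_pos b) S (dynkin_pos b) && ~~ sw (dynkin_pos b) S (dynkin_pos b).+1.
    by rewrite swl swr andbC.
  rewrite (charge_sw (dynkin_pos a) hb) swK scalerA -expfzDr //.
  by rewrite /pairing -/(pos_pairing _ _) addKr.
- move=> a; apply: lendP => f; apply/funext => S.
  set p := dynkin_pos a.
  have -> : (aE a * aF a - aF a * aE a) f S = fE p (fF p f) S - fF p (fE p f) S by [].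
  have -> : ((q - q^-1)^-1 *: (aK a - aKV a)) f S =
    (q - q^-1)^-1 *: (q ^ charge p S *: f S - q ^ (- charge p S) *: f S) by [].
  rewrite -scalerBl scalerA /fE /fF swl swr swK.
  case E: (S p); case E1: (S p.+1); rewrite /=.
  + have -> : charge p S = 0 by rewrite /charge E E1.
    by rewrite subr0 oppr0 subrr mulr0 scale0r.
  + have -> : charge p S = 1 by rewrite /charge E E1.
    by rewrite expr1z exprN1 mulVf // scale1r subr0.
  + have -> : charge p S = -1 by rewrite /charge E E1.
    by rewrite opprK expr1z exprN1 -(opprB q) mulrN mulVf // scaleN1r sub0r.
  + have -> : charge p S = 0 by rewrite /charge E E1.
    by rewrite subr0 oppr0 subrr mulr0 scale0r.
- move=> a b ab; apply: lendP => f.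
  have -> : (aE a * aF b - aF b * aE a) f = fE (dynkin_pos a) (fF (dynkin_pos b) f)
    - fF (dynkin_pos b) (fE (dynkin_pos a) f) by [].
  case: (pairing_cases a b) => h.
  + move: h; rewrite /pairing; case: eqP => [/dynkin_pos_inj //|_]; by case: ifP.
  + by have [-> ->] := fEF_near f (adjacent_pos h); rewrite subrr.
  + by rewrite fEF_far ?far_pos // subrr.
- by move=> a b ab; apply: lendP => f; apply: fE_far; exact: far_pos.
- by move=> a b ab; apply: lendP => f; apply: fF_far; exact: far_pos.
- move=> a b ab; apply: lendP => f.
  have -> : serre q (aE a) (aE b) f = fE (dynkin_pos a) (fE (dynkin_pos a) (fE (dynkin_pos b) f))
    - (q + q^-1) *: fE (dynkin_pos a) (fE (dynkin_pos b) (fE (dynkin_pos a) f))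
    + fE (dynkin_pos b) (fE (dynkin_pos a) (fE (dynkin_pos a) f)) by [].
  rewrite !fEE0 (fEEE_near f (adjacent_pos ab)) scaler0 subr0 add0r.
  by rewrite -[fE _ 0]/(aE b 0) lend0.
- move=> a b ab; apply: lendP => f.
  have -> : serre q (aF a) (aF b) f = fF (dynkin_pos a) (fF (dynkin_pos a) (fF (dynkin_pos b) f))
    - (q + q^-1) *: fF (dynkin_pos a) (fF (dynkin_pos b) (fF (dynkin_pos a) f))
    + fF (dynkin_pos b) (fF (dynkin_pos a) (fF (dynkin_pos a) f)) by [].
  rewrite !fFF0 (fFFF_near f (adjacent_pos ab)) scaler0 subr0 add0r.
  by rewrite -[fF _ 0]/(aF b 0) lend0.
Qed.

End Fermions.

(** The recursion for W on operators of this shape: the two terms in [oS (f y)] cancel because q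
    q^-1 = 1, and only [oS' y] is left with the factor -q c. *)
Lemma step_rule (F : fieldType) (q c : F) (X Y : lmodType F) (nz : exists x : X, x != 0)
    (Tg Tf : lend_of nz) (g f : Y -> Y) (o oS oS' : Y -> X) :
  q != 0 -> (forall y, Tf (o y) = o (f y)) ->
  (forall y, Tg (o y) = q^-1 *: o (g y) + c *: oS y) ->
  (forall y, Tf (oS y) = q^-1 *: oS (f y) + oS' y) ->
  {morph o : y z / y - z} -> (forall a, {morph o : y / a *: y}) ->
  forall y, Tg (Tf (o y)) - q *: Tf (Tg (o y)) =
    q^-1 *: o (g (f y) - q *: f (g y)) + (- q * c) *: oS' y.
Proof.
move=> q0 hf hg hS oB oZ y; rewrite hf !hg lendD !lendZ hf hS oB oZ.
by module_eq F X; field.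
Qed.

Lemma scale_qcomm (F : fieldType) (A : algType F) (N : lmodType A) (u v : A) (c : F) (y : N) :
  (u * v - c *: (v * u)) *: y =
  (u *: (v *: y) : scalar_restr N) - c *: (v *: (u *: y) : scalar_restr N).
Proof. by rewrite scalerBl scale_algE -!scalerA. Qed.

(** * Tensor product with the Fock module and independence in degree one *)

Section TensorFock.
Context (F : fieldType) (q : F) (q0 : q != 0) (h0 : q - q^-1 != 0) (n : nat).
Local Notation root := (simple_root n).
Local Notation Uq := (Uq q n).
Context (N : lmodType Uq) (nzN : exists y : N, y != 0).
Local Notation Y := (scalar_restr N).
Local Notation fock := (fock Y).

(** The pure tensor of [y] with the basis state [S]. *)
Definition occ (S : nat -> bool) (y : Y) : fock := fun S' => if `[< S' = S >] then y else 0.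

Lemma occE S y : occ S y S = y.
Proof. by rewrite /occ; case: asboolP. Qed.
Lemma occN S S' y : S' <> S -> occ S y S' = 0.
Proof. by rewrite /occ; case: asboolP. Qed.

Lemma fock_nz : exists f : fock, f != 0.
Proof.
case: nzN => y y0; exists (occ (fun=> true) (y : Y)).
apply: contra y0 => /eqP /(congr1 (fun f : fock => f (fun=> true))).
by rewrite occE => ->.
Qed.
Local Notation A := (lend_of fock_nz).

Fact coeff_act_linear (u : Uq) : linear (fun (f : fock) => (fun S => u *: (f S : N) : Y) : fock).
Proof.
move=> c f g; apply/funext => S.
exact: (@restr_scaleDr F Uq N c u (f S) (g S)).
Qed.
Definition coeff_act (u : Uq) : A := Lend _ (coeff_act_linear u).

Lemma coeff_actE u f S : coeff_act u f S = u *: (f S : N).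
Proof. by []. Qed.

Lemma coeff_act_isUq : isUq q (fun a => coeff_act (qE q a)) (fun a => coeff_act (qF q a))
  (fun a => coeff_act (qK q a)) (fun a => coeff_act (qKV q a)).
Proof.
apply: (isUq_image (g := coeff_act)).
- by move=> x y; apply: lendP => f; apply/funext => S; exact (scalerDl (f S : N) x y).
- by move=> x; apply: lendP => f; apply/funext => S; exact (scaleNr x (f S : N)).
- by move=> x y; apply: lendP => f; apply/funext => S; exact (esym (scalerA x y (f S : N))).
- by move=> c x; apply: lendP => f; apply/funext => S; exact (scale_algE c x (f S : N)).
- by apply: lendP => f; apply/funext => S; exact (scale1r (f S : N)).
- by apply: lendP => f; apply/funext => S; exact (scale0r (f S : N)).
- move=> x y h; congr coeff_act; move: h; move: x y; apply/isUqP; exact: isUq_Uq.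
Qed.

Let pH := fock_isUq q0 h0 n fock_nz.

Lemma fE_coeff_act p u f : fE p (coeff_act u f) = coeff_act u (fE p f).
Proof.
apply/funext => S; rewrite coeff_actE /fE coeff_actE; case: ifP => // _.
exact (esym (scaler0 _ u)).
Qed.
Lemma fF_coeff_act p u f : fF p (coeff_act u f) = coeff_act u (fF p f).
Proof.
apply/funext => S; rewrite coeff_actE /fF coeff_actE; case: ifP => // _.
exact (esym (scaler0 _ u)).
Qed.
Lemma fK_coeff_act p u f : fK q p (coeff_act u f) = coeff_act u (fK q p f).
Proof.
apply/funext => S; rewrite coeff_actE /fK.
by have := lendZ (coeff_act u) (q ^ charge p S) f => /(congr1 (fun g : fock => g S)) /esym.
Qed.
Lemma fKV_coeff_act p u f : fKV q p (coeff_act u f) = coeff_act u (fKV q p f).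
Proof.
apply/funext => S; rewrite coeff_actE /fKV.
by have := lendZ (coeff_act u) (q ^ (- charge p S)) f => /(congr1 (fun g : fock => g S)) /esym.
Qed.

Let comm_E (u : root -> Uq) : all_comm (fun a => coeff_act (u a)) (aE fock_nz).
Proof. by move=> a b; apply: lendP => f; exact: fE_coeff_act. Qed.
Let comm_F (u : root -> Uq) : all_comm (fun a => coeff_act (u a)) (aF fock_nz).
Proof. by move=> a b; apply: lendP => f; exact: fF_coeff_act. Qed.
Let comm_K (u : root -> Uq) : all_comm (fun a => coeff_act (u a)) (aK q fock_nz).
Proof. by move=> a b; apply: lendP => f; exact: fK_coeff_act. Qed.
Let comm_KV (u : root -> Uq) : all_comm (fun a => coeff_act (u a)) (aKV q fock_nz).
Proof. by move=> a b; apply: lendP => f; exact: fKV_coeff_act. Qed.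

Lemma tensor_isUq : isUq q
  (fun a : root => coeff_act (qE q a) + coeff_act (qK q a) * aE fock_nz a)
  (fun a : root => coeff_act (qF q a) * aKV q fock_nz a + aF fock_nz a)
  (fun a : root => coeff_act (qK q a) * aK q fock_nz a)
  (fun a : root => coeff_act (qKV q a) * aKV q fock_nz a).
Proof.
exact (isUq_coproduct q0 coeff_act_isUq pH
  (@comm_E _) (@comm_F _) (@comm_K _) (@comm_KV _)
  (@comm_E _) (@comm_F _) (@comm_K _) (@comm_KV _)
  (@comm_E _) (@comm_F _) (@comm_K _) (@comm_KV _)
  (@comm_K _)).
Qed.

Lemma coeff_act_occ u S y : coeff_act u (occ S y) = occ S (u *: (y : N) : Y).
Proof.
apply/funext => S'; rewrite coeff_actE /occ; case: asboolP => // _.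
exact (scaler0 _ u).
Qed.
Lemma occD S y y' : occ S (y + y') = occ S y + occ S y'.
Proof.
apply/funext => S'; rewrite fockDE /occ; case: asboolP => // _.
by rewrite addr0.
Qed.
Lemma occZ S c y : occ S (c *: y) = c *: occ S y.
Proof.
apply/funext => S'; rewrite fockZE /occ; case: asboolP => // _.
by rewrite scaler0.
Qed.
Lemma occ_sw p S S' y : occ S y (sw p S') = occ (sw p S) y S'.
Proof.
rewrite /occ; have -> // : `[< sw p S' = S >] = `[< S' = sw p S >].
by apply/asboolP/asboolP => [<-|->]; rewrite swK.
Qed.
Lemma occB S y y' : occ S (y - y') = occ S y - occ S y'.
Proof. by rewrite occD -(scaleN1r y') occZ scaleN1r. Qed.
Lemma fE_occ p S y :
  fE p (occ S y) = if ~~ S p && S p.+1 then occ (sw p S) y else 0.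
Proof.
apply/funext => S'; rewrite /fE occ_sw; case: (EM (S' = sw p S)) => [->|ne].
  by rewrite swl swr andbC; case: ifP.
by rewrite occN // if_same; case: ifP => // _; rewrite occN.
Qed.
Lemma fF_occ p S y :
  fF p (occ S y) = if S p && ~~ S p.+1 then occ (sw p S) y else 0.
Proof.
apply/funext => S'; rewrite /fF occ_sw; case: (EM (S' = sw p S)) => [->|ne].
  by rewrite swl swr andbC; case: ifP.
by rewrite occN // if_same; case: ifP => // _; rewrite occN.
Qed.
Lemma fK_occ p S y : fK q p (occ S y) = q ^ charge p S *: occ S y.
Proof.
apply/funext => S'; rewrite fockZE /fK /occ; case: asboolP => [->//|_].
by rewrite !scaler0.
Qed.
Lemma fKV_occ p S y : fKV q p (occ S y) = q ^ (- charge p S) *: occ S y.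
Proof.
apply/funext => S'; rewrite fockZE /fKV /occ; case: asboolP => [->//|_].
by rewrite !scaler0.
Qed.

Definition tensor_act (u : Uq) : A := Uq_ev
  (fun a : root => coeff_act (qE q a) + coeff_act (qK q a) * aE fock_nz a)
  (fun a : root => coeff_act (qF q a) * aKV q fock_nz a + aF fock_nz a)
  (fun a : root => coeff_act (qK q a) * aK q fock_nz a)
  (fun a : root => coeff_act (qKV q a) * aKV q fock_nz a) u.

Lemma tensor_actM u v f : tensor_act (u * v) f = tensor_act u (tensor_act v f).
Proof. by rewrite /tensor_act (Uq_evM tensor_isUq). Qed.
Lemma tensor_actB u v f : tensor_act (u - v) f = tensor_act u f - tensor_act v f.
Proof. by rewrite /tensor_act (Uq_evD tensor_isUq) -(scaleN1r v) (Uq_evZ tensor_isUq) scaleN1r. Qed.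
Lemma tensor_actZ c u f : tensor_act (c *: u) f = c *: tensor_act u f.
Proof. by rewrite /tensor_act (Uq_evZ tensor_isUq). Qed.

Lemma tensor_act_qcomm u v c f : tensor_act (u * v - c *: (v * u)) f = tensor_act u (tensor_act v f) - c *: tensor_act v (tensor_act u f).
Proof.
exact (etrans (tensor_actB (u * v) (c *: (v * u)) f) (f_equal2 (fun a b => a - b) (tensor_actM u v f)
  (etrans (tensor_actZ c (v * u) f) (f_equal (fun a => c *: a) (tensor_actM v u f))))).
Qed.

Lemma tensor_actE a S y : tensor_act (qE q a) (occ S y) = occ S (qE q a *: (y : N) : Y) +
  (if ~~ S (dynkin_pos a) && S (dynkin_pos a).+1
   then occ (sw (dynkin_pos a) S) (qK q a *: (y : N) : Y) else 0).
Proof.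
have [h _ _ _] := Uq_ev_gens tensor_isUq a; rewrite /tensor_act h.
have -> : (coeff_act (qE q a) + coeff_act (qK q a) * aE fock_nz a) (occ S y) =
  coeff_act (qE q a) (occ S y) + coeff_act (qK q a) (fE (dynkin_pos a) (occ S y)) by [].
rewrite fE_occ !coeff_act_occ; case: ifP => _; rewrite ?coeff_act_occ //.
by rewrite lend0.
Qed.
Lemma tensor_actF a S y : tensor_act (qF q a) (occ S y) =
  q ^ (- charge (dynkin_pos a) S) *: occ S (qF q a *: (y : N) : Y) +
  (if S (dynkin_pos a) && ~~ S (dynkin_pos a).+1
   then occ (sw (dynkin_pos a) S) y else 0).
Proof.
have [_ h _ _] := Uq_ev_gens tensor_isUq a; rewrite /tensor_act h.
have -> : (coeff_act (qF q a) * aKV q fock_nz a + aF fock_nz a) (occ S y) =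
  coeff_act (qF q a) (fKV q (dynkin_pos a) (occ S y)) + fF (dynkin_pos a) (occ S y) by [].
by rewrite fKV_occ fF_occ lendZ coeff_act_occ.
Qed.
Lemma tensor_actK a S y : tensor_act (qK q a) (occ S y) =
  q ^ charge (dynkin_pos a) S *: occ S (qK q a *: (y : N) : Y).
Proof.
have [_ _ h _] := Uq_ev_gens tensor_isUq a; rewrite /tensor_act h.
have -> : (coeff_act (qK q a) * aK q fock_nz a) (occ S y) =
  coeff_act (qK q a) (fK q (dynkin_pos a) (occ S y)) by [].
by rewrite fK_occ lendZ coeff_act_occ.
Qed.

(** Occupation is constant along each of the two arms, so the E's and F's of k act on this state by
    0. Across beta, between the sites n - 1 and n, the charge is 1. *)
Definition vac : nat -> bool := fun x => (x < n)%N.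
Definition hole (i j : nat) : nat -> bool :=
  fun x => ((x < n)%N && (x != n.-1 - i)%N) || (x == n + j)%N.

Lemma vac_compact (a : root) : compact_root a ->
  vac (dynkin_pos a) = vac (dynkin_pos a).+1.
Proof.
by case: a => //= i _; rewrite /vac; have := ltn_ord i => hi;
  [transitivity true|transitivity false]; lia.
Qed.

(** Each step of the recursion for W moves the hole or the displaced particle by one site and
    multiplies the coefficient by -q. *)
Lemma tensor_act_step g c (a : root) S : compact_root a -> charge (dynkin_pos a) S = 1 ->
  (forall y, tensor_act g (occ vac y) = q^-1 *: occ vac (g *: (y : N) : Y) + c *: occ S y) ->
  forall y, tensor_act (g * qF q a - q *: (qF q a * g)) (occ vac y) =
    q^-1 *: occ vac ((g * qF q a - q *: (qF q a * g)) *: (y : N) : Y)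
    + (- q * c) *: occ (sw (dynkin_pos a) S) y.
Proof.
move=> ha S1 hg y; have hv := vac_compact ha.
have ch : charge (dynkin_pos a) vac = 0 by rewrite /charge hv subrr.
have S1' : S (dynkin_pos a) && ~~ S (dynkin_pos a).+1.
  by move: S1; rewrite /charge; case: (S _); case: (S _).
have FV z : tensor_act (qF q a) (occ vac z) = occ vac (qF q a *: (z : N) : Y).
  by rewrite tensor_actF ch oppr0 expr0z scale1r hv andbN addr0.
have FS z : tensor_act (qF q a) (occ S z) =
    q^-1 *: occ S (qF q a *: (z : N) : Y) + occ (sw (dynkin_pos a) S) z.
  by rewrite tensor_actF S1 S1' exprN1.
rewrite tensor_act_qcomm.
have -> : ((g * qF q a - q *: (qF q a * g)) *: (y : N) : Y) =
  (g *: (qF q a *: (y : N)) : Y) - q *: (qF q a *: (g *: (y : N)) : Y).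
  exact: scale_qcomm.
exact (step_rule (g := fun y : Y => g *: (y : N) : Y) (f := fun y : Y => qF q a *: (y : N) : Y)
  q0 FV hg FS (@occB vac) (@occZ vac) y).
Qed.

Lemma sw_hole_mu (i : 'I_n.-1) : sw (dynkin_pos (mu i)) (hole i 0) = hole i.+1 0.
Proof.
have hi := ltn_ord i; apply/funext => x; rewrite /sw /hole /=.
by case: eqP => [->|h1]; [|case: eqP => [->|h2]]; apply/idP/idP; lia.
Qed.
Lemma sw_hole_nu i (j : 'I_n.-1) : (i < n)%N ->
  sw (dynkin_pos (nu j)) (hole i j) = hole i j.+1.
Proof.
move=> hi; have hj := ltn_ord j; apply/funext => x; rewrite /sw /hole /=.
by case: eqP => [->|h1]; [|case: eqP => [->|h2]]; apply/idP/idP; lia.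
Qed.

Lemma charge_hole_mu (i : 'I_n.-1) : charge (dynkin_pos (mu i)) (hole i 0) = 1.
Proof.
have hi := ltn_ord i; rewrite /charge /=.
have -> : hole i 0 (n.-2 - i) = true by rewrite /hole; lia.
by have -> : hole i 0 (n.-2 - i).+1 = false by rewrite /hole; lia.
Qed.
Lemma charge_hole_nu i (j : 'I_n.-1) : (i < n)%N ->
  charge (dynkin_pos (nu j)) (hole i j) = 1.
Proof.
move=> hi; have hj := ltn_ord j; rewrite /charge /=.
have -> : hole i j (n + j) = true by rewrite /hole; lia.
by have -> : hole i j (n + j).+1 = false by rewrite /hole; lia.
Qed.

(* [hole i j] moves the particle at the site n - 1 - i to the site n + j. These
   states are distinct, so W_ij separates the components of degree one. *)
Lemma tensor_act_W i j y : (i < n)%N -> (j < n)%N -> tensor_act (W q n i j) (occ vac y) =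
  q^-1 *: occ vac (W q n i j *: (y : N) : Y) + (- q) ^+ (i + j) *: occ (hole i j) y.
Proof.
have W0E k z : (k < n)%N -> tensor_act (W0 q n k) (occ vac z) =
    q^-1 *: occ vac (W0 q n k *: (z : N) : Y) + (- q) ^+ k *: occ (hole k 0) z.
  elim: k z => [|k IH] z hk.
    have hv : vac n.-1 && ~~ vac n.-1.+1 by rewrite /vac; lia.
    have ch : charge n.-1 vac = 1.
      by case/andP: hv; rewrite /charge => -> /negPf ->.
    rewrite /= tensor_actF /= ch exprN1 hv expr0 scale1r; congr (_ + occ _ _).
    by apply/funext => x; rewrite /sw /hole /vac; case: eqP => [->|h1];
      [|case: eqP => [->|h2]]; apply/idP/idP; lia.
  have hk' : (k < n.-1)%N by lia.
  rewrite /= /mu_ext insubT /= (tensor_act_step (a := mu (Ordinal hk')) (c := (- q) ^+ k)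
    (S := hole k 0)) //.
  - by rewrite sw_hole_mu -exprS.
  - exact: (@charge_hole_mu (Ordinal hk')).
  - by move=> u; apply: IH; lia.
move=> hi; elim: j y => [|j IH] y hj; first by rewrite addn0; exact: W0E.
have hj' : (j < n.-1)%N by lia.
rewrite /= /nu_ext insubT /= (tensor_act_step (a := nu (Ordinal hj')) (c := (- q) ^+ (i + j))
  (S := hole i j)) //.
- by rewrite (sw_hole_nu (Ordinal hj') hi) -exprS addnS.
- exact: (@charge_hole_nu i (Ordinal hj')).
- by move=> u; apply: IH; lia.
Qed.

Lemma hole_inj i j k l : (i < n)%N -> (j < n)%N -> (k < n)%N -> (l < n)%N ->
  hole i j = hole k l -> i = k /\ j = l.
Proof.
move=> hi hj hk hl E; have E1 := congr1 (fun f => f (n.-1 - i)%N) E.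
have E2 := congr1 (fun f => f (n + j)%N) E; move: E1 E2; rewrite /hole; split; lia.
Qed.
Lemma hole_vac i j : (i < n)%N -> (j < n)%N -> hole i j <> vac.
Proof. by move=> hi hj /(congr1 (fun f => f (n + j)%N)); rewrite /hole /vac; lia. Qed.

Section Injectivity.
Context (V : vectType F) (rho rho' : Uq -> 'End(V)).
Local Notation UkAplus := (@UkAplus F q n).
Hypothesis rep : is_rep UkAplus rho.
Hypothesis rep' : is_rep UkAplus rho'.
Hypothesis rhoZ : forall i j : 'I_n, rho (Z q n i j) = 0.
Hypothesis rhoE : forall a, compact_root a -> rho (qE q a) = rho' (qE q a).
Hypothesis rhoF : forall a, compact_root a -> rho (qF q a) = rho' (qF q a).
Hypothesis rhoK : forall a, compact_root a -> rho (qK q a) = rho' (qK q a).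
Hypothesis rhoKbeta : rho (qK q beta) = q *: rho' (qK q beta).
Context (gen : V -> N).
Hypothesis genD : {morph gen : u w / u + w}.
Hypothesis genS : forall x u, UkAplus x -> gen (rho' x u) = x *: gen u.
Hypothesis genE : forall u, qE q beta *: gen u = 0.
Hypothesis gen_inj : forall u, gen u = 0 -> u = 0.
Hypothesis n0 : (0 < n)%N.

(** The map u |-> gen u (x) vac lifts to M(V) for [rho]: the state multiplies K_beta by q, and
    [rhoKbeta] allows for that. The component of the image of the sum at [hole k l] is (-q)^(k + l)
    gen (x k l). *)
Lemma degree1_indep (x : 'I_n -> 'I_n -> V) :
  \sum_(i < n) \sum_(j < n) W q n i j *: verma_gen rho (x i j) = 0 -> forall i j, x i j = 0.
Proof.
have genZ c u : gen (c *: u) = c *: (gen u : Y) :> Y.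
  by rewrite -(repA rep') genS //; exact: subalg_scalar.
pose f u : umod tensor_isUq := occ vac (gen u : Y).
have [||||||g [gl gE]] := verma_lift rep rhoZ (phi := f).
- by move=> u w; rewrite /f genD; exact: occD.
- by move=> c u; rewrite umod_scalar /f genZ; exact: occZ.
- move=> a ha u; rewrite rhoE // /f genS; last exact/UkAplus_Uk/Uk_qE.
  apply/esym; rewrite -[LHS]/(tensor_act (qE q a) (occ vac (gen u : Y))) tensor_actE.
  by rewrite (vac_compact ha) andNb addr0.
- move=> a ha u; rewrite rhoF // /f genS; last exact/UkAplus_Uk/Uk_qF.
  apply/esym; rewrite -[LHS]/(tensor_act (qF q a) (occ vac (gen u : Y))) tensor_actF.
  by rewrite /charge (vac_compact ha) andbN addr0 subrr oppr0 expr0z scale1r.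
- move=> a u; apply/esym; rewrite -[LHS]/(tensor_act (qK q a) (occ vac (gen u : Y))) tensor_actK /f.
  case ha: (compact_root a).
    by rewrite rhoK // genS ?/charge ?(vac_compact ha) ?subrr ?expr0z ?scale1r //; exact/UkAplus_Uk/Uk_qK.
  have -> : a = beta by case: a ha.
  have -> : charge (dynkin_pos (@beta n)) vac = 1.
    rewrite /charge /vac /=; have -> : (n.-1 < n)%N = true by lia.
    by have -> : (n.-1.+1 < n)%N = false by lia.
  rewrite rhoKbeta scale_lfunE genZ genS ?occZ ?expr1z //.
  exact/UkAplus_Uk/Uk_qK.
- move=> u; rewrite -[LHS]/(tensor_act (qE q beta) (occ vac (gen u : Y))) tensor_actE genE.
  have -> : vac (dynkin_pos (@beta n)) by rewrite /vac /=; lia.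
  by rewrite andFb addr0; apply/funext => S; rewrite /occ if_same.
move=> h; have g0 : g 0 = 0.
  by have := gl (-1) 0 0; rewrite scaler0 addr0 scaleN1r addNr.
have gD a b : g (a + b) = g a + g b.
  by have := gl 1 a b; rewrite !scale1r.
have gZ c a : g (c *: a) = c *: g a by have := gl c a 0; rewrite g0 !addr0.
have gsum (I : finType) (G : I -> verma rho) : g (\sum_i G i) = \sum_i g (G i).
  exact: (big_morph g gD g0).
have E : \sum_(i < n) \sum_(j < n) (tensor_act (W q n i j) (occ vac (gen (x i j) : Y)) : fock) = 0.
  rewrite -[RHS]g0 -h gsum; apply: eq_bigr => i _; rewrite gsum; apply: eq_bigr => j _.
  by rewrite gZ gE.
move=> k l; apply: gen_inj.
have fsum (I : finType) (G : I -> fock) S : (\sum_i G i) S = \sum_i G i S.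
  by rewrite (big_morph (fun G : fock => G S) (id1 := 0) (op1 := +%R)).
have := congr1 (fun G : fock => G (hole k l)) E.
rewrite fsum (bigD1 k) //= fsum (bigD1 l) //= tensor_act_W // fockDE !fockZE occE.
rewrite occN; last exact: hole_vac.
rewrite scaler0 add0r big1 => [|j jl]; last first.
  rewrite tensor_act_W // fockDE !fockZE !occN ?scaler0 ?addr0 //; last exact: hole_vac.
  by move=> /hole_inj [] // _ /val_inj e; rewrite e eqxx in jl.
rewrite big1 => [|i ik]; last first.
  rewrite fsum big1 // => j _.
  rewrite tensor_act_W // fockDE !fockZE !occN ?scaler0 ?addr0 //; last exact: hole_vac.
  by move=> /hole_inj [] // /val_inj e; rewrite e eqxx in ik.
rewrite !addr0 => /eqP; rewrite scaler_eq0 expf_eq0 oppr_eq0 (negPf q0) andbF.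
by move/eqP.
Qed.

End Injectivity.

End TensorFock.

(** * The elements W_ij *)

Section Chains.
Context (F : fieldType) (q : F) (q0 : q != 0) (A : algType F).

(** Iterated skew commutators from an arbitrary start: the common form of W_ij and of the elements
    G_ij. *)
Fixpoint chain (fs : nat -> A) (g : A) (i : nat) : A :=
  if i is j.+1 then chain fs g j * fs j - q *: (fs j * chain fs g j) else g.

Lemma chainS fs g i : chain fs g i.+1 = chain fs g i * fs i - q *: (fs i * chain fs g i).
Proof. by []. Qed.

Lemma eq_chain fs fs' g i : (forall j, (j < i)%N -> fs j = fs' j) ->
  chain fs g i = chain fs' g i.
Proof.
elim: i => [//|i IH] h; rewrite !chainS IH ?h // => j hj.
by apply: h; rewrite ltnS ltnW.
Qed.

Lemma chain_shift fs g i j : chain fs g (i + j) =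
  chain (fun l => fs (i + l)%N) (chain fs g i) j.
Proof. by elim: j => [|j IH]; rewrite ?addn0 // addnS !chainS IH. Qed.

Lemma chainD fs g g' i : chain fs (g + g') i = chain fs g i + chain fs g' i.
Proof.
elim: i => [//|i IH]; rewrite !chainS IH mulrDl mulrDr.
by module_eq F A; ring.
Qed.
Lemma chainZ fs c g i : chain fs (c *: g) i = c *: chain fs g i.
Proof.
elim: i => [//|i IH]; rewrite !chainS IH -scalerAl -scalerAr.
by module_eq F A; ring.
Qed.
Lemma chain0 fs i : chain fs 0 i = 0.
Proof. by have := chainZ fs 0 0 i; rewrite !scale0r. Qed.
Lemma chainB fs g g' i : chain fs (g - g') i = chain fs g i - chain fs g' i.
Proof. by rewrite chainD -(scaleN1r g') chainZ scaleN1r. Qed.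

Lemma chain_scomm fs g i x c (d : nat -> F) : x * g = c *: (g * x) ->
  (forall j, (j < i)%N -> x * fs j = d j *: (fs j * x)) ->
  x * chain fs g i = (c * \prod_(j < i) d j) *: (chain fs g i * x).
Proof.
move=> hg; elim: i => [|i IH] hf; first by rewrite big_ord0 mulr1.
have {}IH := IH (fun j hj => hf j (ltnW hj)).
have hi := hf i (ltnSn i).
rewrite big_ord_recr /= mulrBr mulrBl -scalerAr -scalerAl !mulrA IH hi.
rewrite -!scalerAl -!mulrA hi IH -!scalerAr.
by module_eq F A; ring.
Qed.

Lemma chain_comm fs g i x : x * g = g * x ->
  (forall j, (j < i)%N -> x * fs j = fs j * x) -> x * chain fs g i = chain fs g i * x.
Proof.
move=> hg hf; rewrite (@chain_scomm fs g i x 1 (fun _ => 1)) ?scale1r //.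
- by rewrite big1 ?mulr1 ?scale1r.
- by move=> j hj; rewrite scale1r hf.
Qed.

(** The bracket with x is a derivation that kills every [fs j], so it acts on the start alone. *)
Lemma chain_bracket fs g i x : (forall j, x * fs j = fs j * x) ->
  x * chain fs g i - chain fs g i * x = chain fs (x * g - g * x) i.
Proof.
move=> hf; elim: i => [//|i IH]; rewrite !chainS -IH.
rewrite !(mulrBl, mulrBr) -?scalerAl -?scalerAr !mulrA (hf i) -!mulrA (hf i) !mulrA.
by module_eq F A; ring.
Qed.

Lemma chain_swap fs fs' g i j : (forall k l, fs k * fs' l = fs' l * fs k) ->
  chain fs' (chain fs g i) j = chain fs (chain fs' g j) i.
Proof.
move=> h; elim: j i => [//|j IHj] i; rewrite chainS IHj.
elim: i => [|i IHi]; first by rewrite chainS.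
rewrite [LHS]/= [RHS]chainS -IHi /=.
exact: qcomm_swapr (h i j).
Qed.

End Chains.

(** * Root vectors along an arm and their commutation with E, F and K *)

Section SerreCommutation.
Context (F : fieldType) (q : F) (q0 : q != 0) (A : algType F).

Lemma serreP (x y : A) : serre q x y = 0 ->
  x * x * y = (q + q^-1) *: (x * y * x) - y * x * x.
Proof. by move/eqP; rewrite /serre addr_eq0 subr_eq addrC => /eqP. Qed.

(** As y commutes with c, multiplying g by c on either side multiplies the Serre element by c on
    that side. *)
Lemma serre_qcomm (y c g : A) : y * c = c * y -> serre q y g = 0 ->
  serre q y (c * g - q *: (g * c)) = 0.
Proof.
move=> yc /serreP h.
have ycA x : x * y * c = x * c * y by rewrite -mulrA yc mulrA.
have hA x : x * y * y * g = (q + q^-1) *: (x * y * g * y) - x * g * y * y.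
  by rewrite -!mulrA (mulrA y y g) h mulrBr -scalerAr !mulrA.
rewrite /serre !(mulrBl, mulrBr) -?scalerAl -?scalerAr !mulrA.
rewrite ?(ycA, yc) ?mulrA h ?(ycA, yc) ?mulrA ?hA mulrBl -?scalerAl ?(ycA, yc) ?mulrA.
by module_eq F A; field.
Qed.

Lemma serre_skew (x a : A) : serre q x a = 0 ->
  x * (a * x - q *: (x * a)) = q *: ((a * x - q *: (x * a)) * x).
Proof.
move/serreP => h; rewrite !(mulrBl, mulrBr) -?scalerAl -?scalerAr !mulrA h.
by module_eq F A; field.
Qed.

Hypothesis q2 : q + q^-1 != 0.

(** On a string a - x - y of the diagram this is the root vector of a + x + y, a root orthogonal to
    x. The relation comes from x x a y = x x y a, expanded by the two Serre relations and divided by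
    q + q^-1. *)
Lemma serre_double (x a y : A) : a * y = y * a -> serre q x a = 0 -> serre q x y = 0 ->
  x * ((a * x - q *: (x * a)) * y - q *: (y * (a * x - q *: (x * a)))) =
  ((a * x - q *: (x * a)) * y - q *: (y * (a * x - q *: (x * a)))) * x.
Proof.
move=> ay /serreP sa /serreP sy.
have yaA z : z * y * a = z * a * y by rewrite -mulrA -ay mulrA.
have e1 : x * x * a * y = x * x * y * a by rewrite yaA.
have syA z : z * x * x * y = (q + q^-1) *: (z * x * y * x) - z * y * x * x.
  by rewrite -!mulrA (mulrA x x y) sy mulrBr -scalerAr !mulrA.
have saA z : z * x * x * a = (q + q^-1) *: (z * x * a * x) - z * a * x * x.
  by rewrite -!mulrA (mulrA x x a) sa mulrBr -scalerAr !mulrA.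
have key : x * a * x * y = x * y * x * a + a * x * y * x - y * x * a * x.
  apply: (scalerI q2).
  have : x * x * a * y = x * x * y * a by [].
  rewrite sa sy !mulrBl -!scalerAl syA saA ay => /eqP.
  rewrite -subr_eq0 => /eqP E; apply/eqP; rewrite -subr_eq0; apply/eqP.
  by rewrite -[RHS]E; module_eq F A; field.
rewrite !(mulrBl, mulrBr) -?scalerAl -?scalerAr !mulrA.
rewrite !(mulrBl, mulrBr) -?scalerAl -?scalerAr ?mulrA.
rewrite sa !mulrBl -?scalerAl syA yaA -ay key.
by module_eq F A; field.
Qed.

End SerreCommutation.

Section Arm.
Context (F : fieldType) (q : F) (q0 : q != 0) (h0 : q - q^-1 != 0) (A : algType F).
Context (n : nat).
Local Notation root := (simple_root n).
Context (e f k kv : root -> A) (H : isUq q e f k kv).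
Context (m : nat) (arm : nat -> root).
Hypothesis arm_pairing : forall i j, (i < m)%N -> (j < m)%N ->
  pairing (arm i) (arm j) = if i == j then 2 else if (i.+1 == j) || (j.+1 == i) then -1 else 0.

(** Extended by 0 past the end of the arm, as [mu_ext] is; chains that are too long then vanish. *)
Definition arm_ext (u : root -> A) (i : nat) : A := if (i < m)%N then u (arm i) else 0.
Local Notation chain := (chain q).

Definition arm_chain (r : nat) (g : A) (i : nat) : A := chain (fun j => arm_ext f (r + j)) g i.

Lemma arm_chainS r g i : arm_chain r g i.+1 = arm_chain r g i * arm_ext f (r + i) - q *: (arm_ext f (r + i) * arm_chain r g i).
Proof. by []. Qed.

Lemma arm_ext_out u i : (m <= i)%N -> arm_ext u i = 0.
Proof. by rewrite /arm_ext ltnNge => ->. Qed.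
Lemma arm_ext_in u i : (i < m)%N -> arm_ext u i = u (arm i).
Proof. by rewrite /arm_ext => ->. Qed.

Lemma arm_neq i j : (i < m)%N -> (j < m)%N -> i != j -> arm i <> arm j.
Proof.
move=> hi hj ij E; have := arm_pairing hi hj; rewrite E pairing_id (negPf ij).
by case: ifP.
Qed.

Lemma E_ext i j : (i < m)%N -> i != j -> e (arm i) * arm_ext f j = arm_ext f j * e (arm i).
Proof.
move=> hi ij; case: (ltnP j m) => hj; last by rewrite arm_ext_out // mulr0 mul0r.
by rewrite arm_ext_in // (preUq_EFC H) //; exact: arm_neq.
Qed.
Lemma EF_ext i : (i < m)%N -> e (arm i) * arm_ext f i =
  arm_ext f i * e (arm i) + (q - q^-1)^-1 *: (k (arm i) - kv (arm i)).
Proof. by move=> hi; rewrite arm_ext_in // -(preUq_EF H) addrC subrK. Qed.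

Lemma K_ext i j : (i < m)%N -> k (arm i) * arm_ext f j =
  (if i == j then q ^- 2 else if (i.+1 == j) || (j.+1 == i) then q else 1)
    *: (arm_ext f j * k (arm i)).
Proof.
move=> hi; case: (ltnP j m) => hj; last by rewrite arm_ext_out // mulr0 mul0r scaler0.
rewrite arm_ext_in // (preUq_KF H) arm_pairing //.
by case: eqP => // _; case: ifP => _ //; rewrite oppr0 expr0z.
Qed.
Lemma KV_ext i j : (i < m)%N -> kv (arm i) * arm_ext f j =
  (if i == j then q ^+ 2 else if (i.+1 == j) || (j.+1 == i) then q^-1 else 1)
    *: (arm_ext f j * kv (arm i)).
Proof.
move=> hi; case: (ltnP j m) => hj; last by rewrite arm_ext_out // mulr0 mul0r scaler0.
rewrite arm_ext_in // (preUq_KVF q0 H) arm_pairing //.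
by case: eqP => // _; case: ifP.
Qed.
Lemma F_ext i j : i != j -> i.+1 != j -> j.+1 != i -> arm_ext f i * arm_ext f j = arm_ext f j * arm_ext f i.
Proof.
move=> ij h1 h2; case: (ltnP i m) => hi; last by rewrite (arm_ext_out _ hi) mulr0 mul0r.
case: (ltnP j m) => hj; last by rewrite (arm_ext_out _ hj) mulr0 mul0r.
rewrite !arm_ext_in //; apply: (isUq_FF H).
by rewrite arm_pairing // (negPf ij) (negPf h1) (negPf h2).
Qed.

Lemma E_arm_chain_lt r g i x c : (x < m)%N -> (x < r)%N ->
  e (arm x) * g = c *: (g * e (arm x)) ->
  e (arm x) * arm_chain r g i = c *: (arm_chain r g i * e (arm x)).
Proof.
move=> hx xr hg; rewrite (@chain_scomm _ _ _ _ _ _ _ c (fun _ => 1)) //.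
- by rewrite big1 ?mulr1.
- by move=> j _; rewrite scale1r E_ext //; lia.
Qed.

(** The bracket of e_r with the first F of the chain gives a K-term and a K^-1-term. The next F
    skew-commutes with K, so the K-term occurs only for length one, while the K^-1-term becomes the
    start of a chain from r + 1. Two cases are used: al = 1, ka = q removes the K^-1-term (for W);
    al = q^-1, ka = 1 makes both scalar factors -1 (for G). *)
Lemma E_arm_chain_eq r g i al ka : (r < m)%N -> ka != 0 ->
  e (arm r) * g = al *: (g * e (arm r)) ->
  k (arm r) * g = ka *: (g * k (arm r)) ->
  kv (arm r) * g = ka^-1 *: (g * kv (arm r)) ->
  (forall j, (r < j)%N -> g * arm_ext f j = arm_ext f j * g) ->
  e (arm r) * arm_chain r g i.+1 = al *: (arm_chain r g i.+1 * e (arm r)) +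
    ((if i == 0%N then ((q - q^-1)^-1 * (al - q * ka)) *: (g * k (arm r)) else 0)
    - ((q - q^-1)^-1 * (al - q / ka)) *: arm_chain r.+1 (g * kv (arm r)) i).
Proof.
move=> hr ka0 eg kg kvg gf; set hh := (q - q^-1)^-1.
have fr := EF_ext hr; rewrite -/hh in fr.
have base : e (arm r) * arm_chain r g 1 = al *: (arm_chain r g 1 * e (arm r)) +
   ((hh * (al - q * ka)) *: (g * k (arm r)) - (hh * (al - q / ka)) *: (g * kv (arm r))).
  have frA x : x * e (arm r) * arm_ext f r =
      x * arm_ext f r * e (arm r) + hh *: (x * k (arm r) - x * kv (arm r)).
    by rewrite -mulrA fr mulrDr mulrA -scalerAr mulrBr.
  have egA x : x * e (arm r) * g = al *: (x * g * e (arm r)).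
    by rewrite -mulrA eg -scalerAr mulrA.
  rewrite arm_chainS /= addn0 !(mulrBl, mulrBr) -?scalerAl -?scalerAr !mulrA eg fr.
  rewrite -?scalerAl frA !(mulrDl, mulrDr) -?scalerAl !(mulrBl, mulrBr) egA kg kvg.
  by module_eq F A; field.
elim: i => [|i IH]; first by rewrite base.
rewrite arm_chainS; set c := arm_chain r g i.+1 in IH *; set c' := arm_chain r.+1 (g * kv (arm r)).
clearbody c.
have ef : e (arm r) * arm_ext f (r + i.+1) = arm_ext f (r + i.+1) * e (arm r).
  by rewrite E_ext //; lia.
have -> : e (arm r) * (c * arm_ext f (r + i.+1) - q *: (arm_ext f (r + i.+1) * c)) =
    (e (arm r) * c) * arm_ext f (r + i.+1) - q *: (arm_ext f (r + i.+1) * (e (arm r) * c)).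
  by rewrite mulrBr -scalerAr !mulrA ef.
rewrite IH -/c'; have -> : c' i.+1 = c' i * arm_ext f (r + i.+1) - q *: (arm_ext f (r + i.+1) * c' i).
  by rewrite /c' arm_chainS addSnnS.
(* The skew commutator of K_r with F_(r+1) vanishes, which ends the K-term after one step. *)
have zero : i = 0%N -> g * k (arm r) * arm_ext f (r + i.+1) - q *: (arm_ext f (r + i.+1) * (g * k (arm r))) = 0.
  move=> ->; rewrite -mulrA K_ext //.
  have -> : (r == r + 1)%N = false by lia.
  have -> : (r.+1 == r + 1)%N by lia.
  rewrite /= -scalerAr !mulrA gf ?subrr //; lia.
have efA x : x * e (arm r) * arm_ext f (r + i.+1) = x * arm_ext f (r + i.+1) * e (arm r).
  by rewrite -mulrA ef mulrA.
move: (c' i) => d; rewrite (_ : (i.+1 == 0%N) = false) //.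
case: (eqVneq i 0%N) => [i0|i0].
  rewrite !(mulrDl, mulrDr, mulrBl, mulrBr, mulNr, mulrN) -?scalerAl -?scalerAr.
  have z := zero i0; move: z => /eqP; rewrite subr_eq0 => /eqP ->.
  rewrite !mulrA efA.
  by module_eq F A; ring.
rewrite !(mulrDl, mulrDr, mulrBl, mulrBr, mulNr, mulrN, mul0r, mulr0) -?scalerAl -?scalerAr.
rewrite ?mulrA efA.
by module_eq F A; ring.
Qed.

(** The chain commutes with e_x until it reaches the root x. From there on it is a chain from x
    whose start q-commutes with K_x, the case al = 1, ka = q of [E_arm_chain_eq]. *)
Lemma E_arm_chain_gt r g x : (x < m)%N -> (r < x)%N ->
  e (arm x) * g = g * e (arm x) -> k (arm x) * g = g * k (arm x) ->
  kv (arm x) * g = g * kv (arm x) ->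
  (forall j, (r < j)%N -> g * arm_ext f j = arm_ext f j * g) ->
  forall i, e (arm x) * arm_chain r g i = arm_chain r g i * e (arm x) -
    (if i == (x - r).+1 then q *: (arm_chain r g (x - r) * k (arm x)) else 0).
Proof.
move=> hx rx eg kg kvg gf i.
have low j : (j <= x - r)%N -> e (arm x) * arm_chain r g j = arm_chain r g j * e (arm x).
  move=> hj; apply: chain_comm => // l hl; apply: E_ext => //; lia.
(* Among the factors r, .., x - 1 only the last is adjacent to x; hence a single factor q for K and
   q^-1 for K^-1. *)
have kch y (z : F) : y * g = g * y -> forall d,
    (forall j, y * arm_ext f j = (if x == j then d else if (x.+1 == j) || (j.+1 == x) then z else 1)
      *: (arm_ext f j * y)) -> y * arm_chain r g (x - r) = z *: (arm_chain r g (x - r) * y).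
  move=> yg d yf; rewrite (@chain_scomm _ _ _ _ _ _ _ 1 (fun j =>
    if (j.+1 == x - r)%N then z else 1)) ?scale1r // => [|j hj].
    have -> : (x - r = (x - r).-1.+1)%N by lia.
    rewrite big_ord_recr /= eqxx big1 ?mul1r // => j _.
    by rewrite ifF //; have := ltn_ord j; lia.
  rewrite yf ifF; last lia.
  by have -> : ((x.+1 == (r + j)%N) || ((r + j).+1 == x)) = (j.+1 == x - r)%N by lia.
case: (leqP i (x - r)) => hi.
  by rewrite low // ifF ?subr0 //; lia.
have -> : i = (x - r + (i - (x - r).+1).+1)%N by lia.
set i' := (i - (x - r).+1)%N.
have -> : arm_chain r g (x - r + i'.+1) = arm_chain x (arm_chain r g (x - r)) i'.+1.
  rewrite /arm_chain chain_shift; apply: eq_chain => j _; congr (arm_ext f _); lia.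
rewrite (@E_arm_chain_eq x (arm_chain r g (x - r)) i' 1 q) //.
- rewrite scale1r; congr (_ + _).
  have -> : (1 - q / q) = 0 by rewrite divff ?subrr.
  rewrite mulr0 scale0r subr0.
  have -> : (x - r + i'.+1 == (x - r).+1)%N = (i' == 0)%N by lia.
  case: (i' == 0%N); last by rewrite oppr0.
  rewrite -scaleNr; congr (_ *: _).
  have -> : 1 - q * q = - q * (q - q^-1) by rewrite mulNr mulrBr mulfV // opprB.
  by rewrite mulrCA mulVf // mulr1.
- by rewrite scale1r low.
- exact: (kch (k (arm x)) q kg (q ^- 2) (fun j => K_ext j hx)).
- exact: (kch (kv (arm x)) q^-1 kvg (q ^+ 2) (fun j => KV_ext j hx)).
- move=> j hj; apply/esym; apply: chain_comm; first by rewrite gf //; lia.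
  by move=> l hl; apply: F_ext; lia.
Qed.

Hypothesis q2 : q + q^-1 != 0.

Lemma serre_ext i j : (i.+1 == j) || (j.+1 == i) -> serre q (arm_ext f i) (arm_ext f j) = 0.
Proof.
move=> ij; case: (ltnP i m) => hi; last by rewrite /serre (arm_ext_out _ hi) !(mul0r, mulr0) scaler0 subr0 addr0.
case: (ltnP j m) => hj; last by rewrite /serre (arm_ext_out _ hj) !(mul0r, mulr0) scaler0 subr0 addr0.
rewrite !arm_ext_in //; apply: (isUq_serreF H); rewrite arm_pairing // ij.
by rewrite ifF //; lia.
Qed.

Section Start.
Context (g : A).
Hypothesis gf : forall j, (0 < j)%N -> g * arm_ext f j = arm_ext f j * g.
Hypothesis gs : serre q (arm_ext f 0) g = 0.

Lemma F_arm_chain_far x i : (i < x)%N -> arm_ext f x * arm_chain 0 g i = arm_chain 0 g i * arm_ext f x.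
Proof.
move=> ix; apply: chain_comm; first by rewrite gf //; lia.
by move=> j hj; apply: F_ext; lia.
Qed.

Lemma F_arm_chain_serre x : serre q (arm_ext f x) (arm_chain 0 g x) = 0.
Proof.
case: x => [//|x]; rewrite arm_chainS; apply: serre_qcomm => //; first exact: F_arm_chain_far.
by apply: serre_ext; rewrite eqxx orbT.
Qed.

(** Below x everything commutes; at x this is the definition of the next chain element; at x + 1 it
    is [serre_skew]; from x + 2 on it is [serre_double], as the later factors commute with F_x. *)
Lemma F_arm_chain x i : arm_ext f x * arm_chain 0 g i =
  if i == x then q^-1 *: (arm_chain 0 g x * arm_ext f x - arm_chain 0 g x.+1)
  else if i == x.+1 then q *: (arm_chain 0 g i * arm_ext f x) else arm_chain 0 g i * arm_ext f x.
Proof.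
case: (ltngtP i x) => ix; last first.
- rewrite ix arm_chainS add0n opprB addrC subrK scalerA mulVf ?scale1r //.
- case: (eqVneq i x.+1) => [->|ne]; first exact: serre_skew (F_arm_chain_serre x).
  have -> : i = (x.+2 + (i - x.+2))%N by lia.
  rewrite /arm_chain chain_shift; apply: chain_comm; last by move=> j _; apply: F_ext; lia.
  have cy : arm_chain 0 g x * arm_ext f x.+1 = arm_ext f x.+1 * arm_chain 0 g x by rewrite F_arm_chain_far.
  have sy : serre q (arm_ext f x) (arm_ext f x.+1) = 0 by apply: serre_ext; rewrite eqxx.
  exact (serre_double q0 q2 cy (F_arm_chain_serre x) sy).
- by rewrite F_arm_chain_far // ifF //; lia.
Qed.

Lemma E_arm_chain0 x i : (x < m)%N ->
  (forall y, (y < m)%N -> e (arm y) * g = g * e (arm y)) ->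
  (forall y, (y < m)%N -> k (arm y) * g = (if y == 0%N then q else 1) *: (g * k (arm y))) ->
  (forall y, (y < m)%N -> kv (arm y) * g = (if y == 0%N then q^-1 else 1) *: (g * kv (arm y))) ->
  e (arm x) * arm_chain 0 g i = arm_chain 0 g i * e (arm x) -
    (if i == x.+1 then q *: (arm_chain 0 g x * k (arm x)) else 0).
Proof.
move=> hx eg kg kvg; case: x hx => [|x] hx.
  case: i => [|i]; first by rewrite eg // subr0.
  rewrite (@E_arm_chain_eq 0 g i 1 q) //.
  - rewrite scale1r; congr (_ + _).
    have -> : (1 - q / q) = 0 by rewrite divff ?subrr.
    rewrite mulr0 scale0r subr0 eqSS.
    case: (i == 0%N); last by rewrite oppr0.
    rewrite -scaleNr; congr (_ *: _).
    have -> : 1 - q * q = - q * (q - q^-1) by rewrite mulNr mulrBr mulfV // opprB.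
    by rewrite mulrCA mulVf // mulr1.
  - by rewrite scale1r eg.
  - by rewrite kg.
  - by rewrite kvg.
have kg' := kg _ hx; have kvg' := kvg _ hx; rewrite !scale1r in kg' kvg'.
by rewrite (E_arm_chain_gt hx _ (eg _ hx) kg' kvg' gf) // subn0.
Qed.

End Start.

End Arm.

(** * The two arms and the elements W_ij and G_ij *)

Section TwoArms.
Context (F : fieldType) (q : F) (q0 : q != 0) (h0 : q - q^-1 != 0) (q2 : q + q^-1 != 0).
Context (A : algType F) (n : nat).
Local Notation root := (simple_root n).
Context (e f k kv : root -> A) (H : isUq q e f k kv) (m : nat).

(** The arms mu and nu as seen from beta, in a form symmetric under their exchange: computations are
    done for the first arm and carried over by [arms_sym]. *)
Record arms (a1 a2 : nat -> root) : Prop := Arms {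
  arms1 : forall i j, (i < m)%N -> (j < m)%N -> pairing (a1 i) (a1 j) =
    if i == j then 2 else if (i.+1 == j) || (j.+1 == i) then -1 else 0;
  arms2 : forall i j, (i < m)%N -> (j < m)%N -> pairing (a2 i) (a2 j) =
    if i == j then 2 else if (i.+1 == j) || (j.+1 == i) then -1 else 0;
  arms12 : forall i j, (i < m)%N -> (j < m)%N -> pairing (a1 i) (a2 j) = 0;
  arms1beta : forall i, (i < m)%N -> pairing (a1 i) beta = if i == 0%N then -1 else 0;
  arms2beta : forall i, (i < m)%N -> pairing (a2 i) beta = if i == 0%N then -1 else 0 }.

Lemma arms_sym a1 a2 : arms a1 a2 -> arms a2 a1.
Proof. by case=> h1 h2 h3 h4 h5; split=> // i j hi hj; rewrite pairingC h3. Qed.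

Lemma pairing_neq (a b : root) : pairing a b <> 2 -> a <> b.
Proof. by move=> h E; apply: h; rewrite E pairing_id. Qed.

Lemma pairing0_EF (a b : root) : pairing a b = 0 -> e a * f b = f b * e a.
Proof. by move=> ab; rewrite (preUq_EFC H) //; apply: pairing_neq; rewrite ab. Qed.
Lemma pairing0_KF (a b : root) : pairing a b = 0 -> k a * f b = f b * k a.
Proof. by move=> ab; rewrite (preUq_KF H) ab oppr0 expr0z scale1r. Qed.
Lemma pairing0_KVF (a b : root) : pairing a b = 0 -> kv a * f b = f b * kv a.
Proof. by move=> ab; rewrite (preUq_KVF q0 H) ab expr0z scale1r. Qed.

Section Arms.
Context (a1 a2 : nat -> root) (HA : arms a1 a2).
Let ch1 := arm_chain q f m a1.
Let ch2 := arm_chain q f m a2.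
Let ext1 := @arm_ext F A n m a1.
Let ext2 := @arm_ext F A n m a2.
Let HA1 := arms1 HA.
Let HA2 := arms2 HA.

Lemma cross_comm (u : root -> A) i j : (forall a b, pairing a b = 0 -> u a * f b = f b * u a) ->
  (i < m)%N -> u (a1 i) * ext2 f j = ext2 f j * u (a1 i).
Proof.
move=> hu hi; rewrite /ext2 /arm_ext; case: ifP => hj; last by rewrite mulr0 mul0r.
by apply: hu; rewrite (arms12 HA hi hj).
Qed.
Lemma ext12_comm i j : ext1 f i * ext2 f j = ext2 f j * ext1 f i.
Proof.
rewrite /ext1 /arm_ext; case: ifP => hi; last by rewrite mulr0 mul0r.
by apply: (cross_comm (u := f)) => // a b; exact: (isUq_FF H).
Qed.

(** The start f_beta gives W_ij and K_beta^-1 gives G_ij; the offsets r and s arise when a sum over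
    the G_ij is raised along the arms. *)
Definition grid_chain r s g i j : A := ch1 r (ch2 s g j) i.

Lemma grid_chain_swap r s g i j : grid_chain r s g i j = ch2 s (ch1 r g i) j.
Proof. by rewrite /grid_chain /ch1 /ch2 /arm_chain -chain_swap // => x y; exact: ext12_comm. Qed.

Lemma ch2_comm x s g j : x * g = g * x -> (forall l, x * ext2 f l = ext2 f l * x) ->
  x * ch2 s g j = ch2 s g j * x.
Proof. by move=> hg hx; apply: chain_comm => // l _; exact: hx. Qed.

Lemma ch2_mulr x s g j : (forall l, x * ext2 f l = ext2 f l * x) ->
  ch2 s g j * x = ch2 s (g * x) j.
Proof.
move=> hx; elim: j => [//|j IH]; rewrite /ch2 !arm_chainS -!/ch2 -IH mulrBl -scalerAl.
by rewrite -!mulrA -hx !mulrA.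
Qed.

Lemma ch2_scomm x s g j c : x * g = c *: (g * x) ->
  (forall l, x * ext2 f l = ext2 f l * x) -> x * ch2 s g j = c *: (ch2 s g j * x).
Proof.
move=> hg hx; rewrite /ch2 /arm_chain (@chain_scomm _ _ _ _ _ _ _ c (fun _ => 1)) //.
  by rewrite big1 ?mulr1.
by move=> l _; rewrite scale1r hx.
Qed.

Lemma ext1_beta_comm j : (0 < j)%N -> f beta * ext1 f j = ext1 f j * f beta.
Proof.
move=> hj; rewrite /ext1 /arm_ext; case: ifP => hm; last by rewrite mulr0 mul0r.
by apply: (isUq_FF H); rewrite pairingC (arms1beta HA hm) ifF //; lia.
Qed.

Let W i j := grid_chain 0 0 (f beta) i j.
Let g2 j := ch2 0 (f beta) j.

Lemma g2_ext1 i j : (0 < i)%N -> g2 j * ext1 f i = ext1 f i * g2 j.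
Proof.
move=> hi; apply/esym; apply: ch2_comm; first by rewrite ext1_beta_comm.
by move=> l; exact: ext12_comm.
Qed.
(** The F's of the second arm commute with those of the first, so the Serre relation with f_beta
    passes through the recursion. *)
Lemma g2_serre j : serre q (ext1 f 0) (g2 j) = 0.
Proof.
elim: j => [|j IH]; rewrite /g2 /ch2.
  case: (ltnP 0 m) => hm; last first.
    by rewrite /serre /ext1 arm_ext_out // !(mul0r, mulr0) scaler0 subr0 addr0.
  by rewrite /ext1 arm_ext_in //; apply: (isUq_serreF H); rewrite (arms1beta HA hm).
have xy := ext12_comm 0 (0 + j); rewrite arm_chainS -/(g2 j).
set x := ext1 f 0 in IH xy *; set y := ext2 f _ in xy *; set g := g2 j in IH *.
have -> : serre q x (g * y - q *: (y * g)) = serre q x g * y - q *: (y * serre q x g).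
  have xyA z : z * x * y = z * y * x by rewrite -mulrA xy mulrA.
  rewrite /serre !(mulrBl, mulrBr, mulrDl, mulrDr) -?scalerAl -?scalerAr !mulrA.
  rewrite ?(mulrBl, mulrBr, mulrDl, mulrDr) -?scalerAl -?scalerAr ?mulrA.
  rewrite ?xyA ?xy ?xyA.
  by module_eq F A; field.
by rewrite IH mul0r mulr0 scaler0 subr0.
Qed.

Lemma W_E1 x i j : (x < m)%N -> e (a1 x) * W i j = W i j * e (a1 x) -
  (if i == x.+1 then q *: (W x j * k (a1 x)) else 0).
Proof.
move=> hx; apply: (E_arm_chain0 q0 h0 H HA1) => //.
- by move=> l hl; exact: g2_ext1.
- move=> y hy; apply: ch2_comm; last by move=> l; apply: cross_comm => //; exact: pairing0_EF.
  by apply: (preUq_EFC H); apply: pairing_neq; rewrite (arms1beta HA hy); case: ifP.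
- move=> y hy; apply: ch2_scomm; last by move=> l; apply: cross_comm => //; exact: pairing0_KF.
  by rewrite (preUq_KF H) (arms1beta HA hy); case: ifP => _ //; rewrite oppr0 expr0z.
- move=> y hy; apply: ch2_scomm; last by move=> l; apply: cross_comm => //; exact: pairing0_KVF.
  by rewrite (preUq_KVF q0 H) (arms1beta HA hy); case: ifP.
Qed.

Lemma W_F1 x i j : ext1 f x * W i j =
  if i == x then q^-1 *: (W x j * ext1 f x - W x.+1 j)
  else if i == x.+1 then q *: (W i j * ext1 f x) else W i j * ext1 f x.
Proof.
by apply: (F_arm_chain q0 h0 H HA1 q2) => [l hl|]; [exact: g2_ext1|exact: g2_serre].
Qed.

Lemma grid_chain_scomm x r s g i j c d1 d2 : x * g = c *: (g * x) ->
  (forall l, x * ext1 f l = d1 l *: (ext1 f l * x)) ->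
  (forall l, x * ext2 f l = d2 l *: (ext2 f l * x)) ->
  x * grid_chain r s g i j =
    (c * \prod_(l < j) d2 (s + l)%N * \prod_(l < i) d1 (r + l)%N) *: (grid_chain r s g i j * x).
Proof.
move=> hg h1 h2.
apply: (@chain_scomm F q A (fun l => ext1 f (r + l)) _ i x _ (fun l => d1 (r + l)%N)) => [|l _].
  by apply: (@chain_scomm F q A (fun l => ext2 f (s + l)) _ j x _ (fun l => d2 (s + l)%N)).
exact: h1.
Qed.

Lemma ext_scomm (a : nat -> root) x (d : root -> F) l : (forall b, x * f b = d b *: (f b * x)) ->
  x * arm_ext m a f l = (if (l < m)%N then d (a l) else 1) *: (arm_ext m a f l * x).
Proof. by move=> hx; rewrite /arm_ext; case: ifP => _ //; rewrite mulr0 mul0r scaler0. Qed.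

Lemma W_K a i j : exists2 c, c != 0 & k a * W i j = c *: (W i j * k a).
Proof.
have hf b : k a * f b = q ^ (- pairing a b) *: (f b * k a) by rewrite (preUq_KF H).
have h a' l := ext_scomm a' (d := fun b => q ^ (- pairing a b)) l hf.
refine (ex_intro2 _ _ _ _ (grid_chain_scomm 0 0 i j (hf beta) (h a1) (h a2))).
rewrite !mulf_neq0 ?expfz_neq0 //; apply/prodf_neq0 => l _;
  by case: ifP => _; rewrite ?oner_eq0 ?expfz_neq0.
Qed.

Lemma grid_chainZ r s c g i j : grid_chain r s (c *: g) i j = c *: grid_chain r s g i j.
Proof. by rewrite /grid_chain /ch2 /ch1 /arm_chain !chainZ. Qed.
Lemma grid_chainB r s g g' i j : grid_chain r s (g - g') i j = grid_chain r s g i j - grid_chain r s g' i j.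
Proof. by rewrite /grid_chain /ch2 /ch1 /arm_chain !chainB. Qed.

(** K_beta f = q f K_beta for the first root of an arm, so already the first skew commutator is
    0. *)
Lemma arm_chain_Kbeta (a : nat -> root) i :
  (forall i, (i < m)%N -> pairing (a i) beta = if i == 0%N then -1 else 0) ->
  arm_chain q f m a 0 (k beta) i.+1 = 0.
Proof.
move=> ha; rewrite /arm_chain -add1n chain_shift; apply: etrans (chain0 q _ i).
congr chain; rewrite /= addn0 /arm_ext; case: ifP => hm; last by rewrite mulr0 mul0r scaler0 subr0.
by rewrite (preUq_KF H) pairingC ha // opprK expr1z subrr.
Qed.

Lemma grid_chain_Kbeta i j : grid_chain 0 0 (k beta) i j = if (i == 0%N) && (j == 0%N) then k beta else 0.
Proof.
rewrite /grid_chain; case: j => [|j].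
  by case: i => [//|i]; rewrite /ch1 arm_chain_Kbeta //; exact: arms1beta HA.
rewrite /ch2 arm_chain_Kbeta /ch1 /arm_chain ?chain0 ?andbF //; exact: arms2beta HA.
Qed.

Lemma ext_Ebeta (a : nat -> root) l :
  (forall i, (i < m)%N -> pairing (a i) beta = if i == 0%N then -1 else 0) ->
  e beta * arm_ext m a f l = arm_ext m a f l * e beta.
Proof.
move=> ha; rewrite /arm_ext; case: ifP => hm; last by rewrite mulr0 mul0r.
apply: (preUq_EFC H); apply: pairing_neq; rewrite pairingC ha //.
by case: ifP.
Qed.

(** E_beta commutes with the F's of both arms, so the bracket only replaces the start f_beta by (q -
    q^-1)^-1 (K_beta - K_beta^-1). The chains from K_beta vanish except at (0, 0). *)
Lemma W_Ebeta i j : e beta * W i j = W i j * e beta +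
  (q - q^-1)^-1 *: ((if (i == 0%N) && (j == 0%N) then k beta else 0) - grid_chain 0 0 (kv beta) i j).
Proof.
rewrite -grid_chain_Kbeta -grid_chainB -grid_chainZ -(preUq_EF H) -/(W i j).
rewrite /W /grid_chain /ch1 /ch2 /arm_chain -[in RHS](@chain_bracket _ _ _ (fun l => ext2 f (0 + l))) => [|l].
  rewrite -[in RHS](@chain_bracket _ _ _ (fun l => ext1 f (0 + l))) => [|l].
    by rewrite addrC subrK.
  by apply: ext_Ebeta; exact: arms1beta HA.
by apply: ext_Ebeta; exact: arms2beta HA.
Qed.

Section Module.
Context (N : lmodType A) (t : nat -> nat -> N).
Hypothesis t_out : forall i j, (m < i)%N -> t i j = 0.
(** By [W_E1] this says, coefficient by coefficient, that the E's of the first arm kill the sum of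
    the W_ij t_ij. *)
Hypothesis tE : forall x i j, (x < m)%N ->
  e (a1 x) *: t i j = if i == x then (q *: k (a1 x)) *: t x.+1 j else 0.

(* (q - q^-1) E_beta maps sum W_ij t_ij to K_beta t_00 - sumG (K_beta^-1) 0 0, and
   raising by the r-th root of the first arm shifts r and multiplies the start g
   by the inverse of its K. *)
Definition sumG g r s : N := \sum_(j < m.+1) \sum_(i < m.+1) grid_chain r s g i j *: t (r + i) (s + j).

(** Through [tE] the term i = 0 gives g' K t_(r+1), and the K-term of the bracket at i = 1 cancels
    it. The K^-1-terms remain and form the sum shifted to r + 1. *)
Lemma sumG_E_eq r s g : (r < m)%N ->
  e (a1 r) * g = q^-1 *: (g * e (a1 r)) -> k (a1 r) * g = g * k (a1 r) ->
  kv (a1 r) * g = g * kv (a1 r) -> (forall l, (r < l)%N -> g * ext1 f l = ext1 f l * g) ->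
  e (a1 r) *: sumG g r s = sumG (g * kv (a1 r)) r.+1 s.
Proof.
move=> hr eg kg kvg gf; rewrite scaler_sumr; apply: eq_bigr => j _.
set g' := ch2 s g j.
have eg' : e (a1 r) * g' = q^-1 *: (g' * e (a1 r)).
  by apply: ch2_scomm => // l; apply: cross_comm => //; exact: pairing0_EF.
have kg' : k (a1 r) * g' = g' * k (a1 r).
  by apply: ch2_comm => // l; apply: cross_comm => //; exact: pairing0_KF.
have kvc l : kv (a1 r) * ext2 f l = ext2 f l * kv (a1 r).
  by apply: cross_comm => //; exact: pairing0_KVF.
have kvg' : kv (a1 r) * g' = g' * kv (a1 r) by exact: ch2_comm.
have gf' l : (r < l)%N -> g' * ext1 f l = ext1 f l * g'.
  by move=> hl; apply/esym; apply: ch2_comm; [rewrite gf|move=> x; exact: ext12_comm].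
have E i : e (a1 r) * grid_chain r s g i.+1 j = q^-1 *: (grid_chain r s g i.+1 j * e (a1 r)) +
    (grid_chain r.+1 s (g * kv (a1 r)) i j - (if i == 0%N then g' * k (a1 r) else 0)).
  rewrite /grid_chain (@E_arm_chain_eq F q q0 h0 A n e f k kv H m a1 HA1 r g' i q^-1 1) ?invr1 ?scale1r ?oner_eq0 //.
  rewrite ?mulr1 -(opprB q q^-1) mulrN mulVf // !scaleN1r opprK; congr (_ + _).
  rewrite -(ch2_mulr s g j kvc) -/g' addrC; congr (_ + _).
  by case: ifP; rewrite ?oppr0.
(* The shifted sum has one more term, whose index r + 1 + m lies outside the grid. *)
have z : t (r.+1 + m) (s + j) = 0 by apply: t_out; lia.
rewrite [RHS]big_ord_recr /= z scaler0 addr0 scaler_sumr big_ord_recl /= addn0.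
have -> : grid_chain r s g 0 j = g' by [].
rewrite scalerA eg' scalerAl -scalerA tE // eqxx scalerA -scalerAl -scalerAr.
rewrite scalerA mulVf // scale1r.
have -> : \sum_(i < m) e (a1 r) *: (grid_chain r s g (lift ord0 i) j *: t (r + lift ord0 i) (s + j)) =
  \sum_(i < m) ((grid_chain r.+1 s (g * kv (a1 r)) i j *: t (r.+1 + i) (s + j)) -
    (if i == 0%N :> nat then (g' * k (a1 r)) *: t r.+1 (s + j) else 0)).
  apply: eq_bigr => i _; rewrite lift0 scalerA E scalerDl.
  have -> : (q^-1 *: (grid_chain r s g i.+1 j * e (a1 r))) *: t (r + i.+1) (s + j) = 0.
    by rewrite scalerAl -scalerA tE // ifF ?scaler0 //; lia.
  rewrite add0r scalerBl addnS addSn; congr (_ - _).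
  case: eqP => [-> //|_]; last by rewrite scale0r.
  by rewrite addn0.
rewrite sumrB.
have -> : \sum_(i < m) (if i == 0%N :> nat then (g' * k (a1 r)) *: t r.+1 (s + j) else 0) =
  (g' * k (a1 r)) *: t r.+1 (s + j).
  have m0 : (0 < m)%N by lia.
  by rewrite -big_mkcond /= (big_pred1 (Ordinal m0)).
by rewrite addrC subrK.
Qed.

(** Two indices contribute, i = x - r through the action on t and i = x - r + 1 through the bracket
    with the chain, and they cancel. *)
Lemma sumG_E_gt r s g x : (x < m)%N -> (r < x)%N ->
  e (a1 x) * g = g * e (a1 x) -> k (a1 x) * g = g * k (a1 x) ->
  kv (a1 x) * g = g * kv (a1 x) -> (forall l, (r < l)%N -> g * ext1 f l = ext1 f l * g) ->
  e (a1 x) *: sumG g r s = 0.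
Proof.
move=> hx rx eg kg kvg gf; rewrite scaler_sumr big1 // => j _.
set g' := ch2 s g j.
have eg' : e (a1 x) * g' = g' * e (a1 x).
  by apply: ch2_comm => // l; apply: cross_comm => //; exact: pairing0_EF.
have kg' : k (a1 x) * g' = g' * k (a1 x).
  by apply: ch2_comm => // l; apply: cross_comm => //; exact: pairing0_KF.
have kvg' : kv (a1 x) * g' = g' * kv (a1 x).
  by apply: ch2_comm => // l; apply: cross_comm => //; exact: pairing0_KVF.
have gf' l : (r < l)%N -> g' * ext1 f l = ext1 f l * g'.
  by move=> hl; apply/esym; apply: ch2_comm; [rewrite gf|move=> y; exact: ext12_comm].
have E i := E_arm_chain_gt q0 h0 H HA1 hx rx eg' kg' kvg' gf' i.
set y := (g' * k (a1 x)).
have D (i : 'I_m.+1) : e (a1 x) *: (grid_chain r s g i j *: t (r + i) (s + j)) =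
  (if (i == x - r :> nat)%N then (q *: (ch1 r g' (x - r) * k (a1 x))) *: t x.+1 (s + j) else 0)
  - (if (i == (x - r).+1 :> nat)%N then (q *: (ch1 r g' (x - r) * k (a1 x))) *: t x.+1 (s + j) else 0).
  rewrite scalerA /grid_chain E scalerBl -scalerA tE //; congr (_ - _).
    have -> : (r + i == x)%N = (i == x - r :> nat)%N by lia.
    case: eqP => [->|_]; last by rewrite scaler0.
    by rewrite scalerA -scalerAr.
  case: eqP => [i1|_]; last by rewrite scale0r.
  by congr (_ *: t _ _); lia.
have x1 : (x - r < m.+1)%N by lia.
have x2 : ((x - r).+1 < m.+1)%N by lia.
rewrite scaler_sumr (eq_bigr _ (fun i _ => D i)) sumrB -!big_mkcond /=.
by rewrite (big_pred1 (Ordinal x1)) // (big_pred1 (Ordinal x2)) // subrr.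
Qed.

Lemma sumG_E_lt r s g x c : (x < r)%N -> (x < m)%N ->
  e (a1 x) * g = c *: (g * e (a1 x)) -> e (a1 x) *: sumG g r s = 0.
Proof.
move=> xr hx eg; rewrite scaler_sumr big1 // => j _; rewrite scaler_sumr big1 // => i _.
rewrite scalerA /grid_chain (@E_arm_chain_lt F q q0 h0 A n e f k kv H m a1 HA1 r _ i x c) //; last first.
  by apply: ch2_scomm => // l; apply: cross_comm => //; exact: pairing0_EF.
rewrite scalerAl -scalerA tE // ifF ?scaler0 //; lia.
Qed.

End Module.

End Arms.
End TwoArms.

(** * Raising paths *)

Section ScalarAction.
Context (F : fieldType) (A : algType F) (N : lmodType A).
Implicit Types (x y : A) (v : N) (a b c : F).

Definition fscale c v : N := c%:A *: v.
Local Notation "c **: v" := (fscale c v) (at level 40).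

Lemma alg_scale c x v : (c *: x) *: v = c **: (x *: v).
Proof. by rewrite /fscale scalerA mulr_algl. Qed.
Lemma fscaleA a b v : a **: (b **: v) = (a * b) **: v.
Proof. by rewrite /fscale scalerA -scalerAl mul1r scalerA. Qed.
Lemma fscaleC x c v : x *: (c **: v) = c **: (x *: v).
Proof. by rewrite /fscale !scalerA mulr_algl -scalerAr mulr1. Qed.
Lemma fscale0l v : 0 **: v = 0.
Proof. by rewrite /fscale !scale0r. Qed.
Lemma fscale0r c : c **: 0 = 0.
Proof. by rewrite /fscale scaler0. Qed.
Lemma fscale1 v : 1 **: v = v.
Proof. by rewrite /fscale !scale1r. Qed.
Lemma fscaleBl a b v : (a - b) **: v = a **: v - b **: v.
Proof. by rewrite /fscale !scalerBl. Qed.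
Lemma fscaleBr a u v : a **: (u - v) = a **: u - a **: v.
Proof. by rewrite /fscale scalerBr. Qed.
Lemma fscale_sumr (I : Type) (r : seq I) (P : pred I) a (g : I -> N) :
  a **: (\sum_(i <- r | P i) g i) = \sum_(i <- r | P i) a **: g i.
Proof. by rewrite /fscale scaler_sumr. Qed.
Lemma scale_swap x y c v : x * y = c *: (y * x) -> x *: (y *: v) = c **: (y *: (x *: v)).
Proof. by move=> h; rewrite scalerA h alg_scale scalerA. Qed.
Lemma fscale_neq0 c v : c != 0 -> v != 0 -> c **: v != 0.
Proof.
move=> c0; apply: contra => /eqP h; apply/eqP.
by rewrite -(fscale1 v) -(mulVf c0) -fscaleA h fscale0r.
Qed.
Lemma fscale_inj a b v : v != 0 -> a **: v = b **: v -> a = b.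
Proof.
move=> v0 h; apply/eqP; rewrite -subr_eq0; apply: contraT => ab.
by have := fscale_neq0 ab v0; rewrite fscaleBl h subrr eqxx.
Qed.
End ScalarAction.
Notation "c **: v" := (fscale c v) (at level 40) : ring_scope.

Section Raising.
Context (F : fieldType) (q : F) (q0 : q != 0) (h0 : q - q^-1 != 0) (q2 : q + q^-1 != 0).
Hypothesis qNroot : forall l : nat, q ^+ l = 1 -> l = 0%N.
Context (A : algType F) (n : nat).
Local Notation root := (simple_root n).
Context (e f k kv : root -> A) (H : isUq q e f k kv) (m : nat).
Context (N : lmodType A).

Lemma sqr_exp_inj (z l : F) a b : l = z * (q ^+ 2) ^+ a -> l = z * (q ^+ 2) ^+ b ->
  l != 0 -> a = b.
Proof.
move=> -> E; rewrite mulf_eq0 negb_or => /andP[z0 _].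
have {}E := mulfI z0 E; rewrite -!exprM in E.
wlog ab : a b E / (a <= b)%N.
  by case: (leqP a b) => ab h; [exact: h|apply/esym; apply: h => //; exact: ltnW].
have : q ^+ (2 * b - 2 * a) = 1.
  by apply: (mulfI (expf_neq0 (2 * a) q0)); rewrite -exprD subnKC ?mulr1 //; lia.
by move/qNroot; lia.
Qed.

Fixpoint eword (a : nat -> root) s : A := if s is l.+1 then e (a l) * eword a l else 1.

Lemma eword_scomm (a : nat -> root) x d s : (s <= m)%N ->
  (forall l, (l < m)%N -> x * e (a l) = d l *: (e (a l) * x)) ->
  x * eword a s = (\prod_(l < s) d l) *: (eword a s * x).
Proof.
move=> sm hx; elim: s sm => [|s IH] sm; first by rewrite /= big_ord0 scale1r mulr1 mul1r.
by rewrite /= mulrA hx // -scalerAl -(mulrA (e _) x) IH 1?ltnW // -scalerAr scalerA big_ord_recr mulrA (mulrC (d s)).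
Qed.

Section Arms.
Context (a1 a2 : nat -> root) (HA : arms m a1 a2).

Definition raise (x : N) r s : N := eword a2 s *: (eword a1 r *: x).

Lemma eword2_comm l s : (l < m)%N -> (s <= m)%N -> e (a1 l) * eword a2 s = eword a2 s * e (a1 l).
Proof.
move=> hl hs; rewrite (eword_scomm (d := fun=> 1)) // => [|j hj].
  by rewrite big1 ?scale1r.
by rewrite scale1r (isUq_EE H) // (arms12 HA).
Qed.

Lemma raise_E1 x r s : (r < m)%N -> (s <= m)%N -> e (a1 r) *: raise x r s = raise x r.+1 s.
Proof. by move=> hr hs; rewrite /raise scalerA eword2_comm // -scalerA /= -[in RHS]scalerA. Qed.
Lemma raise_E2 x r s : e (a2 s) *: raise x r s = raise x r s.+1.
Proof. by rewrite /raise scalerA. Qed.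
Lemma raise00 x : raise x 0 0 = x.
Proof. by rewrite /raise !scale1r. Qed.
Lemma raiseB x y r s : raise (x - y) r s = raise x r s - raise y r s.
Proof. by rewrite /raise !scalerBr. Qed.
Lemma raiseZ c x r s : raise (c **: x) r s = c **: raise x r s.
Proof. by rewrite /raise !fscaleC. Qed.

(** At each point of the grid only the E's that continue the path may act nontrivially; T_00 and Q
    share this property. *)
Definition raising x := forall r s l, (r <= m)%N -> (s <= m)%N -> (l < m)%N ->
  (l <> r -> e (a1 l) *: raise x r s = 0) /\ (l <> s -> e (a2 l) *: raise x r s = 0).

Lemma raise_scomm x y (d1 d2 : nat -> F) rh r s : (r <= m)%N -> (s <= m)%N ->
  (forall l, (l < m)%N -> y * e (a1 l) = d1 l *: (e (a1 l) * y)) ->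
  (forall l, (l < m)%N -> y * e (a2 l) = d2 l *: (e (a2 l) * y)) ->
  y *: x = rh **: x ->
  y *: raise x r s = (rh * \prod_(l < r) d1 l * \prod_(l < s) d2 l) **: raise x r s.
Proof.
move=> hr hs h1 h2 hx; rewrite /raise (scale_swap _ (eword_scomm hs h2)).
have E := scale_swap x (eword_scomm hr h1).
rewrite E hx !fscaleC !fscaleA.
by congr (_ **: _); ring.
Qed.

Definition kprod (s : seq root) : A := \prod_(a <- s) k a.

Section Weight.
Context (sq : seq root) (u1 u2 : int).
Hypothesis sq1 : forall l, (l < m)%N -> \sum_(a <- sq) pairing a (a1 l) = u1.
Hypothesis sq2 : forall l, (l < m)%N -> \sum_(a <- sq) pairing a (a2 l) = u2.

Lemma raise_weight x rh r s : (r <= m)%N -> (s <= m)%N -> kprod sq *: x = rh **: x ->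
  kprod sq *: raise x r s = (rh * (q ^ u1) ^+ r * (q ^ u2) ^+ s) **: raise x r s.
Proof.
move=> hr hs hx.
rewrite (raise_scomm (d1 := fun=> q ^ u1) (d2 := fun=> q ^ u2) hr hs _ _ hx).
- by rewrite !prodr_const !card_ord.
- by move=> l hl; rewrite (prod_K_E q0 H) sq1.
- by move=> l hl; rewrite (prod_K_E q0 H) sq2.
Qed.
End Weight.

(* The vector reached at the end of the maximal raising path is a highest weight
   vector, and its weight determines the length of the path. *)
Section Corner.
Context (im : N -> Prop) (w : N) (w0 : w != 0).
Hypothesis imE1 : forall l x, (l < m)%N -> im x -> im (e (a1 l) *: x).
Hypothesis imE2 : forall l x, (l < m)%N -> im x -> im (e (a2 l) *: x).
Hypothesis line : forall x, im x ->
  (forall l, (l < m)%N -> e (a1 l) *: x = 0 /\ e (a2 l) *: x = 0) ->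
  exists c, x = c **: w.
Context (s1 s2 : seq root) (l1 l2 : F).
Hypothesis s11 : forall l, (l < m)%N -> \sum_(a <- s1) pairing a (a1 l) = 2.
Hypothesis s12 : forall l, (l < m)%N -> \sum_(a <- s1) pairing a (a2 l) = 0.
Hypothesis s21 : forall l, (l < m)%N -> \sum_(a <- s2) pairing a (a1 l) = 0.
Hypothesis s22 : forall l, (l < m)%N -> \sum_(a <- s2) pairing a (a2 l) = 2.
Hypothesis w1 : kprod s1 *: w = l1 **: w.
Hypothesis w2 : kprod s2 *: w = l2 **: w.

Lemma im_raise x r s : im x -> (r <= m)%N -> (s <= m)%N -> im (raise x r s).
Proof.
move=> hx hr; elim: s => [|s IH] hs; last by rewrite -raise_E2; apply: imE2 => //; exact: IH (ltnW hs).
elim: r hr => [|r IH] hr; first by rewrite raise00.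
by rewrite -raise_E1 //; apply: imE1 => //; exact: IH (ltnW hr).
Qed.

Lemma corner x r1 r2 : im x -> raising x -> x != 0 ->
  kprod s1 *: x = r1 **: x -> kprod s2 *: x = r2 **: x ->
  exists r s, [/\ (r <= m)%N, (s <= m)%N, raise x r s != 0,
    forall i j, (i <= m)%N -> (j <= m)%N -> (r <= i)%N -> (s <= j)%N ->
      (i, j) <> (r, s) -> raise x i j = 0 &
    l1 = r1 * (q ^+ 2) ^+ r /\ l2 = r2 * (q ^+ 2) ^+ s].
Proof.
move=> hx gx x0 x1 x2.
(* Go as far as possible along the first arm, then along the second. *)
have ex1 : exists r, (r <= m)%N && (raise x r 0 != 0) by exists 0%N; rewrite raise00.
have b1 r : (r <= m)%N && (raise x r 0 != 0) -> (r <= m)%N by case/andP.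
case: (ex_maxnP ex1 b1) => r /andP[hr xr] maxr.
have ex2 : exists s, (s <= m)%N && (raise x r s != 0) by exists 0%N; rewrite xr.
have b2 s : (s <= m)%N && (raise x r s != 0) -> (s <= m)%N by case/andP.
case: (ex_maxnP ex2 b2) => s /andP[hs xs] maxs.
have out i j : (i <= m)%N -> (j <= m)%N -> (r <= i)%N -> (s <= j)%N ->
    (i, j) <> (r, s) -> raise x i j = 0.
  move=> hi hj ri sj ne; case: (ltnP r i) => ri'.
    have h1 : raise x i 0 = 0.
      by apply/eqP; apply: contraT => h; have := maxr i; rewrite hi h leqNgt ri' => /(_ isT).
    by rewrite /raise -(scale1r (eword a1 i *: x)) -[1 *: _]/(raise x i 0) h1 scaler0.
  have ei : i = r by lia.
  have jn : j <> s by move=> E; apply: ne; rewrite ei E.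
  have sj' : (s < j)%N by lia.
  by rewrite ei; apply/eqP; apply: contraT => h; have := maxs j; rewrite hj h leqNgt sj' => /(_ isT).
have kill l : (l < m)%N -> e (a1 l) *: raise x r s = 0 /\ e (a2 l) *: raise x r s = 0.
  move=> hl; have [k1 k2] := gx r s l hr hs hl; split.
    case: (eqVneq l r) => [E|/eqP //]; rewrite E in hl *.
    rewrite raise_E1 //; apply: out => //; case; lia.
  case: (eqVneq l s) => [E|/eqP //]; rewrite E in hl *.
  rewrite raise_E2 //; apply: out => //; case; lia.
have [c E] := line (im_raise hx hr hs) kill.
exists r, s; split=> //.
have c0 : c != 0 by apply: contraNneq xs => c0; rewrite E c0 fscale0l.
have wt (sq : seq root) rh l : kprod sq *: w = l **: w ->
    kprod sq *: raise x r s = rh **: raise x r s -> l = rh.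
  rewrite E fscaleC => -> h; apply: (fscale_inj (fscale_neq0 c0 w0)).
  by rewrite -h !fscaleA mulrC.
split.
  apply: wt w1 _; rewrite (raise_weight s11 s12 hr hs x1).
  by rewrite expr0z expr1n mulr1.
apply: wt w2 _; rewrite (raise_weight s21 s22 hr hs x2).
by rewrite expr0z expr1n mulr1.
Qed.

(** The end of the path is determined by the weight, because q^2 has infinite order. *)
Lemma corner_unique x r1 r2 r s : im x -> raising x -> x != 0 ->
  kprod s1 *: x = r1 **: x -> kprod s2 *: x = r2 **: x ->
  l1 = r1 * (q ^+ 2) ^+ r -> l2 = r2 * (q ^+ 2) ^+ s -> l1 != 0 -> l2 != 0 ->
  raise x r s != 0.
Proof.
move=> hx gx x0 x1 x2 e1 e2 n1 n2.
have [i [j [_ _ xij _ [f1 f2]]]] := corner hx gx x0 x1 x2.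
by rewrite (sqr_exp_inj e1 f1 n1) (sqr_exp_inj e2 f2 n2).
Qed.
End Corner.

End Arms.
End Raising.

(** * Q is a multiple of T_00 by a power of q *)

Section CartanStart.
Context (F : fieldType) (q : F) (q0 : q != 0).
Context (A : algType F) (n : nat).
Local Notation root := (simple_root n).
Context (e f k kv : root -> A) (H : isUq q e f k kv) (m : nat).

Lemma kvkv a b : kv a * kv b = kv b * kv a.
Proof. exact: (preUq_KK (preUq_swap q0 H)). Qed.
Lemma kkv a b : k a * kv b = kv b * k a.
Proof.
rewrite -[LHS]mul1r -(preUq_KVK H b) -!mulrA (mulrA (k b)) (preUq_KK H b a).
by rewrite -!mulrA (preUq_KKV H) mulr1.
Qed.

Section Arms.
Context (a1 a2 : nat -> root) (HA : arms m a1 a2).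

(** What the start K_beta^-1 has become after r raisings along the first arm and s along the
    second. *)
Definition kvprod r s : A := kv beta * (\prod_(0 <= i < r) kv (a1 i)) * \prod_(0 <= j < s) kv (a2 j).

Definition kv_roots r s : seq root := beta :: map a1 (index_iota 0 r) ++ map a2 (index_iota 0 s).

Lemma kvprodE r s : kvprod r s = \prod_(a <- kv_roots r s) kv a.
Proof. by rewrite /kvprod big_cons big_cat /= !big_map mulrA. Qed.

Lemma comm_kvprod x r s : (forall a, x * kv a = kv a * x) -> x * kvprod r s = kvprod r s * x.
Proof.
by move=> hx; rewrite kvprodE; apply: commr_prod => a _; exact: hx.
Qed.

Lemma kvprod_S1 r s : kvprod r s * kv (a1 r) = kvprod r.+1 s.
Proof.
rewrite /kvprod big_nat_recr //= -!mulrA; congr (_ * (_ * _)).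
by apply/esym; apply: commr_prod => j _; exact: kvkv.
Qed.

Lemma kvprod_E r s b : kvprod r s * e b = q ^ (- \sum_(a <- kv_roots r s) pairing a b) *: (e b * kvprod r s).
Proof. by rewrite kvprodE (prod_K_F q0 (preUq_swap q0 H)). Qed.
Lemma kvprod_F r s b : kvprod r s * f b = q ^ (\sum_(a <- kv_roots r s) pairing a b) *: (f b * kvprod r s).
Proof. by rewrite kvprodE (prod_K_E q0 (preUq_swap q0 H)). Qed.

Lemma E_kvprod r s b : e b * kvprod r s = q ^ (\sum_(a <- kv_roots r s) pairing a b) *: (kvprod r s * e b).
Proof. by rewrite kvprod_E scalerA -expfzDr // subrr expr0z scale1r. Qed.

(** The roots in the list form a connected string through beta, and the only root of the first arm
    beyond its end that is adjacent to it is the r-th. *)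
Lemma kv_roots_sum r s x : (x < m)%N -> (s <= m)%N -> (r <= x)%N ->
  \sum_(a <- kv_roots r s) pairing a (a1 x) = if r == x then -1 else 0.
Proof.
move=> hx hs rx; rewrite big_cons big_cat /= !big_map.
rewrite [X in _ + (_ + X)]big_nat_cond [X in _ + (_ + X)]big1; last first.
  by move=> j /andP[/andP[_ hj] _]; rewrite pairingC (arms12 HA) //; lia.
rewrite addr0 pairingC (arms1beta HA hx).
have -> : \sum_(0 <= i < r) pairing (a1 i) (a1 x) = \sum_(0 <= i < r) (if i.+1 == x then -1 else 0).
  apply: eq_big_nat => i /andP[_ hi]; rewrite (arms1 HA) //; last lia.
  have -> : (i == x) = false by lia.
  have -> : (x.+1 == i) = false by lia.
  by rewrite orbF.
case: r rx => [|r] rx; first by rewrite big_geq // addr0 eq_sym.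
have -> : (x == 0%N) = false by lia.
rewrite add0r big_nat_recr //= big_nat_cond big1 ?add0r // => i /andP[/andP[_ hi] _].
by rewrite ifF //; lia.
Qed.

End Arms.

Lemma kvprod_swap a1 a2 r s : kvprod a1 a2 r s = kvprod a2 a1 s r.
Proof.
rewrite /kvprod -!mulrA; congr (_ * _); apply: commr_prod => j _; apply/commr_sym.
by apply: commr_prod => i _; exact: kvkv.
Qed.

End CartanStart.

Section Proportional.
Context (F : fieldType) (q : F) (q0 : q != 0) (h0 : q - q^-1 != 0) (q2 : q + q^-1 != 0).
Hypothesis qNroot : forall l : nat, q ^+ l = 1 -> l = 0%N.
Context (A : algType F) (n : nat).
Local Notation root := (simple_root n).
Context (e f k kv : root -> A) (H : isUq q e f k kv) (m : nat).
Context (N : lmodType A) (a1 a2 : nat -> root) (HA : arms m a1 a2).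
Let HA' := arms_sym HA.
Context (t : nat -> nat -> N).
Hypothesis t_out1 : forall i j, (m < i)%N -> t i j = 0.
Hypothesis t_out2 : forall i j, (m < j)%N -> t i j = 0.
Hypothesis tE1 : forall x i j, (x < m)%N ->
  e (a1 x) *: t i j = if i == x then (q *: k (a1 x)) *: t x.+1 j else 0.
Hypothesis tE2 : forall x i j, (x < m)%N ->
  e (a2 x) *: t i j = if j == x then (q *: k (a2 x)) *: t i x.+1 else 0.

Let sumGH r s := sumG q f m a1 a2 t (kvprod kv a1 a2 r s) r s.
Let rs : N -> nat -> nat -> N := raise e a1 a2.

Lemma sumG_sym g r s : sumG q f m a1 a2 t g r s = sumG q f m a2 a1 (fun i j => t j i) g s r.
Proof.
rewrite /sumG exchange_big /=; apply: eq_bigr => i _; apply: eq_bigr => j _.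
by rewrite (grid_chain_swap H HA).
Qed.

Section OneArm.
Context (b1 b2 : nat -> root) (HB : arms m b1 b2) (t' : nat -> nat -> N).
Hypothesis t'_out : forall i j, (m < i)%N -> t' i j = 0.
Hypothesis t'E : forall x i j, (x < m)%N ->
  e (b1 x) *: t' i j = if i == x then (q *: k (b1 x)) *: t' x.+1 j else 0.

Lemma kvprod_ext r s l : (r <= m)%N -> (s <= m)%N -> (r < l)%N ->
  kvprod kv b1 b2 r s * arm_ext m b1 f l = arm_ext m b1 f l * kvprod kv b1 b2 r s.
Proof.
move=> hr hs rl; rewrite /arm_ext; case: ifP => hl; last by rewrite mulr0 mul0r.
rewrite (kvprod_F q0 H) (kv_roots_sum q0 HB) //; last exact: ltnW.
by rewrite ifF ?expr0z ?scale1r //; lia.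
Qed.

Lemma sumG_E r s x : (r <= m)%N -> (s <= m)%N -> (x < m)%N ->
  e (b1 x) *: sumG q f m b1 b2 t' (kvprod kv b1 b2 r s) r s =
  if x == r then sumG q f m b1 b2 t' (kvprod kv b1 b2 r.+1 s) r.+1 s else 0.
Proof.
move=> hr hs hx; have He := E_kvprod q0 H b1 b2 r s (b1 x).
have hk := fun a => comm_kvprod b1 b2 r s (fun b => kkv H a b).
have hkv := fun a => comm_kvprod b1 b2 r s (fun b => kvkv q0 H a b).
have hF l : (r < l)%N -> _ := kvprod_ext hr hs (l := l).
case: (ltngtP x r) => xr.
- exact: (sumG_E_lt q0 h0 q2 H HB t'E _ xr hx He).
- move: He; rewrite (kv_roots_sum q0 HB) ?ifF ?expr0z ?scale1r //; try lia; move=> He.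
  exact: (sumG_E_gt q0 h0 q2 H HB t'E _ hx xr He (hk _) (hkv _) hF).
- rewrite xr in hx He hk hkv *.
  move: He; rewrite (kv_roots_sum q0 HB) ?eqxx // => He.
  by rewrite (sumG_E_eq q0 h0 q2 H HB t'_out t'E _ hx He (hk _) (hkv _) hF) (kvprod_S1 q0 H).
Qed.
End OneArm.

Lemma sumGH_E1 r s x : (r <= m)%N -> (s <= m)%N -> (x < m)%N ->
  e (a1 x) *: sumGH r s = if x == r then sumGH r.+1 s else 0.
Proof. exact: (sumG_E HA t_out1 tE1). Qed.

Lemma sumGH_E2 r s x : (r <= m)%N -> (s <= m)%N -> (x < m)%N ->
  e (a2 x) *: sumGH r s = if x == s then sumGH r s.+1 else 0.
Proof.
move=> hr hs hx; rewrite /sumGH !sumG_sym !(kvprod_swap q0 H a1 a2).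
by apply: (sumG_E HA') => //; [move=> i j; exact: t_out2|move=> y i j; exact: tE2].
Qed.

Lemma raise_sumG r s : (r <= m)%N -> (s <= m)%N -> rs (sumGH 0 0) r s = sumGH r s.
Proof.
move=> hr; elim: s => [|s IH] hs; last first.
  by rewrite /rs -raise_E2 -/rs IH ?(ltnW hs) // sumGH_E2 ?eqxx // ltnW.
elim: r hr => [|r IH] hr; first exact: raise00.
by rewrite /rs -(raise_E1 H HA) // -/rs IH ?(ltnW hr) // sumGH_E1 ?eqxx // ltnW.
Qed.

Lemma raising_sumG : raising e m a1 a2 (sumGH 0 0).
Proof.
move=> r s l hr hs hl; rewrite -/rs raise_sumG // sumGH_E1 // sumGH_E2 //.
by split=> /eqP/negPf ->.
Qed.

Context (P : F -> Prop).
Hypothesis PM : forall a b, P a -> P b -> P (a * b).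
Hypothesis PV : forall a, P a -> P a^-1.
Hypothesis Pq : P q.
Hypothesis P_neq0 : forall a, P a -> a != 0.
Hypothesis tk : forall a, exists2 c, P c & k a *: t 0 0 = c **: t 0 0.

Lemma closed1 : P 1.
Proof. by rewrite -(divff q0); apply: PM => //; exact: PV. Qed.
Lemma closed_int z : P (q ^ z).
Proof.
have Pn i : P (q ^+ i) by elim: i => [|i IH]; [exact: closed1|rewrite exprS; exact: PM].
by case: z => i; [exact: Pn|rewrite NegzE -exprnN; apply: PV; exact: Pn].
Qed.
Lemma closed_prod (I : Type) (s : seq I) (c : I -> F) : (forall i, P (c i)) -> P (\prod_(i <- s) c i).
Proof. by move=> hc; elim/big_ind: _ => //; exact: closed1. Qed.

Lemma kv_eigen a (c : F) (x : N) : c != 0 -> k a *: x = c **: x -> kv a *: x = c^-1 **: x.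
Proof.
move=> c0 h; rewrite -[in RHS](scale1r x) -(preUq_KVK H a) -scalerA h fscaleC.
by rewrite fscaleA mulVf // fscale1.
Qed.

Lemma raise_kv a r s : (r <= m)%N -> (s <= m)%N ->
  exists2 c, P c & kv a *: rs (t 0 0) r s = c **: rs (t 0 0) r s.
Proof.
move=> hr hs; have [c Pc hc] := tk a; have {}hc := kv_eigen (P_neq0 Pc) hc.
have hE b : kv a * e b = q ^ (- pairing a b) *: (e b * kv a) by exact: (preUq_KVE q0 H).
exists (c^-1 * (\prod_(l < r) q ^ (- pairing a (a1 l))) * (\prod_(l < s) q ^ (- pairing a (a2 l)))).
  apply: PM; last by apply: closed_prod => l; exact: closed_int.
  by apply: PM; [exact: PV|apply: closed_prod => l; exact: closed_int].
exact: (raise_scomm (d1 := fun l => q ^ (- pairing a (a1 l)))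
  (d2 := fun l => q ^ (- pairing a (a2 l))) hr hs _ _ hc).
Qed.

(** The relation e t_r = q K t_(r+1) is solved for t_(r+1), and K^-1 acts on the raised vector by an
    eigenvalue. The predicate [P], later the set of powers of q, records where the factors lie. *)
Lemma t_raise r s : (r <= m)%N -> (s <= m)%N -> exists2 c, P c & t r s = c **: rs (t 0 0) r s.
Proof.
have step (b : root) x y : e b *: x = (q *: k b) *: y -> y = q^-1 **: (kv b *: (e b *: x)).
  move=> ->; rewrite alg_scale fscaleC fscaleA mulVf // fscale1 scalerA.
  by rewrite (preUq_KVK H) scale1r.
move=> hr; elim: s => [|s IH] hs.
  elim: r hr => [|r IH] hr; first by exists 1; [exact: closed1|rewrite fscale1 /rs raise00].
  have [c Pc hc] := IH (ltnW hr); have := tE1 r 0 hr; rewrite eqxx => /step ->.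
  have [d Pd hd] := raise_kv (a1 r) hr (leq0n m).
  exists (q^-1 * (c * d)); first by apply: PM; [exact: PV|exact: PM].
  by rewrite hc fscaleC /rs (raise_E1 H HA) // -/rs fscaleC hd !fscaleA mulrA.
have [c Pc hc] := IH (ltnW hs); have := tE2 r s hs; rewrite eqxx => /step ->.
have [d Pd hd] := raise_kv (a2 s) hr hs.
exists (q^-1 * (c * d)); first by apply: PM; [exact: PV|exact: PM].
by rewrite hc fscaleC /rs raise_E2 -/rs fscaleC hd !fscaleA mulrA.
Qed.

Lemma raising_t : raising e m a1 a2 (t 0 0).
Proof.
move=> r s l hr hs hl; have [c Pc hc] := t_raise hr hs.
have z x : x *: t r s = 0 -> x *: raise e a1 a2 (t 0 0) r s = 0.
  rewrite hc fscaleC -/rs => h; apply/eqP; apply: contraT => nz.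
  by have := fscale_neq0 (P_neq0 Pc) nz; rewrite h eqxx.
by split=> /eqP/negPf ne; apply: z; rewrite ?tE1 ?tE2 // eq_sym ne.
Qed.

(** G_ij lowers the weight by the same roots by which t_ij exceeds t_00, so every term has the
    weight of t_00. *)
Lemma weight_sumG (sq : seq root) (u1 u2 : int) rh :
  (forall l, (l < m)%N -> \sum_(a <- sq) pairing a (a1 l) = u1) ->
  (forall l, (l < m)%N -> \sum_(a <- sq) pairing a (a2 l) = u2) ->
  kprod k sq *: t 0 0 = rh **: t 0 0 -> kprod k sq *: sumGH 0 0 = rh **: sumGH 0 0.
Proof.
move=> h1 h2 ht.
have R0 : kprod k sq * kvprod kv a1 a2 0 0 = 1 *: (kvprod kv a1 a2 0 0 * kprod k sq).
  rewrite scale1r; apply: comm_kvprod => a; apply/commr_sym; apply: commr_prod => b _.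
  by apply/esym; exact: (kkv H).
have hx b : kprod k sq * f b = q ^ (- \sum_(a <- sq) pairing a b) *: (f b * kprod k sq).
  exact: (prod_K_F q0 H).
rewrite /sumGH /sumG scaler_sumr fscale_sumr; apply: eq_bigr => j _.
rewrite scaler_sumr fscale_sumr; apply: eq_bigr => i _; rewrite !add0n.
have E := grid_chain_scomm q 0 0 i j R0 (fun l => ext_scomm m a1 l hx) (fun l => ext_scomm m a2 l hx).
rewrite (scale_swap _ E).
have hi : (i <= m)%N by rewrite -ltnS.
have hj : (j <= m)%N by rewrite -ltnS.
have [c Pc ->] := t_raise hi hj.
rewrite 2!fscaleC /rs (raise_weight q0 H h1 h2 hi hj ht) !fscaleC !fscaleA; congr (_ **: _).
rewrite (eq_bigr (fun=> q ^ (- u2))) => [|l _]; last by rewrite add0n h2 ?ifT //; have := ltn_ord l; lia.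
rewrite prodr_const card_ord (eq_bigr (fun=> q ^ (- u1))) => [|l _]; last by rewrite add0n h1 ?ifT //; have := ltn_ord l; lia.
rewrite prodr_const card_ord -!invr_expz !exprVn.
have n1 : (q ^ u1) ^+ i != 0 by rewrite expf_neq0 // expfz_neq0.
have n2 : (q ^ u2) ^+ j != 0 by rewrite expf_neq0 // expfz_neq0.
by field; apply/andP.
Qed.

Context (im : N -> Prop) (w : N) (w0 : w != 0).
Hypothesis imE1 : forall l x, (l < m)%N -> im x -> im (e (a1 l) *: x).
Hypothesis imE2 : forall l x, (l < m)%N -> im x -> im (e (a2 l) *: x).
Hypothesis imB : forall c x y, im x -> im y -> im (x - c **: y).
Hypothesis line : forall x, im x ->
  (forall l, (l < m)%N -> e (a1 l) *: x = 0 /\ e (a2 l) *: x = 0) ->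
  exists c, x = c **: w.
Context (s1 s2 : seq root) (l1 l2 : F) (l10 : l1 != 0) (l20 : l2 != 0).
Hypothesis s11 : forall l, (l < m)%N -> \sum_(a <- s1) pairing a (a1 l) = 2.
Hypothesis s12 : forall l, (l < m)%N -> \sum_(a <- s1) pairing a (a2 l) = 0.
Hypothesis s21 : forall l, (l < m)%N -> \sum_(a <- s2) pairing a (a1 l) = 0.
Hypothesis s22 : forall l, (l < m)%N -> \sum_(a <- s2) pairing a (a2 l) = 2.
Hypothesis w1 : kprod k s1 *: w = l1 **: w.
Hypothesis w2 : kprod k s2 *: w = l2 **: w.
Hypothesis im_t : im (t 0 0).
Hypothesis im_Q : im (sumGH 0 0).
Hypothesis t0 : t 0 0 != 0.

Lemma kprod_eigen sq : exists c, kprod k sq *: t 0 0 = c **: t 0 0.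
Proof.
elim: sq => [|a sq [c hc]]; first by exists 1; rewrite /kprod big_nil scale1r fscale1.
have [d _ hd] := tk a; exists (c * d).
by rewrite /kprod big_cons -scalerA hc fscaleC hd fscaleA.
Qed.

(* At the end of the raising path of t_00 the double sum has a single term, and
   the difference of the two sides has no raising path ending there. *)
Lemma sumG_proportional : exists2 c, P c & sumGH 0 0 = c **: t 0 0.
Proof.
have [r1 x1] := kprod_eigen s1; have [r2 x2] := kprod_eigen s2.
have [r [s [hr hs xrs out [e1 e2]]]] :=
  corner q0 h0 q2 H HA w0 imE1 imE2 line s11 s12 s21 s22 w1 w2 im_t raising_t t0 x1 x2.
have [c Pc tc] := t_raise hr hs.
have [d Pd hd] : exists2 d, P d & kvprod kv a1 a2 r s *: rs (t 0 0) r s = d **: rs (t 0 0) r s.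
  rewrite kvprodE; elim: (kv_roots _ _ _ _) => [|a sq [d Pd hd]].
    by exists 1; [exact: closed1|rewrite big_nil scale1r fscale1].
  have [b Pb hb] := raise_kv a hr hs; exists (d * b); first exact: PM.
  by rewrite big_cons -scalerA hd fscaleC hb fscaleA.
(* Every t_(r+i, s+j) other than t_rs lies past the end of the path or outside the grid, hence is
   0. *)
have Qrs : sumGH r s = (c * d) **: rs (t 0 0) r s.
  rewrite /sumGH /sumG (bigD1 ord0) //= (bigD1 ord0) //= !addn0 tc fscaleC hd fscaleA.
  rewrite [X in _ + X + _]big1 => [|i ine]; last first.
    suff -> : t (r + i) s = 0 by rewrite scaler0.
    case: (leqP (r + i)%N m) => hi; last exact: t_out1.
    have [b _ ->] := t_raise hi hs; rewrite /rs out ?fscale0r ?leq_addr // => - [].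
    by move/eqP: ine => ine E; apply: ine; apply: val_inj => /=; lia.
  rewrite [X in _ + X]big1 ?addr0 // => j jne; rewrite big1 // => i _.
  suff -> : t (r + i) (s + j) = 0 by rewrite scaler0.
  case: (leqP (r + i)%N m) => hi; last exact: t_out1.
  case: (leqP (s + j)%N m) => hj; last exact: t_out2.
  have [b _ ->] := t_raise hi hj; rewrite /rs out ?fscale0r ?leq_addr // => - [] _.
  by move/eqP: jne => jne E; apply: jne; apply: val_inj => /=; lia.
exists (c * d); first exact: PM.
apply/eqP; rewrite -subr_eq0; apply: contraT => nz.
have gY : raising e m a1 a2 (sumGH 0 0 - (c * d) **: t 0 0).
  move=> i j l hi hj hl; have [g1 g2] := raising_sumG hi hj hl; have [g3 g4] := raising_t hi hj hl.
  rewrite raiseB raiseZ; split=> ne.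
    by rewrite scalerBr fscaleC g1 // g3 // fscale0r subr0.
  by rewrite scalerBr fscaleC g2 // g4 // fscale0r subr0.
have wY sq rh : kprod k sq *: t 0 0 = rh **: t 0 0 -> kprod k sq *: sumGH 0 0 = rh **: sumGH 0 0 ->
    kprod k sq *: (sumGH 0 0 - (c * d) **: t 0 0) = rh **: (sumGH 0 0 - (c * d) **: t 0 0).
  by move=> h h'; rewrite scalerBr fscaleC h h' fscaleBr !fscaleA (mulrC rh).
have y1 := wY _ _ x1 (weight_sumG s11 s12 x1).
have y2 := wY _ _ x2 (weight_sumG s21 s22 x2).
have := corner_unique q0 h0 q2 qNroot H HA w0 imE1 imE2 line s11 s12 s21 s22 w1 w2
  (imB (c * d) im_Q im_t) gY nz y1 y2 e1 e2 l10 l20.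
by rewrite raiseB raiseZ -/rs raise_sumG // Qrs subrr eqxx.
Qed.

End Proportional.

(** * Action of U_q on sums of W_ij y_ij *)

Section DegreeOneAction.
Context (F : fieldType) (q : F) (q0 : q != 0) (h0 : q - q^-1 != 0) (q2 : q + q^-1 != 0).
Context (A : algType F) (n : nat).
Local Notation root := (simple_root n).
Context (e f k kv : root -> A) (H : isUq q e f k kv) (m : nat).
Context (N : lmodType A) (a1 a2 : nat -> root) (HA : arms m a1 a2).
Implicit Type y : nat -> nat -> N.

Definition sumW y : N := sumG q f m a1 a2 y (f beta) 0 0.

Lemma sumWE y : sumW y = \sum_(j < m.+1) \sum_(i < m.+1) grid_chain q f m a1 a2 0 0 (f beta) i j *: y i j.
Proof. by []. Qed.

Lemma eq_sumW y z : (forall i j, (i <= m)%N -> (j <= m)%N -> y i j = z i j) -> sumW y = sumW z.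
Proof.
move=> h; rewrite !sumWE; apply: eq_bigr => j _; apply: eq_bigr => i _.
by rewrite h // -ltnS.
Qed.

Lemma sumW_E y x : (x < m)%N -> e (a1 x) *: sumW y =
  sumW (fun i j => e (a1 x) *: y i j - if i == x then (q *: k (a1 x)) *: y x.+1 j else 0).
Proof.
move=> hx; rewrite sumWE scaler_sumr; apply: eq_bigr => j _; rewrite scaler_sumr.
under eq_bigr => i _ do
  rewrite scalerA (W_E1 q0 h0 q2 H HA) // scalerBl -[X in X - _]scalerA.
under [RHS]eq_bigr => i _ do rewrite scalerBr.
rewrite !sumrB; congr (_ - _).
have x1 : (x.+1 < m.+1)%N by lia.
have x0 : (x < m.+1)%N by lia.
rewrite (bigD1 (Ordinal x1)) //= eqxx big1 ?addr0 => [|i ne]; last first.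
  by rewrite ifF ?scale0r //; apply: contraNF ne => /eqP E; apply/eqP/val_inj.
rewrite (bigD1 (Ordinal x0)) //= eqxx big1 ?addr0 => [|i ne]; last first.
  by rewrite ifF ?scaler0 //; apply: contraNF ne => /eqP E; apply/eqP/val_inj.
by rewrite scalerA scalerAr.
Qed.

Lemma sumW_F y x : (x < m)%N -> f (a1 x) *: sumW y =
  sumW (fun i j => ((if i == x then q^-1 else if i == x.+1 then q else 1) *: f (a1 x)) *: y i j
    - if i == x.+1 then q^-1 **: y x j else 0).
Proof.
move=> hx; rewrite sumWE scaler_sumr; apply: eq_bigr => j _; rewrite scaler_sumr.
have fx : f (a1 x) = arm_ext m a1 f x by rewrite arm_ext_in.
pose w i := grid_chain q f m a1 a2 0 0 (f beta) i j.
have E i : f (a1 x) * w i =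
  w i * ((if i == x then q^-1 else if i == x.+1 then q else 1) *: f (a1 x)) -
  (if i == x then q^-1 *: w x.+1 else 0).
  rewrite fx (W_F1 q0 h0 q2 H HA); case: eqP => [->|_].
    by rewrite scalerBr scalerAr.
  by case: eqP => _; rewrite subr0 ?scale1r // scalerAr.
under eq_bigr => i _ do rewrite scalerA -/(w i) E scalerBl -[X in X - _]scalerA.
under [RHS]eq_bigr => i _ do rewrite scalerBr.
rewrite !sumrB; congr (_ - _).
have x1 : (x.+1 < m.+1)%N by lia.
have x0 : (x < m.+1)%N by lia.
rewrite (bigD1 (Ordinal x0)) //= eqxx big1 ?addr0 => [|i ne]; last first.
  by rewrite ifF ?scale0r //; apply: contraNF ne => /eqP E'; apply/eqP/val_inj.
rewrite (bigD1 (Ordinal x1)) //= eqxx big1 ?addr0 => [|i ne]; last first.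
  by rewrite ifF ?scaler0 //; apply: contraNF ne => /eqP E'; apply/eqP/val_inj.
by rewrite alg_scale fscaleC.
Qed.

Lemma W_weights a : exists c : nat -> nat -> F, [/\ forall i j, c i j != 0,
  c 0%N 0%N = q ^ (- pairing a beta) & forall i j, k a * grid_chain q f m a1 a2 0 0 (f beta) i j =
    c i j *: (grid_chain q f m a1 a2 0 0 (f beta) i j * k a)].
Proof.
have hk i j : exists c : F, [/\ c != 0,
    (i == 0%N) && (j == 0%N) -> c = q ^ (- pairing a beta) &
    k a * grid_chain q f m a1 a2 0 0 (f beta) i j = c *: (grid_chain q f m a1 a2 0 0 (f beta) i j * k a)].
  case: (boolP ((i == 0%N) && (j == 0%N))) => [/andP[/eqP-> /eqP->]|ne].
    by exists (q ^ (- pairing a beta)); rewrite expfz_neq0 // -(preUq_KF H).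
  have [c c0 hc] := W_K q0 H m a1 a2 a i j; exists c.
  by split=> // h; rewrite h in ne.
pose c i j := sval (cid (hk i j)).
have hc i j : _ := svalP (cid (hk i j)).
exists c; split=> [i j||i j]; first by case: (hc i j).
  by case: (hc 0%N 0%N) => _ h _; exact: h.
by case: (hc i j).
Qed.

Lemma sumW_scomm x c y : (forall i j, x * grid_chain q f m a1 a2 0 0 (f beta) i j =
    c i j *: (grid_chain q f m a1 a2 0 0 (f beta) i j * x)) ->
  x *: sumW y = sumW (fun i j => c i j **: (x *: y i j)).
Proof.
move=> h; rewrite sumWE scaler_sumr; apply: eq_bigr => j _.
rewrite scaler_sumr; apply: eq_bigr => i _.
by rewrite (scale_swap _ (h i j)) fscaleC.
Qed.

Lemma sumW_Ebeta y : (forall i j, e beta *: y i j = 0) ->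
  e beta *: sumW y = (q - q^-1)^-1 **: (k beta *: y 0 0 - sumG q f m a1 a2 y (kv beta) 0 0).
Proof.
move=> hy; rewrite sumWE scaler_sumr.
have E (i j : 'I_m.+1) : e beta *: (grid_chain q f m a1 a2 0 0 (f beta) i j *: y i j) =
  (q - q^-1)^-1 **: ((if (i == ord0) && (j == ord0) then k beta *: y 0 0 else 0) -
     grid_chain q f m a1 a2 0 0 (kv beta) i j *: y i j).
  rewrite scalerA (W_Ebeta H HA) scalerDl -[X in X + _]scalerA hy scaler0 add0r.
  rewrite alg_scale scalerBl; congr (_ **: (_ - _)).
  by rewrite -!val_eqE /=; case: ifP => [/andP[/eqP-> /eqP->]|_] //; rewrite scale0r.
rewrite (eq_bigr (fun j : 'I_m.+1 => (q - q^-1)^-1 **: (\sum_(i < m.+1)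
  (if (i == ord0) && (j == ord0) then k beta *: y 0 0 else 0) -
  \sum_(i < m.+1) grid_chain q f m a1 a2 0 0 (kv beta) i j *: y i j))) => [|j _]; last first.
  by rewrite scaler_sumr (eq_bigr _ (fun i _ => E i j)) -fscale_sumr sumrB.
rewrite -fscale_sumr sumrB; congr (_ **: (_ - _)).
rewrite (bigD1 ord0) //= (bigD1 ord0) //= eqxx big1 ?addr0 => [|i /negPf ->] //.
by rewrite big1 ?addr0 // => j /negPf ne; rewrite big1 // => i _; rewrite ne andbF.
Qed.

End DegreeOneAction.

Section SecondArm.
Context (F : fieldType) (q : F) (q0 : q != 0) (h0 : q - q^-1 != 0) (q2 : q + q^-1 != 0).
Context (A : algType F) (n : nat).
Local Notation root := (simple_root n).
Context (e f k kv : root -> A) (H : isUq q e f k kv) (m : nat).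
Context (N : lmodType A) (a1 a2 : nat -> root) (HA : arms m a1 a2).
Implicit Type y : nat -> nat -> N.

Lemma sumW_sym y : sumW q f m a1 a2 y = sumW q f m a2 a1 (fun i j => y j i).
Proof. exact: (sumG_sym H HA). Qed.

Lemma sumW_E2 y x : (x < m)%N -> e (a2 x) *: sumW q f m a1 a2 y =
  sumW q f m a1 a2 (fun i j => e (a2 x) *: y i j -
    if j == x then (q *: k (a2 x)) *: y i x.+1 else 0).
Proof. by move=> hx; rewrite sumW_sym (sumW_E q0 h0 q2 H (arms_sym HA)) // [RHS]sumW_sym. Qed.

Lemma sumW_F2 y x : (x < m)%N -> f (a2 x) *: sumW q f m a1 a2 y =
  sumW q f m a1 a2 (fun i j =>
    ((if j == x then q^-1 else if j == x.+1 then q else 1) *: f (a2 x)) *: y i j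
    - if j == x.+1 then q^-1 **: y i x else 0).
Proof. by move=> hx; rewrite sumW_sym (sumW_F q0 h0 q2 H (arms_sym HA)) // [RHS]sumW_sym. Qed.

End SecondArm.

Section Concrete.
Context (n : nat).
Local Notation root := (simple_root n).

Definition muN (i : nat) : root := if insub i is Some j then mu j else beta.
Definition nuN (i : nat) : root := if insub i is Some j then nu j else beta.

Lemma muNE (i : 'I_n.-1) : muN i = mu i.
Proof. by rewrite /muN valK. Qed.
Lemma nuNE (i : 'I_n.-1) : nuN i = nu i.
Proof. by rewrite /nuN valK. Qed.

Lemma arms_mu_nu : arms n.-1 muN nuN.
Proof.
have mE i (hi : (i < n.-1)%N) : muN i = mu (Ordinal hi) by rewrite -muNE.
have nE i (hi : (i < n.-1)%N) : nuN i = nu (Ordinal hi) by rewrite -nuNE.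
split=> [i j hi hj|i j hi hj|i j hi hj|i hi|i hi].
- by rewrite !mE pairing_mu -val_eqE.
- by rewrite !nE pairing_nu pairing_mu -val_eqE.
- by rewrite mE nE pairing_mu_nu.
- rewrite mE /pairing /=; have -> : (n.-2 - i == n.-1)%N = false by lia.
  have -> : (n.-2 - i == n.-1.+1)%N = false by lia.
  by have -> : (n.-1 == (n.-2 - i).+1)%N = (i == 0%N) by lia.
- rewrite nE /pairing /=; have -> : (n + i == n.-1)%N = false by lia.
  have -> : (n.-1 == (n + i).+1)%N = false by lia.
  have -> : (n + i == n.-1.+1)%N = (i == 0%N) by lia.
  by rewrite orbF.
Qed.

Context (F : fieldType) (q : F).

Lemma mu_extE k : mu_ext (@qF F q n) k = arm_ext n.-1 muN (@qF F q n) k.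
Proof.
by rewrite /mu_ext /arm_ext /muN; case: insubP => [i -> /=|/negPf ->].
Qed.
Lemma nu_extE k : nu_ext (@qF F q n) k = arm_ext n.-1 nuN (@qF F q n) k.
Proof.
by rewrite /nu_ext /arm_ext /nuN; case: insubP => [i -> /=|/negPf ->].
Qed.

(** [W] runs through the mu arm first and [grid_chain] through the nu arm first, hence the swap. *)
Lemma W_grid_chain i j : W q n i j = grid_chain q (@qF F q n) n.-1 muN nuN 0 0 (qF q beta) i j.
Proof.
rewrite (grid_chain_swap (isUq_Uq q n) arms_mu_nu).
elim: j => [|j IH].
  elim: i => [//|i IH]; rewrite [LHS]/= -[W0 q n i]/(W q n i 0) IH mu_extE //.
by rewrite W_Sr IH nu_extE.
Qed.

End Concrete.

(** * Coordinates of tensors in degree one *)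

Section SpanValues.
Context (R : nzRingType) (L : lmodType R) (D : L -> Prop).
Implicit Types a b : lspan D.
Lemma lspan_inj a b : lspan_val a = lspan_val b -> a = b.
Proof. exact: val_inj. Qed.
Lemma lspan_valD a b : lspan_val (a + b) = lspan_val a + lspan_val b.
Proof. by []. Qed.
Lemma lspan_valZ c a : lspan_val (c *: a) = c *: lspan_val a.
Proof. by []. Qed.
End SpanValues.

Section PureTensors.
Context (F : fieldType) (A V : lmodType F).

Lemma pure_tensDl (a b : A) (v : V) : pure_tens (a + b) v = pure_tens a v + pure_tens b v.
Proof.
rewrite /pure_tens -lquot_piD; apply/lquot_pi_eq; rewrite opprD addrA.
by apply: lin_span_gen; exact: tens_relDl.
Qed.
Lemma pure_tensDr (a : A) (v w : V) : pure_tens a (v + w) = pure_tens a v + pure_tens a w.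
Proof.
rewrite /pure_tens -lquot_piD; apply/lquot_pi_eq; rewrite opprD addrA.
by apply: lin_span_gen; exact: tens_relDr.
Qed.
Lemma pure_tensZl c (a : A) (v : V) : pure_tens (c *: a) v = c *: pure_tens a v.
Proof.
rewrite /pure_tens [RHS]lquot_piZ; apply/lquot_pi_eq.
by apply: lin_span_gen; exact: tens_relZl.
Qed.
Lemma pure_tensZr c (a : A) (v : V) : pure_tens a (c *: v) = c *: pure_tens a v.
Proof.
rewrite /pure_tens [RHS]lquot_piZ; apply/lquot_pi_eq.
by apply: lin_span_gen; exact: tens_relZr.
Qed.
Lemma pure_tens0r (a : A) : pure_tens a (0 : V) = 0.
Proof. by rewrite -(scale0r 0) pure_tensZr scale0r. Qed.

Lemma tens_span (P : tens A V -> Prop) : P 0 -> (forall s t, P s -> P t -> P (s + t)) ->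
  (forall c t, P t -> P (c *: t)) -> (forall a v, P (pure_tens a v)) -> forall t, P t.
Proof.
move=> P0 PD PZ Pp t; rewrite -[t]lquot_reprK.
have pi0 : lquot_pi (@tens_rel F A V) 0 = 0.
  by apply: (addrI (lquot_pi (@tens_rel F A V) 0)); rewrite -lquot_piD !addr0.
rewrite [lquot_repr t]monalgE; elim/big_ind: _ => [|g g' hg hg'|p _].
- by rewrite pi0.
- by rewrite lquot_piD; exact: PD.
have -> : << (lquot_repr t)@_p *g p >> = (lquot_repr t)@_p *: << p >> :> {malg F[(A * V)%type]}.
  by apply/malgP => p'; rewrite mcoeffU [RHS]mcoeffZ [X in _ * X]mcoeffU mulr_natr.
by rewrite -lquot_piZ; apply: PZ; case: p => a v; exact: Pp.
Qed.
End PureTensors.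

Lemma sum_delta (U : nmodType) (I J : finType) (G : I -> J -> U) i0 j0 :
  (forall i j, ~~ ((i == i0) && (j == j0)) -> G i j = 0) -> \sum_j \sum_i G i j = G i0 j0.
Proof.
move=> h; rewrite (bigD1 j0) //= (bigD1 i0) //= big1 ?addr0 => [|i /negPf ne]; last first.
  by rewrite h // ne.
rewrite big1 ?addr0 // => j /negPf ne; rewrite big1 // => i _.
by rewrite h // ne andbF.
Qed.

Section DegreeOneTensors.
Context (F : fieldType) (q : F) (m : nat).
Local Notation n := m.+1.
Local Notation Uq := (Uq q n).
Local Notation Am := (Aminus1 q n).
Context (V : vectType F).

Lemma W_span (i j : 'I_n) : W q n i j \in span_pred (@W_gen F q n).
Proof. by apply/span_predP; apply: lin_span_gen; exists i, j. Qed.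
Definition aW (i j : 'I_n) : Am := LSpan (W_span i j).

Definition Wtens (x : 'I_n -> 'I_n -> V) : tens Am V :=
  \sum_(j < n) \sum_(i < n) pure_tens (aW i j) (x i j).

Lemma WtensD x y : Wtens (fun i j => x i j + y i j) = Wtens x + Wtens y.
Proof.
rewrite /Wtens -big_split; apply: eq_bigr => j _; rewrite -big_split; apply: eq_bigr => i _.
exact: pure_tensDr.
Qed.
Lemma WtensZ c x : Wtens (fun i j => c *: x i j) = c *: Wtens x.
Proof.
rewrite /Wtens scaler_sumr; apply: eq_bigr => j _; rewrite scaler_sumr; apply: eq_bigr => i _.
exact: pure_tensZr.
Qed.
Lemma Wtens0 : Wtens (fun _ _ => 0) = 0.
Proof. by rewrite /Wtens big1 // => j _; rewrite big1 // => i _; exact: pure_tens0r. Qed.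

Lemma tens_decomp (t : tens Am V) : exists x, t = Wtens x.
Proof.
move: t; apply: tens_span.
- by exists (fun _ _ => 0); rewrite Wtens0.
- by move=> s t [x ->] [y ->]; exists (fun i j => x i j + y i j); rewrite WtensD.
- by move=> c t [x ->]; exists (fun i j => c *: x i j); rewrite WtensZ.
(* The underlying element is generalized so that the induction on its membership in the span can
   recurse to other elements of the subtype. *)
move=> a v; have [y E] : exists y : Uq, y = lspan_val a by exists (lspan_val a).
have /span_predP hy := lspan_valP a; rewrite -E in hy.
elim: hy a E => {y} [|_ [i [j ->]]|y z hy IHy hz IHz|c y hy IH] a E.
- exists (fun _ _ => 0); rewrite Wtens0.
  have -> : a = 0 *: a by apply: lspan_inj; rewrite lspan_valZ scale0r -E.
  by rewrite pure_tensZl scale0r.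
- exists (fun k l => if (k == i) && (l == j) then v else 0).
  have -> : a = aW i j by apply: lspan_inj; rewrite -E.
  rewrite /Wtens (sum_delta (i0 := i) (j0 := j)) => [|k l /negPf ->]; last exact: pure_tens0r.
  by rewrite !eqxx.
- have [sy sz] : y \in span_pred (@W_gen F q n) /\ z \in span_pred (@W_gen F q n).
    by split; apply/span_predP.
  have [x hx] := IHy (LSpan sy) (erefl _); have [x' hx'] := IHz (LSpan sz) (erefl _).
  exists (fun i j => x i j + x' i j); rewrite WtensD -hx -hx' -pure_tensDl.
  rewrite (_ : a = LSpan sy + LSpan sz) //; apply: lspan_inj.
  by rewrite lspan_valD -E.
- have sy : y \in span_pred (@W_gen F q n) by apply/span_predP.
  have [x hx] := IH (LSpan sy) (erefl _).
  exists (fun i j => c *: x i j); rewrite WtensZ -hx -pure_tensZl.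
  rewrite (_ : a = c *: LSpan sy) //; apply: lspan_inj.
  by rewrite lspan_valZ -E.
Qed.

Section Inclusion.
Context (rho : Uq -> 'End(V)) (rep : is_rep (@UkAplus F q n) rho).

Lemma verma_genZ c u : verma_gen rho (c *: u) = c **: verma_gen rho u.
Proof.
rewrite /fscale -(repA rep) verma_gen_scale //; exact: subalg_scalar.
Qed.

Lemma degree1_incl_linear c s t :
  degree1_incl rho (c *: s + t) = c **: degree1_incl rho s + degree1_incl rho t.
Proof.
rewrite /degree1_incl tens_lift_is_linear.
- by [].
- by move=> u b x y; exact: restr_scaleDl.
- by move=> x b u u'; rewrite verma_genD verma_genZ; exact: restr_scaleDr.
Qed.
Lemma degree1_inclD s t : degree1_incl rho (s + t) = degree1_incl rho s + degree1_incl rho t.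
Proof. by rewrite -[s in LHS]scale1r degree1_incl_linear fscale1. Qed.
Lemma degree1_incl0 : degree1_incl rho 0 = 0.
Proof. by apply: (addrI (degree1_incl rho 0)); rewrite -degree1_inclD !addr0. Qed.
Lemma degree1_inclZ c s : degree1_incl rho (c *: s) = c **: degree1_incl rho s.
Proof. by rewrite -[c *: s]addr0 degree1_incl_linear degree1_incl0 addr0. Qed.
Lemma degree1_incl_sum (I : Type) (r : seq I) (P : pred I) (g : I -> tens Am V) :
  degree1_incl rho (\sum_(i <- r | P i) g i) = \sum_(i <- r | P i) degree1_incl rho (g i).
Proof. exact: (big_morph _ degree1_inclD degree1_incl0). Qed.

Definition famS (x : nat -> nat -> V) : verma rho :=
  sumW q (@qF F q n) m (@muN n) (@nuN n) (fun i j => verma_gen rho (x i j)).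

Lemma famSE x : famS x = \sum_(j < n) \sum_(i < n) W q n i j *: verma_gen rho (x i j).
Proof.
rewrite /famS sumWE; apply: eq_bigr => j _; apply: eq_bigr => i _.
by rewrite W_grid_chain.
Qed.

Lemma incl_Wtens x : degree1_incl rho (Wtens x) = famS (fun i j => x (inord i) (inord j)).
Proof.
rewrite famSE /Wtens degree1_incl_sum; apply: eq_bigr => j _.
rewrite degree1_incl_sum; apply: eq_bigr => i _.
by rewrite !inord_val; exact (degree1_incl_pure (aW i j) (x i j) rep).
Qed.
End Inclusion.
End DegreeOneTensors.

(** * Dependence on lambda *)

Section GenericPowers.
Context (R : realType) (F : fieldType) (qpow : R[i] -> F) (hq : generic_powers qpow).

Lemma qpow_neq0 x : qpow x != 0.
Proof.
apply/eqP => h; have := qpow0 hq; rewrite -(subrr x) (qpowD hq) h mul0r => /esym/eqP.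
by rewrite oner_eq0.
Qed.
Lemma qpowN x : qpow (- x) = (qpow x)^-1.
Proof.
apply: (mulfI (qpow_neq0 x)); rewrite -(qpowD hq) subrr (qpow0 hq) divff //.
exact: qpow_neq0.
Qed.
Lemma qpowB x y : qpow (x - y) = qpow x / qpow y.
Proof. by rewrite (qpowD hq) qpowN. Qed.
Lemma qpow_inj : injective qpow.
Proof.
move=> x y E; apply/eqP; rewrite -subr_eq0; apply/eqP; apply: (qpow_eq1 hq).
by rewrite qpowB E divff // qpow_neq0.
Qed.
Lemma qpow_nat m : qpow m%:R = qpow 1 ^+ m.
Proof. by elim: m => [|m IH]; rewrite ?(qpow0 hq) // -addn1 natrD (qpowD hq) IH exprD. Qed.

Local Notation q := (qpow 1).
Lemma q_neq0 : q != 0. Proof. exact: qpow_neq0. Qed.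
Lemma q_Nroot (m : nat) : q ^+ m = 1 -> m = 0%N.
Proof.
by rewrite -qpow_nat => /(qpow_eq1 hq) /eqP; rewrite Num.Theory.pnatr_eq0 => /eqP.
Qed.
Lemma q_sub_inv : q - q^-1 != 0.
Proof.
rewrite subr_eq0; apply/eqP => h.
have : q ^+ 2 = 1 by rewrite expr2 {2}h divff ?q_neq0.
by move/q_Nroot.
Qed.
Lemma q_add_inv : q + q^-1 != 0.
Proof.
rewrite addr_eq0; apply/eqP => h.
have E : q ^+ 2 = -1 by rewrite expr2 {2}h mulrN divff ?q_neq0.
have : q ^+ 4 = 1 by rewrite -[4%N]/(2 * 2)%N exprM E expr2 mulrNN mulr1.
by move/q_Nroot.
Qed.

Definition is_qpow (c : F) := exists z, c = qpow z.
Lemma is_qpowM a b : is_qpow a -> is_qpow b -> is_qpow (a * b).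
Proof. by move=> [x ->] [y ->]; exists (x + y); rewrite (qpowD hq). Qed.
Lemma is_qpowV a : is_qpow a -> is_qpow a^-1.
Proof. by move=> [x ->]; exists (- x); rewrite qpowN. Qed.
Lemma is_qpow_q : is_qpow q. Proof. by exists 1. Qed.
Lemma is_qpow_neq0 a : is_qpow a -> a != 0.
Proof. by move=> [x ->]; exact: qpow_neq0. Qed.
Lemma is_qpow_nat m : is_qpow (q ^+ m).
Proof. by exists m%:R; rewrite qpow_nat. Qed.
Lemma is_qpow_int z : is_qpow (q ^ z).
Proof.
by case: z => m; [exact: is_qpow_nat|rewrite NegzE -exprnN; apply: is_qpowV; exact: is_qpow_nat].
Qed.
End GenericPowers.

Section Family.
Context (R : realType) (F : fieldType) (qpow : R[i] -> F) (hq : generic_powers qpow).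
Context (m : nat).
Local Notation n := m.+1.
Local Notation q := (qpow 1).
Local Notation Uq := (Uq q n).
Local Notation root := (simple_root n).
Context (LL LR : m.-tuple nat) (V : vectType F) (rho : R[i] -> Uq -> 'End(V)) (v : V).
Hypothesis hV : @is_V_family R F qpow n LL LR V rho v.
Let q0 := q_neq0 hq.
Let hVL lam : @is_V_Lambda R F qpow n LL LR lam V (rho lam) v := VF_V_Lambda hV lam.

Lemma fam_rep lam : is_rep (@UkAplus F q n) (rho lam).
Proof. exact (VL_rep (hVL lam)). Qed.
Lemma fam_irr lam : irreducible_rep (@Uk F q n) (rho lam).
Proof. exact (VL_irreducible (hVL lam)). Qed.
Lemma fam_Z lam (i j : 'I_n) : rho lam (Z q n i j) = 0.
Proof. exact (VL_Aplus (hVL lam) i j). Qed.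
Lemma fam_v0 : v != 0.
Proof. exact (VL_neq0 (hVL 0)). Qed.
Lemma fam_Ev lam (a : root) : compact_root a -> rho lam (qE q a) v = 0.
Proof.
case: a => [i|//|i] _; [exact (VL_Emu (hVL lam) i)|exact (VL_Enu (hVL lam) i)].
Qed.

Definition hw_weight lam (a : root) : F :=
  match a with mu i => q ^+ tnth LL i | beta => qpow lam | nu i => q ^+ tnth LR i end.
Lemma fam_Kv lam (a : root) : rho lam (qK q a) v = hw_weight lam a *: v.
Proof.
case: a => [i||i]; [exact (VL_Kmu (hVL lam) i)|exact (VL_Kbeta (hVL lam))|].
exact (VL_Knu (hVL lam) i).
Qed.
Lemma hw_weight_qpow lam a : is_qpow qpow (hw_weight lam a).
Proof. by case: a => [i||i]; [exact: is_qpow_nat|exists lam|exact: is_qpow_nat]. Qed.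

Lemma fam_same (g : root -> Uq) lam lam' (a : root) :
  (forall i, kL_gen (g (mu i))) -> (forall i, kR_gen (g (nu i))) ->
  compact_root a -> rho lam (g a) = rho lam' (g a).
Proof.
move=> hL hR; case: a => [i|//|i] _; apply: (VF_same hV).
  by left; apply: subalg_gen; exact: hL.
by right; apply: subalg_gen; exact: hR.
Qed.
Lemma same_E lam lam' (a : root) : compact_root a -> rho lam (qE q a) = rho lam' (qE q a).
Proof. by apply: fam_same => i; exists i; constructor 1. Qed.
Lemma same_F lam lam' (a : root) : compact_root a -> rho lam (qF q a) = rho lam' (qF q a).
Proof. by apply: fam_same => i; exists i; constructor 2. Qed.
Lemma same_K lam lam' (a : root) : compact_root a -> rho lam (qK q a) = rho lam' (qK q a).
Proof. by apply: fam_same => i; exists i; constructor 3. Qed.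

Lemma Fword_span lam (P : V -> Prop) : P 0 -> (forall u w, P u -> P w -> P (u + w)) ->
  (forall c u, P u -> P (c *: u)) ->
  (forall w, all (@compact_root n) w -> P (Fword (rho lam) w v)) -> forall u, P u.
Proof.
move=> P0 PD PZ Pw u.
have [D [y [hy ->]]] := Gr_decomp q0 (fam_rep lam) (fam_irr lam) fam_v0 (@fam_Ev lam) (fam_Kv lam) u.
elim/big_ind: _ => // d _; elim: (hy d) => [//|_ [w [cw _ ->]]|x z _ Px _ Pz|c x _ Px]; [exact: Pw|exact: PD|exact: PZ].
Qed.

Lemma Fword_same lam lam' w : all (@compact_root n) w ->
  Fword (rho lam) w v = Fword (rho lam') w v.
Proof. by elim: w => [//|a w IH] /= /andP[ha /IH ->]; rewrite (same_F lam lam' ha). Qed.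

(** On the vector of an F-word K_beta has eigenvalue q^lambda times a power of q given by the word
    alone, and these vectors span V and do not depend on lambda. *)
Lemma fam_Kbeta lam lam' u :
  rho lam' (qK q beta) u = qpow (lam' - lam) *: rho lam (qK q beta) u.
Proof.
move: u; apply: (@Fword_span lam).
- by rewrite !linear0.
- by move=> u w hu hw; rewrite linearD /= hu hw -scalerDr -linearD.
- by move=> c u hu; rewrite linearZ /= hu [in RHS]linearZ /= !scalerA mulrC.
move=> w cw; rewrite (K_Fword q0 (fam_rep lam) (fam_Kv lam) _ cw) {1}(Fword_same lam lam' cw).
rewrite (K_Fword q0 (fam_rep lam') (fam_Kv lam') _ cw) (Fword_same lam' lam cw).
by rewrite scalerA /= mulrA (qpowB hq) mulfVK // qpow_neq0.
Qed.

Lemma fam_KVbeta lam lam' u :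
  rho lam' (qKV q beta) u = qpow (lam - lam') *: rho lam (qKV q beta) u.
Proof.
have h x := fam_Kbeta lam lam' x.
rewrite -[in RHS](rep_KKV (fam_rep lam') beta u) h linearZ /= scalerA -(qpowD hq).
by rewrite addrA subrK subrr (qpow0 hq) scale1r (rep_KVK (fam_rep lam)).
Qed.

Lemma fam_vs lam : exists vs : V -> F, [/\ linear (vs : V -> F^o), vs v = 1,
  forall a u, compact_root a -> vs (rho lam (qF q a) u) = 0 &
  forall a u, vs (rho lam (qK q a) u) = hw_weight lam a * vs u].
Proof.
exact (vacuum_functional q0 (q_Nroot hq) (fam_rep lam) (fam_irr lam) fam_v0 (@fam_Ev lam) (fam_Kv lam)).
Qed.

Lemma fam_gen_inj lam u : verma_gen (rho lam) u = 0 -> u = 0.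
Proof.
have [vs [vl vv vF vK]] := fam_vs lam => h.
exact (verma_gen_inj q0 (fam_rep lam) (fam_irr lam) (fam_Z lam) fam_v0 (fam_Kv lam) vl vv vF vK h).
Qed.

Lemma fam_line lam u : (forall a, compact_root a -> rho lam (qE q a) u = 0) -> exists c, u = c *: v.
Proof.
have [vs [vl vv vF vK]] := fam_vs lam => h; exists (vs u).
exact (killed_line q0 (fam_rep lam) (fam_irr lam) fam_v0 (@fam_Ev lam) (fam_Kv lam) vl vv vF vK h).
Qed.

Local Notation gen lam := (verma_gen (rho lam)).

Lemma gen_act lam x u : Uk x -> x *: gen lam u = gen lam (rho lam x u).
Proof. by move=> hx; rewrite (verma_gen_scale (rho lam) u (UkAplus_Uk hx)). Qed.
Lemma gen0 lam : gen lam 0 = 0.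
Proof. by apply: (addrI (gen lam 0)); rewrite -verma_genD !addr0. Qed.
Lemma genB lam u w : gen lam (u - w) = gen lam u - gen lam w.
Proof. by apply: (addIr (gen lam w)); rewrite -verma_genD !subrK. Qed.
Lemma genZ lam c u : gen lam (c *: u) = c **: gen lam u.
Proof. exact (verma_genZ (fam_rep lam) c u). Qed.
Lemma fam_gen_eq lam u w : gen lam u = gen lam w -> u = w.
Proof. by move=> h; apply/eqP; rewrite -subr_eq0; apply/eqP/(@fam_gen_inj lam); rewrite genB h subrr. Qed.

Lemma gen_Ebeta lam u : qE q beta *: gen lam u = 0.
Proof.
have hZ : UkAplus (Z q n 0 0).
  by apply: subalg_gen; right; apply: subalg_gen; exists ord0, ord0.
have := verma_gen_scale (rho lam) u hZ.
by rewrite (fam_Z lam ord0 ord0) zero_lfunE gen0 => /esym.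
Qed.

(** [degree1_indep] with N the Verma module at [lam - 1]: there K_beta is smaller by a factor q,
    which the vacuum restores. *)
Lemma famS_inj lam x : famS (rho lam) x = 0 -> forall i j, (i <= m)%N -> (j <= m)%N -> x i j = 0.
Proof.
rewrite famSE exchange_big => h i j hi hj.
have Kb : rho lam (qK q beta) = q *: rho (lam - 1) (qK q beta).
  apply/lfunP => u; rewrite scale_lfunE (fam_Kbeta (lam - 1) lam) opprB addrA addrC.
  by rewrite addrA addNr add0r.
have nz : exists y : verma (rho (lam - 1)), y != 0.
  exists (gen (lam - 1) v); apply/eqP => /fam_gen_inj v0; have := fam_v0.
  by rewrite v0 eqxx.
have := @degree1_indep F q q0 (q_sub_inv hq) n (verma (rho (lam - 1))) nz V (rho lam)
  (rho (lam - 1)) (fam_rep lam) (fam_rep (lam - 1)) (fam_Z lam) (same_E lam (lam - 1))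
  (same_F lam (lam - 1)) (same_K lam (lam - 1)) Kb (gen (lam - 1)) (verma_genD (rho (lam - 1)))
  (fun x u h => verma_gen_scale (rho (lam - 1)) u h) (gen_Ebeta (lam - 1))
  (@fam_gen_inj (lam - 1)) (ltn0Sn m) (fun i j => x i j) h.
by move=> /(_ (inord i) (inord j)); rewrite !inordK.
Qed.

Lemma famSB lam x y : famS (rho lam) (fun i j => x i j - y i j) = famS (rho lam) x - famS (rho lam) y.
Proof.
rewrite !famSE -sumrB; apply: eq_bigr => j _; rewrite -sumrB; apply: eq_bigr => i _.
by rewrite genB scalerBr.
Qed.
Lemma famSZ lam c x : famS (rho lam) (fun i j => c *: x i j) = c **: famS (rho lam) x.
Proof.
rewrite !famSE fscale_sumr; apply: eq_bigr => j _; rewrite fscale_sumr; apply: eq_bigr => i _.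
by rewrite genZ fscaleC.
Qed.
Lemma famS_eq lam x y : famS (rho lam) x = famS (rho lam) y ->
  forall i j, (i <= m)%N -> (j <= m)%N -> x i j = y i j.
Proof.
move=> h i j hi hj; apply/eqP; rewrite -subr_eq0; apply/eqP.
have E := famSB lam x y; rewrite h subrr in E.
exact (famS_inj E hi hj).
Qed.
Lemma eq_famS lam x y : (forall i j, (i <= m)%N -> (j <= m)%N -> x i j = y i j) ->
  famS (rho lam) x = famS (rho lam) y.
Proof. by move=> h; apply: eq_sumW => i j hi hj; rewrite h. Qed.

End Family.

Section Coordinates.
Context (R : realType) (F : fieldType) (qpow : R[i] -> F) (hq : generic_powers qpow).
Context (m : nat).
Local Notation n := m.+1.
Local Notation q := (qpow 1).
Local Notation Uq := (Uq q n).
Local Notation root := (simple_root n).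
Context (LL LR : m.-tuple nat) (V : vectType F) (rho : R[i] -> Uq -> 'End(V)) (v : V).
Hypothesis hV : @is_V_family R F qpow n LL LR V rho v.
Let q0 := q_neq0 hq.
Let h0 := q_sub_inv hq.
Let q2 := q_add_inv hq.
Local Notation gen lam := (verma_gen (rho lam)).
Local Notation H := (isUq_Uq q n).
Implicit Type x : nat -> nat -> V.

Lemma muN_compact k : (k < m)%N -> compact_root (muN n k).
Proof. by move=> hk; rewrite (muNE (n := n) (Ordinal hk)). Qed.
Lemma nuN_compact k : (k < m)%N -> compact_root (nuN n k).
Proof. by move=> hk; rewrite (nuNE (n := n) (Ordinal hk)). Qed.

Lemma gen_if lam (b : bool) u : gen lam (if b then u else 0) = if b then gen lam u else 0.
Proof. by case: b => //; exact (gen0 rho lam). Qed.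
Lemma gen_E lam (a : root) u : compact_root a -> gen lam (rho 0 (qE q a) u) = qE q a *: gen lam u.
Proof. by move=> ha; rewrite (same_E hV 0 lam ha) (gen_act rho lam u (Uk_qE q ha)). Qed.
Lemma gen_F lam (a : root) u : compact_root a -> gen lam (rho 0 (qF q a) u) = qF q a *: gen lam u.
Proof. by move=> ha; rewrite (same_F hV 0 lam ha) (gen_act rho lam u (Uk_qF q ha)). Qed.
Lemma gen_K lam (a : root) u : compact_root a -> gen lam (rho 0 (qK q a) u) = qK q a *: gen lam u.
Proof. by move=> ha; rewrite (same_K hV 0 lam ha) (gen_act rho lam u (Uk_qK q a)). Qed.

(** The index 0 in [rho 0] is arbitrary: the E's, F's and K's of k_L and k_R act independently of
    lambda, so the same operators on coordinates serve every lambda. *)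
Definition opE1 k x i j : V := rho 0 (qE q (muN n k)) (x i j) -
  if i == k then q *: rho 0 (qK q (muN n k)) (x k.+1 j) else 0.
Definition opE2 k x i j : V := rho 0 (qE q (nuN n k)) (x i j) -
  if j == k then q *: rho 0 (qK q (nuN n k)) (x i k.+1) else 0.
Definition opF1 k x i j : V :=
  (if i == k then q^-1 else if i == k.+1 then q else 1) *: rho 0 (qF q (muN n k)) (x i j) -
  if i == k.+1 then q^-1 *: x k j else 0.
Definition opF2 k x i j : V :=
  (if j == k then q^-1 else if j == k.+1 then q else 1) *: rho 0 (qF q (nuN n k)) (x i j) -
  if j == k.+1 then q^-1 *: x i k else 0.

Lemma famS_E1 lam x k : (k < m)%N ->
  qE q (muN n k) *: famS (rho lam) x = famS (rho lam) (opE1 k x).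
Proof.
move=> hk; have hc := muN_compact hk.
refine (eq_trans (sumW_E q0 h0 q2 H (arms_mu_nu n) (fun i j => gen lam (x i j)) hk) _).
apply: eq_sumW => i j _ _.
rewrite /opE1 (genB rho) gen_if (gen_E _ _ hc) (genZ hV) (gen_K _ _ hc).
by rewrite alg_scale.
Qed.
Lemma famS_E2 lam x k : (k < m)%N ->
  qE q (nuN n k) *: famS (rho lam) x = famS (rho lam) (opE2 k x).
Proof.
move=> hk; have hc := nuN_compact hk.
refine (eq_trans (sumW_E2 q0 h0 q2 H (arms_mu_nu n) (fun i j => gen lam (x i j)) hk) _).
apply: eq_sumW => i j _ _.
rewrite /opE2 (genB rho) gen_if (gen_E _ _ hc) (genZ hV) (gen_K _ _ hc).
by rewrite alg_scale.
Qed.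
Lemma famS_F1 lam x k : (k < m)%N ->
  qF q (muN n k) *: famS (rho lam) x = famS (rho lam) (opF1 k x).
Proof.
move=> hk; have hc := muN_compact hk.
refine (eq_trans (sumW_F q0 h0 q2 H (arms_mu_nu n) (fun i j => gen lam (x i j)) hk) _).
apply: eq_sumW => i j _ _.
rewrite /opF1 (genB rho) gen_if !(genZ hV) (gen_F _ _ hc).
by rewrite alg_scale.
Qed.
Lemma famS_F2 lam x k : (k < m)%N ->
  qF q (nuN n k) *: famS (rho lam) x = famS (rho lam) (opF2 k x).
Proof.
move=> hk; have hc := nuN_compact hk.
refine (eq_trans (sumW_F2 q0 h0 q2 H (arms_mu_nu n) (fun i j => gen lam (x i j)) hk) _).
apply: eq_sumW => i j _ _.
rewrite /opF2 (genB rho) gen_if !(genZ hV) (gen_F _ _ hc).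
by rewrite alg_scale.
Qed.

Lemma famS_K (a : root) : exists c : nat -> nat -> F, [/\ forall i j, c i j != 0,
  c 0%N 0%N = q ^ (- pairing a beta) & forall lam x,
  qK q a *: famS (rho lam) x = famS (rho lam) (fun i j => c i j *: rho lam (qK q a) (x i j))].
Proof.
have [c [c0 c00 hc]] := W_weights q0 H m (muN n) (nuN n) a.
exists c; split=> // lam x.
refine (eq_trans (sumW_scomm (fun i j => gen lam (x i j)) hc) _); apply: eq_sumW => i j _ _.
by rewrite (genZ hV) (gen_act rho lam _ (Uk_qK q a)).
Qed.
End Coordinates.

(** The coordinates are chosen from [t] before [rho], so one family describes the image of [t] in
    M(V) for all lambda. *)
Lemma tens_coords (F : fieldType) (q : F) (m : nat) (V : vectType F)
    (t : tens (Aminus1 q m.+1) V) : exists x : nat -> nat -> V,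
  [/\ forall i j, (m < i)%N -> x i j = 0, forall i j, (m < j)%N -> x i j = 0,
    forall rho : Uq q m.+1 -> 'End(V), is_rep (@UkAplus F q m.+1) rho ->
      degree1_incl rho t = famS rho x &
    (forall i j, x i j = 0) -> t = 0].
Proof.
have [y hy] := tens_decomp t.
exists (fun i j => if (i <= m)%N && (j <= m)%N then y (inord i) (inord j) else 0); split.
- by move=> i j; rewrite ltnNge => /negPf ->.
- by move=> i j; rewrite ltnNge andbC => /negPf ->.
- move=> rho hr; rewrite hy (incl_Wtens hr); apply: eq_sumW => i j hi hj.
  by rewrite hi hj.
- move=> h; rewrite hy -(Wtens0 q m V); congr Wtens.
  apply/funext => i; apply/funext => j; have := h i j.
  by rewrite -ltnS (ltn_ord i) -ltnS (ltn_ord j) !inord_val.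
Qed.

Lemma subalgZ (F : fieldType) (A : lalgType F) (D : A -> Prop) c x :
  subalg D x -> subalg D (c *: x).
Proof. by move=> h; rewrite -mulr_algl; exact: subalgM (subalg_scalar D c) h. Qed.

Section ChainClosed.
Context (F : fieldType) (q : F) (A : algType F) (n : nat) (f : simple_root n -> A) (m : nat).

Lemma grid_chain_closed (P : A -> Prop) a1 a2 g :
  (forall x l, P x -> P (x * arm_ext m a1 f l - q *: (arm_ext m a1 f l * x))) ->
  (forall x l, P x -> P (x * arm_ext m a2 f l - q *: (arm_ext m a2 f l * x))) ->
  P g -> forall i j, P (grid_chain q f m a1 a2 0 0 g i j).
Proof.
move=> h1 h2 hg i j; rewrite /grid_chain.
have hP : P (arm_chain q f m a2 0 g j) by elim: j => [//|j IH]; rewrite arm_chainS; exact: h2.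
by elim: i => [//|i IH]; rewrite arm_chainS; exact: h1.
Qed.
End ChainClosed.

Section HighestVector.
Context (R : realType) (F : fieldType) (qpow : R[i] -> F) (hq : generic_powers qpow).
Context (m : nat).
Local Notation n := m.+1.
Local Notation q := (qpow 1).
Local Notation Uq := (Uq q n).
Local Notation root := (simple_root n).
Context (LL LR : m.-tuple nat) (V : vectType F) (rho : R[i] -> Uq -> 'End(V)) (v : V).
Hypothesis hV : @is_V_family R F qpow n LL LR V rho v.
Let q0 := q_neq0 hq.
Let h0 := q_sub_inv hq.
Let q2 := q_add_inv hq.
Local Notation gen lam := (verma_gen (rho lam)).
Local Notation H := (isUq_Uq q n).
Local Notation mu_ k := (muN n k).
Local Notation nu_ k := (nuN n k).
Context (T : nat -> nat -> V).
Hypothesis T_out1 : forall i j, (m < i)%N -> T i j = 0.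
Hypothesis T_out2 : forall i j, (m < j)%N -> T i j = 0.
Hypothesis T_E : forall lam (a : root), compact_root a -> qE q a *: famS (rho lam) T = 0.

Lemma gen_out1 lam i j : (m < i)%N -> gen lam (T i j) = 0.
Proof. by move=> hi; rewrite (T_out1 _ hi) (gen0 rho). Qed.
Lemma gen_out2 lam i j : (m < j)%N -> gen lam (T i j) = 0.
Proof. by move=> hj; rewrite (T_out2 _ hj) (gen0 rho). Qed.

Lemma gen_E1 lam k i j : (k < m)%N -> qE q (mu_ k) *: gen lam (T i j) =
  if i == k then (q *: qK q (mu_ k)) *: gen lam (T k.+1 j) else 0.
Proof.
move=> hk; have hc := muN_compact hk.
have E : opE1 rho k T i j = 0.
  case: (leqP i m) => hi; last first.
    rewrite /opE1 (T_out1 _ hi) linear0; have -> : (i == k) = false by lia.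
    by rewrite subr0.
  case: (leqP j m) => hj; last first.
    by rewrite /opE1 !(T_out2 _ hj) !linear0 if_same subr0.
  have Z : famS (rho lam) (opE1 rho k T) = 0.
    by rewrite -(famS_E1 hq hV lam T hk); exact: T_E.
  exact (famS_inj hq hV Z hi hj).
have := congr1 (gen lam) E; rewrite (gen0 rho) /opE1 (genB rho) (gen_if rho).
rewrite (gen_E hV _ _ hc) (genZ hV) (gen_K hV _ _ hc) => /eqP; rewrite subr_eq0 => /eqP ->.
by rewrite alg_scale.
Qed.

Lemma gen_E2 lam k i j : (k < m)%N -> qE q (nu_ k) *: gen lam (T i j) =
  if j == k then (q *: qK q (nu_ k)) *: gen lam (T i k.+1) else 0.
Proof.
move=> hk; have hc := nuN_compact hk.
have E : opE2 rho k T i j = 0.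
  case: (leqP j m) => hj; last first.
    rewrite /opE2 (T_out2 _ hj) linear0; have -> : (j == k) = false by lia.
    by rewrite subr0.
  case: (leqP i m) => hi; last first.
    by rewrite /opE2 !(T_out1 _ hi) !linear0 if_same subr0.
  have Z : famS (rho lam) (opE2 rho k T) = 0.
    by rewrite -(famS_E2 hq hV lam T hk); exact: T_E.
  exact (famS_inj hq hV Z hi hj).
have := congr1 (gen lam) E; rewrite (gen0 rho) /opE2 (genB rho) (gen_if rho).
rewrite (gen_E hV _ _ hc) (genZ hV) (gen_K hV _ _ hc) => /eqP; rewrite subr_eq0 => /eqP ->.
by rewrite alg_scale.
Qed.

Lemma scaleK_eq0 lam (a : root) u : (q *: qK q a) *: gen lam u = 0 -> u = 0.
Proof.
rewrite alg_scale => h; apply: (fam_gen_inj hq hV (lam := lam)).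
rewrite -(scale1r (gen lam u)) -(preUq_KVK (isUq_pre H) a) -scalerA.
have -> : qK q a *: gen lam u = 0.
  rewrite -[LHS]fscale1 -(mulVf q0) -fscaleA h fscale0r; reflexivity.
by rewrite scaler0.
Qed.

(** E T_k = q K T_(k+1) along either arm, and K is invertible, so T_(k+1) vanishes as soon as T_k
    does. *)
Lemma T00_neq0 : (exists i j, T i j != 0) -> T 0%N 0%N != 0.
Proof.
move=> [i [j Tij]]; apply: contraNneq Tij => T0; apply/eqP.
have step1 k l : T k l = 0 -> T k.+1 l = 0.
  move=> h; case: (ltnP k m) => hk; last by rewrite T_out1.
  apply: (@scaleK_eq0 0 (mu_ k)).
  by have := gen_E1 0 k l hk; rewrite eqxx h (gen0 rho) scaler0 => <-.
have step2 k l : T k l = 0 -> T k l.+1 = 0.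
  move=> h; case: (ltnP l m) => hl; last by rewrite T_out2.
  apply: (@scaleK_eq0 0 (nu_ l)).
  by have := gen_E2 0 k l hl; rewrite eqxx h (gen0 rho) scaler0 => <-.
elim: j => [|j IH]; last exact: step2.
by elim: i => [//|i IH]; exact: step1.
Qed.

Lemma mu_case k : (k < m)%N -> exists i, mu_ k = mu i.
Proof. by move=> hk; exists (Ordinal hk : 'I_n.-1); rewrite -muNE. Qed.
Lemma nu_case k : (k < m)%N -> exists i, nu_ k = nu i.
Proof. by move=> hk; exists (Ordinal hk : 'I_n.-1); rewrite -nuNE. Qed.
Lemma compact_case (a : root) : compact_root a ->
  exists k, (k < m)%N /\ (a = mu_ k \/ a = nu_ k).
Proof.
case: a => [i|//|i] _; exists i; split; rewrite ?ltn_ord //.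
  by left; rewrite muNE.
by right; rewrite nuNE.
Qed.

Definition Gbeta i j : Uq := grid_chain q (@qF F q n) m (@muN n) (@nuN n) 0 0 (qKV q beta) i j.

Lemma ext_Uk (arm : nat -> root) l : (forall k, (k < m)%N -> compact_root (arm k)) ->
  Uk (arm_ext m arm (@qF F q n) l).
Proof.
move=> h; rewrite /arm_ext; case: ifP => hl; last by rewrite -(scale0r 1); exact: subalg_scalar.
exact (Uk_qF q (h _ hl)).
Qed.
Lemma ext_same (arm : nat -> root) l lam lam' u : (forall k, (k < m)%N -> compact_root (arm k)) ->
  rho lam (arm_ext m arm (@qF F q n) l) u = rho lam' (arm_ext m arm (@qF F q n) l) u.
Proof.
move=> h; rewrite /arm_ext; case: ifP => hl; first by rewrite (same_F hV lam lam' (h _ hl)).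
by rewrite -(scale0r 1) !(repA (fam_rep hV _)).
Qed.

Lemma scale_closed lam lam' c (x y : Uq) : Uk x ->
  (forall u, rho lam' x u = c *: rho lam x u) -> Uk y ->
  (forall u, rho lam' y u = rho lam y u) ->
  Uk (x * y - q *: (y * x)) /\ forall u,
    rho lam' (x * y - q *: (y * x)) u = c *: rho lam (x * y - q *: (y * x)) u.
Proof.
move=> Ux hx Uy hy.
have Uxy : Uk (x * y) by exact (subalgM Ux Uy).
have Uyx : Uk (y * x) by exact (subalgM Uy Ux).
have Uz : Uk ((- q) *: (y * x)) by exact (subalgZ (- q) Uyx).
rewrite -scaleNr; split; first exact (subalgD Uxy Uz).
have e l u : rho l (x * y + (- q) *: (y * x)) u =
    rho l x (rho l y u) - q *: rho l y (rho l x u).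
  rewrite (repD (fam_rep hV l) u (UkAplus_Uk Uxy) (UkAplus_Uk Uz)).
  rewrite (repM (fam_rep hV l) u (UkAplus_Uk Ux) (UkAplus_Uk Uy)).
  rewrite (repZ (fam_rep hV l) _ u (UkAplus_Uk Uyx)).
  by rewrite (repM (fam_rep hV l) u (UkAplus_Uk Uy) (UkAplus_Uk Ux)) scaleNr.
move=> u; rewrite !e !hx !hy.
have -> : rho lam y (c *: rho lam x u) = c *: rho lam y (rho lam x u) by exact: linearZ.
rewrite scalerBr !scalerA.
by rewrite (mulrC q c).
Qed.

(** G_ij is linear in K_beta^-1, the only factor whose action depends on lambda. *)
Lemma Gbeta_scale lam lam' i j : Uk (Gbeta i j) /\
  forall u, rho lam' (Gbeta i j) u = qpow (lam - lam') *: rho lam (Gbeta i j) u.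
Proof.
apply: (grid_chain_closed (P := fun x : Uq => Uk x /\
  forall u, rho lam' x u = qpow (lam - lam') *: rho lam x u)); last first.
- split; first exact (Uk_qKV q beta).
  exact (fam_KVbeta hq hV lam lam').
all: move=> x l [Ux hx].
  exact (scale_closed Ux hx (ext_Uk l (@nuN_compact m))
    (fun u => ext_same l lam' lam u (@nuN_compact m))).
exact (scale_closed Ux hx (ext_Uk l (@muN_compact m))
  (fun u => ext_same l lam' lam u (@muN_compact m))).
Qed.

Definition Qvec lam : V := \sum_(j < n) \sum_(i < n) rho lam (Gbeta i j) (T i j).

Lemma Qvec_scale lam lam' : Qvec lam' = qpow (lam - lam') *: Qvec lam.
Proof.
rewrite /Qvec scaler_sumr; apply: eq_bigr => j _; rewrite scaler_sumr; apply: eq_bigr => i _.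
by have [_ ->] := Gbeta_scale lam lam' i j.
Qed.

Lemma gen_sum lam (I : Type) (r : seq I) (P : pred I) (g : I -> V) :
  gen lam (\sum_(i <- r | P i) g i) = \sum_(i <- r | P i) gen lam (g i).
Proof. exact (big_morph _ (verma_genD (rho lam)) (gen0 rho lam) r P g). Qed.

Lemma gen_Qvec lam : sumG q (@qF F q n) m (@muN n) (@nuN n) (fun i j => gen lam (T i j))
  (qKV q beta) 0 0 = gen lam (Qvec lam).
Proof.
rewrite /Qvec /sumG gen_sum; apply: eq_bigr => j _; rewrite gen_sum; apply: eq_bigr => i _.
have [U _] := Gbeta_scale lam lam i j.
rewrite !add0n; exact (gen_act rho lam (T i j) U).
Qed.

Lemma Ebeta_famS lam : qE q beta *: famS (rho lam) T =
  (q - q^-1)^-1 **: gen lam (rho lam (qK q beta) (T 0%N 0%N) - Qvec lam).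
Proof.
rewrite (genB rho) -gen_Qvec -(gen_act rho lam _ (Uk_qK q beta)).
exact (sumW_Ebeta H (arms_mu_nu n) (fun i j => gen_Ebeta hV lam (T i j))).
Qed.

Context (L1 : R[i] -> root -> F).
Hypothesis L1_qpow : forall lam a, is_qpow qpow (L1 lam a).
Hypothesis T_K : forall lam (a : root),
  qK q a *: famS (rho lam) T = L1 lam a **: famS (rho lam) T.
Hypothesis T00 : T 0%N 0%N != 0.

(** T_00 is the coefficient of W_00, so its weight is that of psi(v1) divided by that of W_00, a
    quotient of powers of q. *)
Lemma T00_K lam (a : root) : exists2 c, is_qpow qpow c &
  rho lam (qK q a) (T 0%N 0%N) = c *: T 0%N 0%N.
Proof.
have [c [c0 c00 hc]] := famS_K hq hV a.
have E : famS (rho lam) (fun i j => c i j *: rho lam (qK q a) (T i j)) =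
         famS (rho lam) (fun i j => L1 lam a *: T i j).
  by rewrite -hc (famSZ hV) T_K.
have := famS_eq hq hV E (leq0n m) (leq0n m); rewrite c00 => e.
exists ((q ^ (- pairing a beta))^-1 * L1 lam a).
  exact (is_qpowM hq (is_qpowV hq (is_qpow_int hq _)) (L1_qpow lam a)).
have nz : q ^ (- pairing a beta) != 0 by exact (expfz_neq0 _ q0).
by rewrite -scalerA -e scalerA (mulVf nz) scale1r.
Qed.

Lemma Kprod_gen lam s : kprod (@qK F q n) s *: gen lam v =
  (\prod_(a <- s) hw_weight qpow LL LR lam a) **: gen lam v.
Proof.
rewrite -(genZ hV) -(Kprod_v (fam_rep hV lam) (fam_Kv hV lam) s).
by rewrite -(gen_act rho lam _ (Uk_Kprod q s)).
Qed.

Lemma weight_prod_neq0 lam s : \prod_(a <- s) hw_weight qpow LL LR lam a != 0.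
Proof.
elim/big_ind: _ => [|x y x0 y0|a _]; rewrite ?oner_neq0 ?mulf_neq0 //.
exact (is_qpow_neq0 hq (hw_weight_qpow hq LL LR lam a)).
Qed.

Lemma Qvec_proportional lam : exists2 c, is_qpow qpow c & Qvec lam = c *: T 0%N 0%N.
Proof.
pose im (y : verma (rho lam)) := exists u, y = gen lam u.
have tk (a : root) : exists2 c, is_qpow qpow c &
    qK q a *: gen lam (T 0%N 0%N) = c **: gen lam (T 0%N 0%N).
  have [c hc e] := T00_K lam a; exists c; first exact hc.
  by rewrite (gen_act rho lam _ (Uk_qK q a)) e (genZ hV).
have w0 : gen lam v != 0.
  by apply/eqP => /(fam_gen_inj hq hV) v0; have := fam_v0 hV; rewrite v0 eqxx.
have im_E (a : root) y : compact_root a -> im y -> im (qE q a *: y).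
  by move=> ha [u ->]; exists (rho lam (qE q a) u); rewrite (gen_act rho lam _ (Uk_qE q ha)).
have imE1 l y : (l < m)%N -> im y -> im (qE q (mu_ l) *: y).
  by move=> hl; apply: im_E; exact: muN_compact.
have imE2 l y : (l < m)%N -> im y -> im (qE q (nu_ l) *: y).
  by move=> hl; apply: im_E; exact: nuN_compact.
have imB c x y : im x -> im y -> im (x - c **: y).
  by move=> [u ->] [u' ->]; exists (u - c *: u'); rewrite (genB rho) (genZ hV).
have line y : im y -> (forall l, (l < m)%N ->
    qE q (mu_ l) *: y = 0 /\ qE q (nu_ l) *: y = 0) -> exists c, y = c **: gen lam v.
  move=> [u ->] hu.
  have [a ha|c ->] := fam_line hq hV (lam := lam) (u := u); last first.
    by exists c; rewrite (genZ hV).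
  apply: (fam_gen_inj hq hV (lam := lam)); rewrite -(gen_act rho lam _ (Uk_qE q ha)).
  case: (compact_case ha) => l [hl [->|->]]; [exact (proj1 (hu l hl))|exact (proj2 (hu l hl))].
have s11 l : (l < m)%N -> \sum_(a <- mu_rho n) pairing a (mu_ l) = 2.
  by move=> hl; have [i ->] := mu_case hl; exact: mu_rho_mu.
have s12 l : (l < m)%N -> \sum_(a <- mu_rho n) pairing a (nu_ l) = 0.
  by move=> hl; have [i ->] := nu_case hl; exact: mu_rho_nu.
have s21 l : (l < m)%N -> \sum_(a <- nu_rho n) pairing a (mu_ l) = 0.
  by move=> hl; have [i ->] := mu_case hl; exact: nu_rho_mu.
have s22 l : (l < m)%N -> \sum_(a <- nu_rho n) pairing a (nu_ l) = 2.
  by move=> hl; have [i ->] := nu_case hl; exact: nu_rho_nu.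
have Hs0 : kvprod (@qKV F q n) (@muN n) (@nuN n) 0 0 = qKV q beta.
  by rewrite /kvprod !big_geq // !mulr1.
have imT : im (gen lam (T 0%N 0%N)) by exists (T 0%N 0%N).
have imQ : im (sumG q (@qF F q n) m (@muN n) (@nuN n) (fun i j => gen lam (T i j))
    (kvprod (@qKV F q n) (@muN n) (@nuN n) 0 0) 0 0).
  by rewrite Hs0; exists (Qvec lam); exact: gen_Qvec.
have t0 : gen lam (T 0%N 0%N) != 0.
  by apply/eqP => /(fam_gen_inj hq hV) Z; move: T00; rewrite Z eqxx.
have [c Pc] := sumG_proportional q0 h0 q2 (q_Nroot hq) H (arms_mu_nu n)
  (t := fun i j => gen lam (T i j)) (@gen_out1 lam) (@gen_out2 lam)
  (fun k i j hk => gen_E1 lam i j hk) (fun k i j hk => gen_E2 lam i j hk)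
  (is_qpowM hq) (is_qpowV hq) (is_qpow_q qpow) (is_qpow_neq0 hq) tk
  w0 imE1 imE2 imB line (weight_prod_neq0 lam (mu_rho n)) (weight_prod_neq0 lam (nu_rho n))
  s11 s12 s21 s22 (Kprod_gen lam (mu_rho n)) (Kprod_gen lam (nu_rho n)) imT imQ t0.
rewrite Hs0 gen_Qvec -(genZ hV) => e; exists c; first exact Pc.
exact (fam_gen_eq hq hV e).
Qed.

Lemma Ebeta_eq0 (lam0 : R[i]) : exists z : R[i], forall lam,
  qE q beta *: famS (rho lam) T = 0 <-> lam = z.
Proof.
have [_ [a ->] hK] := T00_K lam0 beta; have [_ [b ->] hQ] := Qvec_proportional lam0.
(* At [lam0], K_beta T_00 = q^a T_00 and Q = q^b T_00. At [lam] the exponents are lam - lam0 + a and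
   lam0 - lam + b; this is where they agree. *)
exists (lam0 + (b - a) / 2%:R) => lam.
rewrite Ebeta_famS (fam_Kbeta hq hV lam0 lam) hK (Qvec_scale lam0 lam) hQ !scalerA.
rewrite -!(qpowD hq) -scalerBl.
have hh : (q - q^-1)^-1 != 0 by rewrite invr_eq0.
have two : (2%:R : R[i]) != 0 by rewrite Num.Theory.pnatr_eq0.
have E : (lam - lam0 + a = lam0 - lam + b) <-> lam = lam0 + (b - a) / 2%:R.
  split=> [e|->]; last by field.
  apply: (mulfI two); apply/eqP; rewrite -subr_eq0; apply/eqP.
  have {}e : (lam - lam0 + a) - (lam0 - lam + b) = 0 by rewrite e subrr.
  by rewrite -[RHS]e; field.
rewrite -E; split=> [h|->]; last by rewrite subrr scale0r (gen0 rho) fscale0r.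
have Z : (qpow (lam - lam0 + a) - qpow (lam0 - lam + b)) *: T 0%N 0%N = 0.
  apply: (fam_gen_inj hq hV (lam := lam)); apply/eqP; apply: contraT => nz.
  by have := fscale_neq0 hh nz; rewrite h eqxx.
apply: (qpow_inj hq); apply/eqP; rewrite -subr_eq0.
by move/eqP: Z; rewrite scaler_eq0 (negPf T00) orbF.
Qed.

End HighestVector.

Lemma noncompact n (a : simple_root n) : compact_root a = false -> a = beta.
Proof. by case: a. Qed.

(** * From one lambda to all, and the conclusion *)

Section Transfer.
Context (R : realType) (F : fieldType) (qpow : R[i] -> F) (hq : generic_powers qpow).
Context (m : nat).
Local Notation n := m.+1.
Local Notation q := (qpow 1).
Local Notation Uq := (Uq q n).
Local Notation root := (simple_root n).
Context (LL LR LL1 LR1 : m.-tuple nat).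
Context (V : vectType F) (rho : R[i] -> Uq -> 'End(V)) (v : V).
Hypothesis hV : @is_V_family R F qpow n LL LR V rho v.
Context (V1 : vectType F) (rho1 : R[i] -> Uq -> 'End(V1)) (v1 : V1).
Hypothesis hV1 : @is_V_family R F qpow n LL1 LR1 V1 rho1 v1.
Context (psi : {linear V1 -> tens (Aminus1 q n) V}).
Context (lam0 s : R[i]).
Hypothesis psi_hom : is_degree1_hom (rho1 (lam0 + s)) (rho lam0) psi.
Let q0 := q_neq0 hq.
Local Notation H := (isUq_Uq q n).

Definition psi_image lam u : verma (rho lam) := degree1_incl (rho lam) (psi u).

Lemma psi_imageD lam u w : psi_image lam (u + w) = psi_image lam u + psi_image lam w.
Proof. by rewrite /psi_image linearD (degree1_inclD (fam_rep hV lam)). Qed.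
Lemma psi_imageZ lam c u : psi_image lam (c *: u) = c **: psi_image lam u.
Proof. by rewrite /psi_image linearZ (degree1_inclZ (fam_rep hV lam)). Qed.
Lemma psi_image0 lam : psi_image lam 0 = 0.
Proof. by rewrite /psi_image linear0 (degree1_incl0 (fam_rep hV lam)). Qed.

(** By [famS_eq] the relation at [lam0] is one between coordinates in V, which no longer mentions
    lambda and can be read back in any M(V). The factor [d] serves K_beta, whose action scales with
    lambda. *)
Lemma transfer (g : Uq) (d : R[i] -> F) (op : (nat -> nat -> V) -> nat -> nat -> V) u u' :
  (forall lam x, g *: famS (rho lam) x = d lam **: famS (rho lam) (op x)) -> d lam0 = 1 ->
  psi_image lam0 u' = g *: psi_image lam0 u -> forall lam, d lam **: psi_image lam u' = g *: psi_image lam u.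
Proof.
move=> hg d0 h lam.
have [x [_ _ hx _]] := tens_coords (psi u); have [x' [_ _ hx' _]] := tens_coords (psi u').
have ix l : psi_image l u = famS (rho l) x by exact (hx _ (fam_rep hV l)).
have ix' l : psi_image l u' = famS (rho l) x' by exact (hx' _ (fam_rep hV l)).
have E : famS (rho lam0) x' = famS (rho lam0) (op x).
  by rewrite -ix' h ix (hg lam0 x) d0 fscale1.
rewrite ix' ix (hg lam x); apply: congr1.
by apply: (eq_famS rho) => i j hi hj; exact (famS_eq hq hV E hi hj).
Qed.

Lemma psi_hom0 (x : Uq) u : Uk x -> psi_image lam0 (rho1 (lam0 + s) x u) = x *: psi_image lam0 u.
Proof. by move=> hx; exact (psi_hom hx u). Qed.

Lemma image_op (g : Uq) (op : (nat -> nat -> V) -> nat -> nat -> V) :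
  Uk g -> (forall lam, rho1 lam g = rho1 (lam0 + s) g) ->
  (forall lam x, g *: famS (rho lam) x = famS (rho lam) (op x)) ->
  forall lam u, psi_image lam (rho1 (lam + s) g u) = g *: psi_image lam u.
Proof.
move=> Ug hs hg lam u; rewrite hs -(fscale1 (psi_image lam _)).
refine (@transfer g (fun=> 1) op u _ _ (erefl _) (psi_hom0 u Ug) lam).
by move=> l x; rewrite fscale1.
Qed.

Lemma image_E lam (a : root) u : compact_root a ->
  psi_image lam (rho1 (lam + s) (qE q a) u) = qE q a *: psi_image lam u.
Proof.
move=> ha; have hs l := same_E hV1 l (lam0 + s) ha; have Ug := Uk_qE q ha.
have [k [hk E]] := compact_case ha.
case: E hs Ug => -> hs Ug.
  exact (image_op Ug hs (fun l x => famS_E1 hq hV l x hk) lam u).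
exact (image_op Ug hs (fun l x => famS_E2 hq hV l x hk) lam u).
Qed.

Lemma image_F lam (a : root) u : compact_root a ->
  psi_image lam (rho1 (lam + s) (qF q a) u) = qF q a *: psi_image lam u.
Proof.
move=> ha; have hs l := same_F hV1 l (lam0 + s) ha; have Ug := Uk_qF q ha.
have [k [hk E]] := compact_case ha.
case: E hs Ug => -> hs Ug.
  exact (image_op Ug hs (fun l x => famS_F1 hq hV l x hk) lam u).
exact (image_op Ug hs (fun l x => famS_F2 hq hV l x hk) lam u).
Qed.

Lemma image_K lam (a : root) u : psi_image lam (rho1 (lam + s) (qK q a) u) = qK q a *: psi_image lam u.
Proof.
have [c [_ _ hc]] := famS_K hq hV a.
case ha: (compact_root a).
  apply: (image_op (op := fun x i j => c i j *: rho lam0 (qK q a) (x i j)) (Uk_qK q a)).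
    by move=> l; exact (same_K hV1 l (lam0 + s) ha).
  by move=> l x; rewrite hc (same_K hV l lam0 ha).
have -> : rho1 (lam + s) (qK q a) u = qpow (lam - lam0) *: rho1 (lam0 + s) (qK q a) u.
  rewrite (noncompact ha) (fam_Kbeta hq hV1 (lam0 + s) (lam + s)).
  by have -> : lam + s - (lam0 + s) = lam - lam0 by ring.
rewrite psi_imageZ.
apply: (transfer (d := fun l => qpow (l - lam0))
  (op := fun x i j => c i j *: rho lam0 (qK q a) (x i j)) _ _ (psi_hom0 u (Uk_qK q a))).
  move=> l x; rewrite hc -(famSZ hV); apply: (eq_famS rho) => i j _ _.
  by rewrite (noncompact ha) (fam_Kbeta hq hV lam0 l) !scalerA mulrC.
by rewrite subrr (qpow0 hq).
Qed.

(** The F's of k generate V1 from [v1], so psi would vanish on all of V1. *)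
Lemma image_v1_neq0 : (exists u, psi u <> 0) -> psi_image lam0 v1 <> 0.
Proof.
move=> [u hu] h; apply: hu.
have : psi_image lam0 u = 0.
  move: u; apply: (Fword_span hq hV1 (lam := lam0 + s) (P := fun u => psi_image lam0 u = 0)).
  - exact (psi_image0 lam0).
  - move=> u w hu hw; rewrite psi_imageD; exact (etrans (congr2 +%R hu hw) (addr0 0)).
  - by move=> c u hu; rewrite psi_imageZ hu fscale0r.
  elim=> [|a w IH] /=; first by rewrite h.
  by move=> /andP[ha /IH e]; rewrite (image_F lam0 _ ha) e scaler0.
have [x [o1 o2 hx z]] := tens_coords (psi u).
rewrite /psi_image hx; last exact (fam_rep hV lam0).
move=> e; apply: z => i j.
case: (leqP i m) => hi; last exact: o1.
case: (leqP j m) => hj; last exact: o2.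
exact (famS_inj hq hV e hi hj).
Qed.

Lemma image_Ebeta lam : qE q beta *: psi_image lam v1 = 0 -> forall u, qE q beta *: psi_image lam u = 0.
Proof.
move=> h; apply: (Fword_span hq hV1 (lam := lam + s) (P := fun u => qE q beta *: psi_image lam u = 0)).
- by rewrite psi_image0 scaler0.
- move=> u w hu hw; rewrite psi_imageD.
  exact (etrans (scalerDr _ _ _) (etrans (congr2 +%R hu hw) (addr0 0))).
- by move=> c u hu; rewrite psi_imageZ fscaleC hu fscale0r.
elim=> [|a w IH] /=; first by rewrite h.
move=> /andP[ha /IH e]; rewrite (image_F lam _ ha) scalerA.
have ne : beta <> a by move=> E; rewrite -E in ha.
by rewrite (preUq_EFC H ne) -scalerA e scaler0.
Qed.

Lemma extension_exists lam : (forall u, qE q beta *: psi_image lam u = 0) ->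
  exists f : verma (rho1 (lam + s)) -> verma (rho lam),
    [/\ is_hom_over (@AminusUk F q n) f, extends_degree1 psi f & linear f].
Proof.
move=> h.
have [f [fl fE]] := verma_lift (fam_rep hV1 (lam + s)) (fam_Z hV1 (lam + s)) (psi_imageD lam)
  (psi_imageZ lam) (fun a ha u => image_E lam u ha) (fun a ha u => image_F lam u ha)
  (image_K lam) h.
have f0 : f 0 = 0.
  by have := fl (-1) 0 0; rewrite scaler0 addr0 scaleN1r addNr.
exists f; split.
- split=> [x y|x _ y]; first by have := fl 1 x y; rewrite !scale1r.
  by have := fl x y 0; rewrite f0 !addr0.
- exact fE.
- exact fl.
Qed.

(** E_beta kills the generators of the source, and a U_q(g)-linear map carries this over to their
    images. *)
Lemma extension_Ebeta lam (f : verma (rho1 (lam + s)) -> verma (rho lam)) :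
  extends_degree1 psi f -> linear f -> qE q beta *: psi_image lam v1 = 0.
Proof.
move=> fE fl; have f0 : f 0 = 0.
  by have := fl (-1) 0 0; rewrite scaler0 addr0 scaleN1r addNr.
have := fl (qE q beta) (verma_gen (rho1 (lam + s)) v1) 0.
by rewrite f0 !addr0 (gen_Ebeta hV1) f0 fE => <-.
Qed.

Lemma unique_lambda : (exists u, psi u <> 0) ->
  exists! lam : R[i], exists f : verma (rho1 (lam + s)) -> verma (rho lam),
    [/\ is_hom_over (@AminusUk F q n) f, extends_degree1 psi f & linear f].
Proof.
move=> nz.
have [T [o1 o2 hT z]] := tens_coords (psi v1).
have iT lam : psi_image lam v1 = famS (rho lam) T by exact (hT _ (fam_rep hV lam)).
have T_E lam (a : root) : compact_root a -> qE q a *: famS (rho lam) T = 0.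
  by move=> ha; rewrite -iT -(image_E lam _ ha) (fam_Ev hV1 _ ha) psi_image0.
have T_K lam (a : root) : qK q a *: famS (rho lam) T =
    hw_weight qpow LL1 LR1 (lam + s) a **: famS (rho lam) T.
  by rewrite -iT -image_K (fam_Kv hV1) psi_imageZ.
have T00 : T 0%N 0%N != 0.
  apply: (T00_neq0 hq hV o1 o2 T_E); apply: contrapT => all0.
  apply: (image_v1_neq0 nz); rewrite iT.
  have -> : T = fun _ _ => 0.
    apply/funext => i; apply/funext => j; apply/eqP; apply: contraT => h.
    by case: all0; exists i, j.
  rewrite famSE big1 => [|j _]; first reflexivity.
  rewrite big1 => [|i _]; first reflexivity.
  by rewrite (gen0 rho) scaler0.
have [lam hlam] := Ebeta_eq0 hq hV o1 o2 T_E (fun l a => hw_weight_qpow hq LL1 LR1 (l + s) a) T_K T00 lam0.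
exists lam; split.
  by apply: extension_exists; apply: image_Ebeta; rewrite iT; exact/hlam.
move=> l [f [_ fE fl]]; apply/esym/hlam; rewrite -iT.
exact (extension_Ebeta fE fl).
Qed.
End Transfer.

(** [linear f] is linearity over U_q(g), the ring over which [verma] is a module. The homomorphism
    property of psi is assumed at one value [lam0]; the transfer lemmas extend it to all lambda. *)
Theorem proposition8p1 (R : realType) (F : fieldType)
    (charF : [pchar F] =i pred0)
    (qpow : R[i] -> F) (hq : generic_powers qpow)
    (n : nat) (hn : (1 <= n)%N)
    (LL LR LL1 LR1 : (n.-1).-tuple nat) (c : int)
    (V : vectType F) (rho : R[i] -> Uq (qpow 1) n -> 'End(V)) (v : V)
    (hV : is_V_family LL LR rho v)
    (V1 : vectType F) (rho1 : R[i] -> Uq (qpow 1) n -> 'End(V1)) (v1 : V1)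
    (hV1 : is_V_family LL1 LR1 rho1 v1)
    (psi : {linear V1 -> tens (Aminus1 (qpow 1) n) V})
    (psi_neq0 : exists u, psi u <> 0)
    (lam0 : R[i])
    (psi_hom : is_degree1_hom (rho1 (lam0 + c%:~R)) (rho lam0) psi) :
  exists! lam : R[i],
    exists f : verma (rho1 (lam + c%:~R)) -> verma (rho lam),
      [/\ is_hom_over (@AminusUk F (qpow 1) n) f,
          extends_degree1 psi f &
          linear f].
Proof.
case: n hn LL LR LL1 LR1 V rho v hV V1 rho1 v1 hV1 psi psi_neq0 lam0 psi_hom => [//|m] _.
move=> LL LR LL1 LR1 V rho v hV V1 rho1 v1 hV1 psi psi_neq0 lam0 psi_hom.
exact (unique_lambda hq hV hV1 psi_hom psi_neq0).
Qed.
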